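(* Let $d \ge 1$ be an integer and let $\nu$ be any probability distribution on the nonnegative integers. Then the probability that the frog model on $\mathbb{T}_d$ with i.i.d.-$\nu$ initial conditions is recurrent is either $0$ or $1$.
   Context: $\mathbb{T}_d$ is the infinite rooted tree in which every vertex has exactly $d$ children. Frog model on $\mathbb{T}_d$ with i.i.d.-$\nu$ initial conditions: initially there is one awake frog at the root, and the numbers of sleeping frogs at the non-root vertices are independent with distribution $\nu$. Awake frogs perform independent simple nearest-neighbor random walks in discrete time. Whenever a vertex is visited for the first time, all frogs sleeping there wake up and begin their own independent simple random walks from that vertex, waking frogs in the same way. A realization is called recurrent if the root is visited infinitely many times (in total, by all frogs). *)

(* Defs.v *)
From HB Require Import structures.
From mathcomp Require Import all_boot all_order all_algebra finmap.
From mathcomp Require Import all_classical all_reals all_analysis.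

Set Implicit Arguments.
Unset Strict Implicit.
Unset Printing Implicit Defensive.

Import Order.TTheory GRing.Theory Num.Theory.
Local Open Scope classical_set_scope.
Local Open Scope ring_scope.

(* A vertex of the rooted d-ary tree is its address read from the vertex up to
   the root: the root is [::], the children of v are the j :: v with j : 'I_d,
   and the parent of j :: v is v. *)
Definition vertex (d : nat) := seq 'I_d.

HB.instance Definition _ (d : nat) := Countable.on (vertex d).
HB.instance Definition _ (d : nat) := isPointed.Build (vertex d) [::].
HB.instance Definition _ (d : nat) := @isMeasurable.Build default_measure_display
  (vertex d) discrete_measurable discrete_measurable0
  discrete_measurableC discrete_measurableU.

Definition root_vertex (d : nat) : vertex d := [::].

Definition children (d : nat) (v : vertex d) : seq (vertex d) :=
  [seq j :: v | j <- enum 'I_d].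

Definition neighbors (d : nat) (v : vertex d) : seq (vertex d) :=
  if v is _ :: u then (u : vertex d) :: children v else children v.

Definition srw_step (R : realType) (d : nat) (u v : vertex d) : R :=
  if v \in neighbors u then (size (neighbors u))%:R^-1 else 0.

Section probability.
Context (R : realType) (dO : measure_display) (Omega : measurableType dO).
Variable P : probability Omega R.

Definition is_srw (d : nat) (v : vertex d) (X : nat -> {RV P >-> vertex d}) :=
  P [set w | X 0%N w = v] = 1%E /\
  forall (n : nat) (x : nat -> vertex d),
    P [set w | forall k, (k <= n.+1)%N -> X k w = x k] =
    (P [set w | forall k, (k <= n)%N -> X k w = x k]
     * (srw_step R (x n) (x n.+1))%:E)%E.

Definition mutually_independent (I : choiceType) (F : I -> set_system Omega) :=
  forall (J : {fset I}) (E : I -> set Omega),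
    (forall i, i \in J -> F i (E i)) ->
    P (\bigcap_(i in [set` J]) E i) = (\prod_(i <- J) P (E i))%E.

Definition sigma_process (dT : measure_display) (T : measurableType dT)
    (X : nat -> {RV P >-> T}) : set_system Omega :=
  <<s \bigcup_n g_sigma_algebra_preimage (X n) >>.

(* The index inl v stands for the number of frogs at v, the index inr (v, i)
   for the whole path of the i-th frog of v. *)
Definition frog_sigma (d : nat) (eta : vertex d -> {RV P >-> nat})
    (S : vertex d -> nat -> nat -> {RV P >-> vertex d})
    (a : vertex d + vertex d * nat) : set_system Omega :=
  match a with
  | inl v => g_sigma_algebra_preimage (eta v)
  | inr (v, i) => sigma_process (S v i)
  end.

(* eta v is the number of frogs initially at v; the frogs of v are (v, i) with
   i < eta v, and S v i n is the position of frog (v, i) after n steps of its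
   walk, counted from the moment it wakes up. The walks are given for every i,
   those with eta v <= i being unused. At the root the variable eta is the
   constant 1, so its presence in the independent family is harmless. *)
Record frog_model (d : nat) (nu : probability nat R)
    (eta : vertex d -> {RV P >-> nat})
    (S : vertex d -> nat -> nat -> {RV P >-> vertex d}) : Prop := FrogModel {
  frog_root : forall w, eta (root_vertex d) w = 1%N;
  frog_law : forall v, v != root_vertex d ->
    forall A : set nat, distribution P (eta v) A = nu A;
  frog_srw : forall v i, is_srw v (S v i);
  frog_indep : mutually_independent (frog_sigma eta S) }.

End probability.

Section dynamics.
(* One realization: eta and S are deterministic here. *)
Context (d : nat) (eta : vertex d -> nat).
Variable S : vertex d -> nat -> nat -> vertex d.

(* Position at time t of frog f, when wake v is the time of the first visit to
   v, or None if v is not visited yet; None if f does not exist or sleeps. *)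
Definition frog_pos (wake : vertex d -> option nat) (t : nat)
    (f : vertex d * nat) : option (vertex d) :=
  if wake f.1 is Some s then
    if (f.2 < eta f.1)%N then Some (S f.1 f.2 (t - s)%N) else None
  else None.

(* wake_time t v = Some s if v is first visited at time s <= t, and None if v
   is not visited up to time t. *)
Fixpoint wake_time (t : nat) (v : vertex d) : option nat :=
  if t is t'.+1 then
    if wake_time t' v is Some s then Some s
    else if `[< exists f, frog_pos (wake_time t') t f = Some v >] then Some t
    else None
  else if v == root_vertex d then Some 0%N else None.

Definition visits (v : vertex d) : set (nat * (vertex d * nat)) :=
  [set tf | frog_pos (wake_time tf.1) tf.1 tf.2 = Some v].

Definition recurrent : Prop := infinite_set (visits (root_vertex d)).

End dynamics.

(* Main.v *)
From HB Require Import structures.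
Require Import Defs.
From mathcomp Require Import all_boot all_order all_algebra finmap perm.
From mathcomp Require Import all_classical all_reals all_analysis.
From mathcomp Require Import ring lra zify.

Set Implicit Arguments.
Unset Strict Implicit.
Unset Printing Implicit Defensive.

Import Order.TTheory GRing.Theory Num.Theory.
Import numFieldNormedType.Exports.
Local Open Scope classical_set_scope.
Local Open Scope ring_scope.

(* By the abelian property, the number of departures from the root does not depend on
   the order in which the awake frogs move. Its distribution is therefore a function of
   the state: the probability phi_m(s) of at least m departures is the least
   superharmonic function, in the sense of one frog moving and waking the frogs of the
   new vertex; phi_m is invariant under every move.

   Let p be the infimum over m of phi_m at the initial state, and suppose p > 0. Let q
   be the probability that a frog started at a child z of the root, the only awake frog,
   leads to a visit of the root.
   If q = 1, then the subtree of z behaves as the whole tree with an exit that is taken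
   with probability bounded below at each visit; since the exit is taken almost surely,
   there are almost surely m returns, for all m.
   If q < 1 and no frog sleeps, a single walk returns m times with probability at most
   q^m, whence p = 0. Otherwise, rerooting the tree at a vertex y shows that a frog
   started at y visits the root with probability bounded below: after reaching a
   recurrent configuration grafted below y, whose spare frogs replace those that are
   lost, it does as well as in the pruned tree. Since each frog reaching a child of the
   root fails with probability 1 - q > 0, many frogs must be available far from the
   root; hence every state with finitely many visited vertices and an awake frog has
   phi_m >= i for all m and a constant i > 0. Then (phi_m - i) / (1 - i) is still
   superharmonic on such states, and minimality of phi_m yields phi_m = 1.

   Exploring the frogs one step at a time identifies phi_m at the initial state with
   the probability of at least m visits of the root. *)

(** Recurrence is not evidently a tail event: one early path can change who wakes up. What stands in
    for Levy's zero-one law is the affine step [(phi - i) / (1 - i)], which needs only a lower bound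
    valid at every state that finitely many moves can produce. Visited vertices are the obstacle to
    such a bound, since they have no sleepers left; hence the detour through a far, untouched
    subtree.

    Defining the probabilities as infima over superharmonic functions avoids building a process on
    each modified tree (pruned, frozen): a comparison is a one-step inequality, and a coupling
    becomes a relation between states and values ([phi_rel]). Arguments of the kind: infinitely many
    attempts, each succeeding with probability at least k, become [bootstrap]: the best c in
    [c * g <= f] cannot be improved, so it is 1.

    Constants: [step_prob] = 1/(d+1) bounds any single step; delta bounds the chance to visit the
    root from every 0^(n+1); delta / 2 is what is left for C frogs to arrive there, and delta / 4
    includes the factor 1/2 for the m departures that C frogs cause. *)

Definition bnd (R : realType) (T : Type) (f : T -> R) := exists M, forall t, `|f t| <= M.

Section bnd_lemmas.
Context (R : realType) (T : Type).
Implicit Types f g : T -> R.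

Lemma bnd_cst c : bnd (fun _ : T => c : R).
Proof. by exists `|c|. Qed.

Lemma bnd01 f : (forall t, 0 <= f t <= 1) -> bnd f.
Proof. by move=> h; exists 1 => t; have := h t; rewrite ler_norml; lra. Qed.

Lemma bndD f g : bnd f -> bnd g -> bnd (fun t => f t + g t).
Proof.
by move=> [M hM] [N hN]; exists (M + N) => t; apply: le_trans (ler_normD _ _) (lerD _ _).
Qed.

Lemma bndM f g : bnd f -> bnd g -> bnd (fun t => f t * g t).
Proof. by move=> [M hM] [N hN]; exists (M * N) => t; rewrite normrM ler_pM. Qed.

Lemma bndN f : bnd f -> bnd (fun t => - f t).
Proof. by move=> [M hM]; exists M => t; rewrite normrN. Qed.

Lemma bndB f g : bnd f -> bnd g -> bnd (fun t => f t - g t).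
Proof. by move=> hf hg; apply: bndD => //; apply: bndN. Qed.

Lemma bnd_comp (U : Type) (h : U -> T) f : bnd f -> bnd (fun u => f (h u)).
Proof. by move=> [M hM]; exists M. Qed.

End bnd_lemmas.

(** * Expectation over the number of frogs found at a new vertex *)

HB.lock Definition Ex (R : realType) (nu : probability nat R) (f : nat -> R) : R :=
  Rintegral nu setT f.

Section expectation.
Context (R : realType) (nu : probability nat R).
Implicit Types f g : nat -> R.
Local Notation Ex := (Ex nu).

Lemma Ex_integrable f : bnd f -> nu.-integrable setT (EFin \o f).
Proof.
move=> [M hM]; apply: measurable_bounded_integrable => //.
  by apply: (@le_lt_trans _ _ 1%E); rewrite ?probability_le1 // ltry.
exists M; split; first by rewrite num_real.
by move=> x Mx y _ /=; apply: le_trans (hM y) (ltW Mx).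
Qed.

Lemma Ex_cst c : Ex (fun=> c) = c.
Proof.
rewrite unlock Rintegral_cst //.
by have := congr1 (fun x => c * fine x) (probability_setT nu); rewrite /= mulr1.
Qed.

Lemma Ex_le f g : bnd f -> bnd g -> (forall k, f k <= g k) -> Ex f <= Ex g.
Proof. by move=> hf hg fg; rewrite unlock; apply: le_Rintegral => //; apply: Ex_integrable. Qed.

Lemma ExD f g : bnd f -> bnd g -> Ex (fun k => f k + g k) = Ex f + Ex g.
Proof. by move=> hf hg; rewrite unlock RintegralD //; apply: Ex_integrable. Qed.

Lemma ExZ c f : bnd f -> Ex (fun k => c * f k) = c * Ex f.
Proof. by move=> hf; rewrite unlock RintegralZl //; apply: Ex_integrable. Qed.

Lemma Ex_ge0 f : (forall k, 0 <= f k) -> 0 <= Ex f.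
Proof. by move=> hf; rewrite unlock; apply: Rintegral_ge0 => x _. Qed.

Lemma eq_Ex f g : f =1 g -> Ex f = Ex g.
Proof. by move=> /funext ->. Qed.

Lemma Ex_E f : bnd f -> (Ex f)%:E = (\int[nu]_k (f k)%:E)%E.
Proof.
move=> hf; rewrite unlock /Rintegral fineK //.
by apply: integrable_fin_num => //; apply: Ex_integrable.
Qed.

Lemma measurable_nat2 (A : set (nat * nat)) : measurable A.
Proof.
have -> : A = \bigcup_n \bigcup_m ((if `[< A (n, m) >] then [set n] else set0) `*` [set m]).
  apply/seteqP; split.
    move=> [n m] Anm; exists n => //; exists m => //; split => //=.
    by case: asboolP.
  move=> [n m] [n' _] [m' _] [/=]; case: asboolP => //= A' -> ->.
  exact: A'.
apply: bigcupT_measurable => n; apply: bigcupT_measurable => m.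
by apply: measurableX.
Qed.

Lemma Ex_swap (f : nat -> nat -> R) :
  bnd (fun p : nat * nat => f p.1 p.2) ->
  Ex (fun k => Ex (fun l => f k l)) = Ex (fun l => Ex (fun k => f k l)).
Proof.
(* Adding the bound M makes the integrand nonnegative, where Tonelli applies; M is then cancelled on
   both sides. *)
suff pos (g : nat -> nat -> R) : (forall k l, 0 <= g k l) ->
    bnd (fun p : nat * nat => g p.1 p.2) ->
    Ex (fun k => Ex (fun l => g k l)) = Ex (fun l => Ex (fun k => g k l)).
  move=> hf; have [M hM] := hf.
  have hfM : bnd (fun p : nat * nat => f p.1 p.2 + M).
    by apply: bndD hf _; apply: bnd_cst.
  have fk k : bnd (f k) by exists M => l; apply: (hM (k, l)).
  have fl l : bnd (f ^~ l) by exists M => k; apply: (hM (k, l)).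
  have ExM (h : nat -> R) : (forall k, `|h k| <= M) -> `|Ex h| <= M.
    move=> hh; have bh : bnd h by exists M.
    rewrite ler_norml; apply/andP; split.
      rewrite -(Ex_cst (- M)); apply: Ex_le => //; first exact: bnd_cst.
      by move=> k; have := hh k; rewrite ler_norml => /andP[].
    rewrite -[leRHS](Ex_cst M); apply: Ex_le => //; first exact: bnd_cst.
    by move=> k; have := hh k; rewrite ler_norml => /andP[].
  have E1 : Ex (fun k => Ex (fun l => f k l + M)) = Ex (fun k => Ex (fun l => f k l)) + M.
    under eq_Ex do rewrite (ExD (fk _) (bnd_cst _ _)) Ex_cst.
    rewrite ExD ?Ex_cst //; last exact: bnd_cst.
    by exists M => k; apply: ExM => l; apply: (hM (k, l)).
  have E2 : Ex (fun l => Ex (fun k => f k l + M)) = Ex (fun l => Ex (fun k => f k l)) + M.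
    under eq_Ex do rewrite (ExD (fl _) (bnd_cst _ _)) Ex_cst.
    rewrite ExD ?Ex_cst //; last exact: bnd_cst.
    by exists M => l; apply: ExM => k; apply: (hM (k, l)).
  have := pos (fun k l => f k l + M) _ hfM; rewrite E1 E2.
  move=> h; apply: (addIr M); apply: h => k l.
  by have := hM (k, l); rewrite ler_norml /=; lra.
move=> g0 hg; have [M hM] := hg.
have gk k : bnd (g k) by exists M => l; apply: (hM (k, l)).
have gl l : bnd (g ^~ l) by exists M => k; apply: (hM (k, l)).
apply: EFin_inj.
have ExM (h : nat -> R) : (forall k, 0 <= h k <= M) -> 0 <= Ex h <= M.
  move=> hh; rewrite Ex_ge0 /=; last by move=> k; case/andP: (hh k).
  rewrite -[leRHS](Ex_cst M); apply: Ex_le; [|exact: bnd_cst|by move=> k; case/andP: (hh k)].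
  by exists M => k; rewrite ger0_norm; case/andP: (hh k).
have gM k l : 0 <= g k l <= M.
  by rewrite g0 /=; have := hM (k, l); rewrite /= ger0_norm.
have bN (h : nat -> R) : (forall k, 0 <= h k <= M) -> bnd h.
  by move=> hh; exists M => k; rewrite ger0_norm; case/andP: (hh k).
rewrite !Ex_E; [|by apply: bN => l; apply: ExM|by apply: bN => k; apply: ExM].
under eq_integral do rewrite Ex_E //.
under [RHS]eq_integral do rewrite Ex_E //.
apply: (@fubini_tonelli _ _ _ _ R nu nu (fun p : nat * nat => (g p.1 p.2)%:E)).
  by move=> _ Y mY; rewrite setTI; apply: measurable_nat2.
by move=> p; rewrite lee_fin.
Qed.

Lemma Ex_cvg (f : nat -> nat -> R) (g : nat -> R) :
  (forall n k, 0 <= f n k <= 1) -> (forall k, f ^~ k @ \oo --> g k) ->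
  (fun n => Ex (f n)) @ \oo --> Ex g.
Proof.
move=> f01 fg.
have bf n : bnd (f n) by apply: bnd01.
have g01 k : 0 <= g k <= 1.
  have cvf : cvgn (f ^~ k) by apply/cvg_ex; exists (g k); apply: fg.
  have <- : limn (f ^~ k) = g k by apply: cvg_lim => //; apply: fg.
  apply/andP; split.
    by apply: limr_ge => //; apply: nearW => n; case/andP: (f01 n k).
  by apply: limr_le => //; apply: nearW => n; case/andP: (f01 n k).
have h : (fun n => (Ex (f n))%:E) @ \oo --> (Ex g)%:E.
  rewrite Ex_E; last exact: bnd01.
  under eq_fun do rewrite Ex_E //.
  apply: (@dominated_cvg _ nat R nu setT measurableT (fun n k => (f n k)%:E)
    (fun k => (g k)%:E) (fun=> 1%E)).
  - by [].
  - by move=> k _; apply/fine_cvgP; split; [exact: nearW|exact: fg].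
  - by [].
  - exact: (Ex_integrable (bnd_cst nat (1 : R))).
  - by move=> n k _; rewrite /= lee_fin ger0_norm; case/andP: (f01 n k).
by move/fine_cvgP: h => [].
Qed.

(** The error [f k - f 0] is at most 2M in absolute value and vanishes at k = 0, so it is dominated
    by a function of zero expectation. *)
Lemma Ex_at0 f : bnd f -> Ex (fun k => (0 < k)%N%:R) = 0 -> Ex f = f 0%N.
Proof.
move=> hf E0; have [M hM] := hf.
have b1 : bnd (fun k : nat => (0 < k)%N%:R : R).
  by apply: bnd01 => k; case: (0 < k)%N; rewrite !(ler0n, lexx, ler01).
have M0 : 0 <= M by apply: le_trans (hM 0%N).
have bc := bndM (bnd_cst nat (2 * M)) b1.
apply/eqP; rewrite eq_le; apply/andP; split.
  rewrite -[leRHS]addr0 -(mulr0 (2 * M)) -E0 -ExZ // -[X in X + _]Ex_cst -ExD //; last exact: bnd_cst.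
  apply: Ex_le => //; first by apply: bndD => //; exact: bnd_cst.
  case=> [|k] /=; first by rewrite mulr0 addr0.
  by have := hM k.+1; have := hM 0%N; rewrite !ler_norml mulr1; lra.
rewrite -[leRHS]addr0 -(mulr0 (2 * M)) -E0 -ExZ // -[X in X <= _]Ex_cst -ExD //.
apply: Ex_le => //; [exact: bnd_cst|by apply: bndD|].
case=> [|k] /=; first by rewrite mulr0 addr0.
by have := hM k.+1; have := hM 0%N; rewrite !ler_norml mulr1; lra.
Qed.

End expectation.

(** * States and topplings *)

Section states.
Context (V : eqType).

(* The set of visited vertices and the number of awake frogs at each vertex. *)
Definition state : Type := ((V -> bool) * (V -> nat))%type.
Implicit Types (s : state) (D : V -> bool) (a : V -> nat) (x y z : V).

Definition vis z D : V -> bool := fun u => (u == z) || D u.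
Definition add z k a : V -> nat := fun u => (a u + k * (u == z))%N.
Definition rm x a : V -> nat := fun u => (a u - (u == x))%N.
Definition mv x z a : V -> nat := add z 1 (rm x a).

Lemma addC z k z' k' a : add z k (add z' k' a) = add z' k' (add z k a).
Proof. by apply/funext => u; rewrite /add addnAC. Qed.

Lemma add0 z a : add z 0 a = a.
Proof. by apply/funext => u; rewrite /add mul0n addn0. Qed.

Lemma rm_add x z k a : (0 < a x)%N -> rm x (add z k a) = add z k (rm x a).
Proof. by move=> ax; apply/funext => u; rewrite /rm /add; case: (u =P x) => [->|_]; lia. Qed.

Lemma rm_add1 x a : rm x (add x 1 a) = a.
Proof. by apply/funext => u; rewrite /rm /add; lia. Qed.

Lemma add_rm1 x a : (0 < a x)%N -> add x 1 (rm x a) = a.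
Proof. by move=> ax; apply/funext => u; rewrite /rm /add; case: (u =P x) => [->|_]; lia. Qed.

Lemma rmC x y a : rm x (rm y a) = rm y (rm x a).
Proof. by apply/funext => u; rewrite /rm; lia. Qed.

Lemma mv_add1 x z a : mv x z (add x 1 a) = add z 1 a.
Proof. by rewrite /mv rm_add1. Qed.

Lemma mv_add x z y k a : (0 < a x)%N -> mv x z (add y k a) = add y k (mv x z a).
Proof. by move=> ax; rewrite /mv rm_add // addC. Qed.

Lemma add_gt0 z k a x : (0 < a x)%N -> (0 < add z k a x)%N.
Proof. by rewrite /add; lia. Qed.

Lemma add1_gt0 z a : (0 < add z 1 a z)%N.
Proof. by rewrite /add eqxx; lia. Qed.

Lemma mv_gt0 x z a y : y != x -> (0 < a y)%N -> (0 < mv x z a y)%N.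
Proof. by move=> /negPf yx; rewrite /mv /add /rm yx; lia. Qed.

Lemma mv_gt0z x z a : (0 < mv x z a z)%N.
Proof. exact: add1_gt0. Qed.

Lemma rm_mv x y z a : x != y -> (0 < a x)%N -> rm x (mv y z a) = mv y z (rm x a).
Proof.
move=> /negPf xy ax; apply/funext => u; rewrite /mv /add /rm.
by case: (u =P x) => [->|_]; rewrite ?xy; lia.
Qed.

End states.

Section operators.
Context (R : realType) (nu : probability nat R) (V : eqType).
Implicit Types (s : state V) (D : V -> bool) (a : V -> nat) (x y z : V).
Implicit Types (f g : state V -> R) (nb : V -> seq V).
Local Notation E := (Ex nu).

(** Numbers of sleeping frogs are not part of a state: the number at [z] is drawn from [nu] only at
    the first visit of [z]. *)
Definition awaken z f s : R :=
  if s.1 z then f s else E (fun k => f (vis z s.1, add z k s.2)).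

(* A frog standing at a vertex without neighbours is removed. *)
Definition topple nb x f s : R :=
  if nb x is [::] then f (s.1, rm x s.2)
  else (size (nb x))%:R^-1 * \sum_(z <- nb x) awaken z f (s.1, mv x z s.2).

Lemma bnd_wake z f : bnd f -> bnd (awaken z f).
Proof.
move=> [M hM]; exists M => s; rewrite /awaken; case: ifP => // _.
have bf : bnd (fun k => f (vis z s.1, add z k s.2)) by exists M.
rewrite ler_norml; apply/andP; split.
  rewrite -(Ex_cst nu (- M)); apply: Ex_le => //; first exact: bnd_cst.
  by move=> k; have := hM (vis z s.1, add z k s.2); rewrite ler_norml => /andP[].
rewrite -[leRHS](Ex_cst nu M); apply: Ex_le => //; first exact: bnd_cst.
by move=> k; have := hM (vis z s.1, add z k s.2); rewrite ler_norml => /andP[].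
Qed.

Lemma bnd_slice f D a z : bnd f -> bnd (fun k => f (D, add z k a)).
Proof. by move=> [M hM]; exists M. Qed.

Lemma wake_le z z' f g s s' : bnd f -> bnd g -> s.1 z = s'.1 z' ->
  (s.1 z -> f s <= g s') ->
  (~~ s.1 z -> forall k, f (vis z s.1, add z k s.2) <= g (vis z' s'.1, add z' k s'.2)) ->
  awaken z f s <= awaken z' g s'.
Proof.
move=> bf bg e h1 h2; rewrite /awaken -e; case: ifP => [/h1 //|/negbT h].
by apply: Ex_le; [exact: bnd_slice|exact: bnd_slice|exact: h2].
Qed.

Lemma wake_cst z (c : R) s : awaken z (fun=> c) s = c.
Proof. by rewrite /awaken Ex_cst if_same. Qed.

Lemma wakeD z f g s : bnd f -> bnd g ->
  awaken z (fun s => f s + g s) s = awaken z f s + awaken z g s.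
Proof.
by move=> bf bg; rewrite /awaken; case: ifP => // _; rewrite ExD //; exact: bnd_slice.
Qed.

Lemma wakeZ z c f s : bnd f -> awaken z (fun s => c * f s) s = c * awaken z f s.
Proof.
by move=> bf; rewrite /awaken; case: ifP => // _; rewrite ExZ //; exact: bnd_slice.
Qed.

Lemma size_inv_ge0 nb x : 0 <= ((size (nb x))%:R^-1 : R).
Proof. by rewrite invr_ge0 ler0n. Qed.

(** Engine of the one-step comparisons between two systems, possibly on different graphs: once [i]
    matches the neighbours, the outcomes are compared neighbour by neighbour. *)
Lemma top_transfer nb nb' (i : V -> V) x x' f g s s' : bnd f -> bnd g ->
  perm_eq (nb' x') (map i (nb x)) ->
  (nb x = [::] -> g (s'.1, rm x' s'.2) <= f (s.1, rm x s.2)) ->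
  (forall z, z \in nb x ->
     awaken (i z) g (s'.1, mv x' (i z) s'.2) <= awaken z f (s.1, mv x z s.2)) ->
  topple nb' x' g s' <= topple nb x f s.
Proof.
move=> bf bg pm h0 h1; rewrite /topple.
have sz : size (nb' x') = size (nb x) by rewrite (perm_size pm) size_map.
case E1 : (nb x) => [|u l].
  by rewrite E1 in sz; move/size0nil: sz => ->; apply: h0.
case E2 : (nb' x') => [|u' l']; first by rewrite E1 E2 in sz.
rewrite -E1 -E2 sz; apply: ler_wpM2l; first exact: size_inv_ge0.
by rewrite (perm_big _ pm) /= big_map big_seq [leRHS]big_seq; apply: ler_sum.
Qed.

Lemma top_transfer_rev nb nb' (i : V -> V) x x' f g s s' : bnd f -> bnd g ->
  perm_eq (nb x) (map i (nb' x')) ->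
  (nb' x' = [::] -> g (s'.1, rm x' s'.2) <= f (s.1, rm x s.2)) ->
  (forall z, z \in nb' x' ->
     awaken z g (s'.1, mv x' z s'.2) <= awaken (i z) f (s.1, mv x (i z) s.2)) ->
  topple nb' x' g s' <= topple nb x f s.
Proof.
move=> bf bg pm h0 h1; rewrite /topple.
have sz : size (nb x) = size (nb' x') by rewrite (perm_size pm) size_map.
case E1 : (nb' x') => [|u l].
  by rewrite E1 in sz; move/size0nil: sz => ->; apply: h0.
case E2 : (nb x) => [|u' l']; first by rewrite E1 E2 in sz.
rewrite -E1 -E2 sz; apply: ler_wpM2l; first exact: size_inv_ge0.
by rewrite (perm_big _ pm) /= big_map big_seq [leRHS]big_seq; apply: ler_sum.
Qed.

(** The comparison is only needed where the visited set has grown and no frog has left a vertex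
    other than [x]; this is how a second frog is known to be still available after the move. *)
Lemma top_le nb x f g s : bnd f -> bnd g ->
  (forall s', (forall u, s.1 u -> s'.1 u) -> (forall u, u != x -> (s.2 u <= s'.2 u)%N) ->
     f s' <= g s') ->
  topple nb x f s <= topple nb x g s.
Proof.
move=> bf bg h; apply: (@top_transfer _ _ id) => //; first by rewrite map_id.
  by move=> _; apply: h => // u /negPf ux /=; rewrite /rm ux subn0.
move=> z _; apply: wake_le => //= [_|_ k]; apply: h => //= u.
- by move=> /negPf ux; rewrite /mv /add /rm ux; lia.
- by rewrite /vis => ->; rewrite orbT.
- by move=> /negPf ux; rewrite /mv /add /rm ux; lia.
Qed.

Lemma top_mono nb x f g s : bnd f -> bnd g -> (forall s', f s' <= g s') ->
  topple nb x f s <= topple nb x g s.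
Proof. by move=> bf bg h; apply: top_le. Qed.

Lemma top_cst nb x (c : R) s : topple nb x (fun=> c) s = c.
Proof.
rewrite /topple; case E1 : (nb x) => [//|u l]; rewrite -E1.
under eq_bigr do rewrite wake_cst.
rewrite big_const_seq iter_addr_0 count_predT -[c *+ _]mulr_natl mulrA mulVf ?mul1r //.
by rewrite E1 pnatr_eq0.
Qed.

Lemma topD nb x f g s : bnd f -> bnd g ->
  topple nb x (fun s => f s + g s) s = topple nb x f s + topple nb x g s.
Proof.
move=> bf bg; rewrite /topple; case E1 : (nb x) => [//|u l]; rewrite -E1.
under eq_bigr do rewrite wakeD //.
by rewrite big_split mulrDr.
Qed.

Lemma topZ nb x c f s : bnd f -> topple nb x (fun s => c * f s) s = c * topple nb x f s.
Proof.
move=> bf; rewrite /topple; case E1 : (nb x) => [//|u l]; rewrite -E1.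
under eq_bigr do rewrite wakeZ //.
by rewrite -mulr_sumr mulrCA.
Qed.

Lemma top_affine nb x (c k : R) f s : bnd f ->
  topple nb x (fun s => c + k * f s) s = c + k * topple nb x f s.
Proof.
move=> bf; rewrite topD ?topZ ?top_cst //; first exact: bnd_cst.
by apply: bndM => //; exact: bnd_cst.
Qed.

Lemma topB nb x f g s : bnd f -> bnd g ->
  topple nb x (fun s => f s - g s) s = topple nb x f s - topple nb x g s.
Proof.
move=> bf bg; rewrite topD //; last exact: bndN.
have -> : (fun s => - g s) = (fun s => -1 * g s) by apply/funext => t; rewrite mulN1r.
by rewrite topZ // mulN1r.
Qed.

Lemma bnd_top nb x f : bnd f -> bnd (topple nb x f).
Proof.
move=> bf; have [M hM] := bf; exists M => s; rewrite ler_norml; apply/andP; split.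
  rewrite -(top_cst nb x (- M) s); apply: top_mono => //; first exact: bnd_cst.
  by move=> t; have := hM t; rewrite ler_norml => /andP[].
rewrite -[leRHS](top_cst nb x M s); apply: top_mono => //; first exact: bnd_cst.
by move=> t; have := hM t; rewrite ler_norml => /andP[].
Qed.

Lemma top01 nb x f s : (forall t, 0 <= f t <= 1) -> 0 <= topple nb x f s <= 1.
Proof.
move=> f01; have bf := bnd01 f01; apply/andP; split.
  rewrite -(top_cst nb x 0 s); apply: top_mono => //; first exact: bnd_cst.
  by move=> t; case/andP: (f01 t).
rewrite -[leRHS](top_cst nb x 1 s); apply: top_mono => //; first exact: bnd_cst.
by move=> t; case/andP: (f01 t).
Qed.

Lemma wake_ge0 z f s : (forall t, 0 <= f t) -> 0 <= awaken z f s.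
Proof. by move=> f0; rewrite /awaken; case: ifP => // _; apply: Ex_ge0. Qed.

Lemma top_ge1 nb x z f s : (forall t, 0 <= f t) -> z \in nb x ->
  (size (nb x))%:R^-1 * awaken z f (s.1, mv x z s.2) <= topple nb x f s.
Proof.
move=> f0 zx; rewrite /topple; case E1 : (nb x) zx => [//|u l] zx; rewrite -E1 in zx *.
apply: ler_wpM2l; first exact: size_inv_ge0.
rewrite (big_rem z) //= lerDl; apply: sumr_ge0 => y _; exact: wake_ge0.
Qed.

Lemma wake_lb z f s (c : R) : bnd f -> (forall s', s'.1 z -> (forall u, s.1 u -> s'.1 u) ->
    (forall u, (s.2 u <= s'.2 u)%N) -> c <= f s') ->
  c <= awaken z f s.
Proof.
move=> bf h; rewrite /awaken; case: ifP => [sz|_]; first exact: h.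
rewrite -(Ex_cst nu c); apply: Ex_le; [exact: bnd_cst|exact: bnd_slice|].
move=> k; apply: h => /= [|u su|u]; rewrite /vis /add ?eqxx ?su ?orbT //; lia.
Qed.

(* The moves of two distinct frogs commute. *)
Lemma wakeC z z' f D a1 a2 :
  bnd f -> a1 = a2 ->
  (if D z then awaken z' f (D, a1) else E (fun k => awaken z' f (vis z D, add z k a1))) =
  (if D z' then awaken z f (D, a2) else E (fun k => awaken z f (vis z' D, add z' k a2))).
Proof.
move=> bf <-; rewrite /awaken /=.
have [->|zz'] := eqVneq z z'.
  case: ifP => // Dz'; apply: eq_Ex => k; rewrite /vis eqxx //.
case Dz : (D z); case Dz' : (D z') => //=.
- by rewrite /vis Dz orbT.
- by apply: eq_Ex => k; rewrite /vis Dz' orbT.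
rewrite /vis (negPf zz') eq_sym (negPf zz') Dz Dz' /=.
rewrite Ex_swap; last by have [M hM] := bf; exists M => p.
apply: eq_Ex => k; apply: eq_Ex => l; rewrite addC; congr (f (_, _)).
by apply/funext => u; rewrite orbCA.
Qed.

Lemma wake_wake_mv x y z z' f D a : bnd f -> x != y -> (0 < a x)%N -> (0 < a y)%N ->
  awaken z (fun s => awaken z' f (s.1, mv y z' s.2)) (D, mv x z a) =
  awaken z' (fun s => awaken z f (s.1, mv x z s.2)) (D, mv y z' a).
Proof.
move=> bf xy ax ay.
have e : mv y z' (mv x z a) = mv x z (mv y z' a).
  apply/funext => u; rewrite /mv /add /rm.
  case: (u =P x) => [->|_]; first by rewrite (negPf xy); lia.
  by case: (u =P y) => [->|_]; lia.
have out u v u' v' : u != v -> (0 < a u)%N -> (0 < a v)%N ->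
    awaken u' (fun s => awaken v' f (s.1, mv v v' s.2)) (D, mv u u' a) =
    (if D u' then awaken v' f (D, mv v v' (mv u u' a))
     else E (fun k => awaken v' f (vis u' D, add u' k (mv v v' (mv u u' a))))).
  move=> uv au av; rewrite [LHS]/awaken [(D, _).1]/=; case: ifP => // _; apply: eq_Ex => k /=.
  by rewrite mv_add // mv_gt0 // eq_sym.
by rewrite !out //; [exact: wakeC|rewrite eq_sym].
Qed.

Lemma wake_avg z (c : R) (l : seq V) x f s : bnd f ->
  awaken z (fun s => c * \sum_(z' <- l) awaken z' f (s.1, mv x z' s.2)) s =
  c * \sum_(z' <- l) awaken z (fun s => awaken z' f (s.1, mv x z' s.2)) s.
Proof.
move=> bf; have bs l1 : bnd (fun s => \sum_(z' <- l1) awaken z' f (s.1, mv x z' s.2)).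
  elim: l1 => [|z1 l1 IH]; first by under eq_fun do rewrite big_nil; exact: bnd_cst.
  under eq_fun do rewrite big_cons.
  by apply: bndD => //; apply: (bnd_comp _ (bnd_wake z1 bf)).
rewrite wakeZ //; congr (_ * _); elim: l => [|z1 l IH].
  by under eq_fun do rewrite big_nil; rewrite wake_cst big_nil.
under eq_fun do rewrite big_cons.
rewrite wakeD //; last by apply: (bnd_comp _ (bnd_wake z1 bf)).
by rewrite big_cons IH.
Qed.

(** Revealing the sleepers of [z] and moving a frog that is already awake are independent
    operations; occupancy of [x] ensures that the moved frog is not one of those just woken. *)
Lemma wake_top nb z x f s : bnd f -> (0 < s.2 x)%N ->
  awaken z (topple nb x f) s = topple nb x (awaken z f) s.
Proof.
case: s => D a /= bf ax; rewrite [in RHS]/topple.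
case Ex1 : (nb x) => [|u l].
  rewrite /topple Ex1 /awaken /=; case: ifP => // _; apply: eq_Ex => k; by rewrite rm_add.
have -> : topple nb x f = fun s => (size (u :: l))%:R^-1 *
    \sum_(z' <- u :: l) awaken z' f (s.1, mv x z' s.2) by apply/funext => t; rewrite /topple Ex1.
rewrite wake_avg //; congr (_ * _); apply: eq_bigr => z' _ /=.
have e : mv x z' a = mv x z' a by [].
have w := wakeC z z' D bf e; rewrite [RHS]/awaken [(D, _).1]/= [(D, _).2]/= -w.
rewrite [LHS]/awaken [(D, _).1]/=; case: ifP => // _.
by apply: eq_Ex => k /=; rewrite mv_add.
Qed.

(** One-step form of the abelian property. Both vertices must be occupied, as [rm] truncates at
    0. *)
Lemma topC nb x y f s : bnd f -> x != y -> (0 < s.2 x)%N -> (0 < s.2 y)%N ->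
  topple nb y (topple nb x f) s = topple nb x (topple nb y f) s.
Proof.
case: s => D a /= bf xy ax ay.
have yx : y != x by rewrite eq_sym.
rewrite /topple /=.
case Ex1 : (nb x) => [|u l]; case Ey : (nb y) => [|u' l'] //=;
  [|set l1 := u' :: l'|set l1 := u :: l|set l1 := u :: l; set l2 := u' :: l'].
- by rewrite rmC.
- congr (_ * _); apply: eq_bigr => z _; rewrite /awaken /=; case: ifP => _; first by rewrite rm_mv.
  by apply: eq_Ex => k; rewrite rm_add ?mv_gt0 // rm_mv.
- congr (_ * _); apply: eq_bigr => z _; rewrite /awaken /=; case: ifP => _; first by rewrite rm_mv.
  by apply: eq_Ex => k; rewrite rm_add ?mv_gt0 // rm_mv.
under eq_bigr do rewrite wake_avg //.
under [in RHS]eq_bigr do rewrite wake_avg //.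
rewrite -!mulr_sumr mulrCA; congr (_ * (_ * _)); rewrite exchange_big /=.
by apply: eq_bigr => z _; apply: eq_bigr => z' _; rewrite wake_wake_mv.
Qed.

End operators.

(** * Hitting probabilities as least superharmonic functions *)

Section value.
Context (R : realType) (nu : probability nat R) (V : eqType) (nb : V -> seq V) (r : V).
Implicit Types (s : state V) (D : V -> bool) (a : V -> nat) (x y z : V).
Implicit Types (f g : nat -> state V -> R).
Local Notation E := (Ex nu).
Local Notation top := (topple nu nb).
Local Notation wake := (awaken nu).

(** The index is the number of departures from [r] still wanted, so a move from [r] lowers it by
    one. *)
Definition superharmonic f : Prop :=
  [/\ forall m s, 0 <= f m s <= 1, forall s, f 0%N s = 1 &
      forall m s x, (0 < s.2 x)%N -> top x (f (m.+1 - (x == r))%N) s <= f m.+1 s].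

(* [hit_value m s] is the probability that at least m moves from r occur when the
   process is started from s. *)
Definition hit_value m s : R := inf [set f m s | f in superharmonic].

Lemma superharmonic1 : superharmonic (fun _ _ => 1).
Proof. by split=> // *; rewrite ?top_cst ?ler01 ?lexx. Qed.

Lemma phi_has_inf m s : has_inf [set f m s | f in superharmonic].
Proof.
split; first by exists 1, (fun _ _ => 1) => //; exact: superharmonic1.
by exists 0 => _ [f [f01 _ _] <-]; case/andP: (f01 m s).
Qed.

Lemma phi_le f m s : superharmonic f -> hit_value m s <= f m s.
Proof. by move=> sf; apply: ge_inf; [case: (phi_has_inf m s)|exists f]. Qed.

Lemma phi_ge c m s : (forall f, superharmonic f -> c <= f m s) -> c <= hit_value m s.
Proof.
by move=> h; apply: lb_le_inf; [case: (phi_has_inf m s)|move=> _ [f sf <-]; exact: h].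
Qed.

Lemma phi01 m s : 0 <= hit_value m s <= 1.
Proof.
rewrite phi_ge /=; first by apply: (phi_le _ _ superharmonic1).
by move=> f [f01 _ _]; case/andP: (f01 m s).
Qed.

Lemma phi_ge0 m s : 0 <= hit_value m s. Proof. by case/andP: (phi01 m s). Qed.
Lemma phi_le1 m s : hit_value m s <= 1. Proof. by case/andP: (phi01 m s). Qed.

Lemma bnd_phi m : bnd (hit_value m). Proof. by apply: bnd01 => s; exact: phi01. Qed.
Hint Resolve bnd_phi : core.

Lemma phi0 s : hit_value 0 s = 1.
Proof. by apply/eqP; rewrite eq_le phi_le1 phi_ge // => f [_ -> _]. Qed.

Lemma phi_super m s x : (0 < s.2 x)%N -> top x (hit_value (m.+1 - (x == r))%N) s <= hit_value m.+1 s.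
Proof.
move=> sx; apply: phi_ge => f sf; have [f01 _ ft] := sf.
apply: le_trans (ft m s x sx); apply: top_mono => //; first exact: bnd01.
by move=> t; exact: phi_le.
Qed.

(** Truncating [g] at 1 keeps it superharmonic, so test functions may exceed 1. *)
Lemma phi_min g m s : (forall n, bnd (g n)) -> (forall n t, 0 <= g n t) ->
  (forall t, 1 <= g 0%N t) ->
  (forall n t x, (0 < t.2 x)%N -> top x (g (n.+1 - (x == r))%N) t <= g n.+1 t) ->
  hit_value m s <= g m s.
Proof.
move=> bg g0 g1 gt; pose h n t := Num.min 1 (g n t).
have h01 n t : 0 <= h n t <= 1.
  by rewrite /h ge_min lexx /= le_min ler01 /= g0.
have sh : superharmonic h.
  split=> // [t|n t x tx]; first by rewrite /h min_l.
  rewrite {2}/h le_min; apply/andP; split.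
    by have /andP[] := top01 nu nb x t (h01 (n.+1 - (x == r))%N).
  apply: le_trans (gt n t x tx); apply: top_mono => //; first exact: bnd01.
  by move=> u; rewrite /h ge_min lexx orbT.
by apply: le_trans (phi_le m s sh) _; rewrite /h ge_min lexx orbT.
Qed.

(** Abelian property: the value does not depend on which frog moves first. Forcing a frog of [x] to
    move first, where there is one, gives again a superharmonic function by [topC], and minimality
    yields the missing inequality. *)
Lemma phi_top m s x : (0 < s.2 x)%N -> top x (hit_value (m.+1 - (x == r))%N) s = hit_value m.+1 s.
Proof.
move=> sx; apply/eqP; rewrite eq_le phi_super //=.
pose g n t := if (0 < t.2 x)%N then
   (if n is n'.+1 then top x (hit_value (n'.+1 - (x == r))%N) t else 1) else hit_value n t.
have gphi n t : g n t <= hit_value n t.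
  rewrite /g; case: ifP => // tx; case: n => [|n]; first by rewrite phi0.
  exact: phi_super.
have gE n t : (0 < t.2 x)%N -> g n.+1 t = top x (hit_value (n.+1 - (x == r))%N) t.
  by rewrite /g => ->.
have g01 n t : 0 <= g n t <= 1.
  rewrite /g; case: ifP => _; last exact: phi01.
  by case: n => [|n]; [rewrite ler01 lexx|apply: top01 => u; exact: phi01].
rewrite -gE //; apply: (phi_min (g := g)).
- by move=> n; apply: bnd01.
- by move=> n t; case/andP: (g01 n t).
- by move=> t; rewrite /g phi0 if_same.
move=> n t y ty.
have [tx|tx] := boolP (0 < t.2 x)%N; last first.
  rewrite {2}/g (negPf tx); apply: le_trans (phi_super n ty); apply: top_mono => //.
  exact: bnd01.
rewrite gE //; have [->|yx] := eqVneq y x.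
  by apply: top_mono => //; exact: bnd01.
(* If [y] is [r] and one departure is missing, then moving a frog of [x] first leaves the frog at
   [r] in place, so the value after the move is 1. *)
case e : (n.+1 - (y == r))%N => [|k].
  have [ny n0] : y = r /\ n = 0%N.
    by case: (y =P r) e => [yr|_] /=; [split=> //; lia|lia].
  rewrite n0 (_ : (x == r) = false) ?subn0; last by rewrite -ny eq_sym (negPf yx).
  have -> : top y (g 0%N) t = 1.
    rewrite -(top_cst nu nb y 1 t); congr (top _ _ _); apply/funext => u.
    by rewrite /g phi0 if_same.
  rewrite -(top_cst nu nb x 1 t); apply: top_le => //; first exact: bnd_cst.
  move=> t' _ /(_ y yx) h.
  have ty' : (0 < t'.2 y)%N by lia.
  apply: le_trans (phi_super 0 ty'); rewrite ny eqxx subnn.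
  by rewrite (_ : hit_value 0 = fun=> 1) ?top_cst //; apply/funext => u; rewrite phi0.
have -> : top y (g k.+1) t = top y (top x (hit_value (k.+1 - (x == r))%N)) t.
  apply/eqP; rewrite eq_le; apply/andP; split; apply: top_le.
  - exact: bnd01.
  - exact: bnd_top.
  - by move=> t' _ /(_ x) h; rewrite gE //; have := h (negbT (negPf _)); rewrite eq_sym; lia.
  - exact: bnd_top.
  - exact: bnd01.
  - by move=> t' _ /(_ x) h; rewrite gE //; have := h (negbT (negPf _)); rewrite eq_sym; lia.
rewrite topC //; last by rewrite eq_sym.
apply: top_le => //; first exact: bnd_top.
move=> t' _ /(_ y yx) h; have ty' : (0 < t'.2 y)%N by lia.
case e2 : (n.+1 - (x == r))%N => [|k'].
  rewrite phi0; have /andP[] // := top01 nu nb y t' (phi01 (k.+1 - (x == r))%N).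
apply: le_trans (phi_super k' ty'); rewrite (_ : (k.+1 - _ = k'.+1 - (y == r))%N) //; lia.
Qed.

Lemma phi_top_neq m s x : (0 < s.2 x)%N -> x != r -> top x (hit_value m) s = hit_value m s.
Proof.
move=> sx xr; case: m => [|m]; last by have := phi_top m sx; rewrite (negPf xr) subn0.
by rewrite (_ : hit_value 0 = fun=> 1) ?top_cst //; apply/funext => u; rewrite phi0.
Qed.

Lemma phi_top_eq m s : (0 < s.2 r)%N -> top r (hit_value m) s = hit_value m.+1 s.
Proof. by move=> sr; have := phi_top m sr; rewrite eqxx subSS subn0. Qed.

Lemma phi1_active s : (0 < s.2 r)%N -> hit_value 1 s = 1.
Proof.
move=> sr; rewrite -phi_top_eq // (_ : hit_value 0 = fun=> 1) ?top_cst //.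
by apply/funext => u; rewrite phi0.
Qed.

Lemma phi_nincrS m s : hit_value m.+1 s <= hit_value m s.
Proof.
apply: (@phi_min (fun n => hit_value n.-1) m.+1) => //= [n t|t|n t x tx].
- exact: phi_ge0.
- by rewrite phi0.
have [xr|xr] := eqVneq x r; last by rewrite subn0 /= phi_top_neq.
rewrite subSS subn0 {x}xr in tx *; case: n => [|n] /=; last by rewrite phi_top_eq.
by rewrite phi0; have /andP[] := top01 nu nb r t (phi01 0).
Qed.

Lemma phi_nincr m n s : (m <= n)%N -> hit_value n s <= hit_value m s.
Proof.
move=> /subnKC <-; elim: (n - m)%N => [|k IH]; first by rewrite addn0.
by rewrite addnS; apply: le_trans (phi_nincrS _ _) IH.
Qed.

(** Minimality tested at a single level: all other levels keep [hit_value] itself, so the condition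
    at [r] refers to the known level m. *)
Lemma phi_minS m (g : state V -> R) s : bnd g -> (forall t, 0 <= g t) ->
  (forall t x, (0 < t.2 x)%N -> x != r -> top x g t <= g t) ->
  (forall t, (0 < t.2 r)%N -> top r (hit_value m) t <= g t) ->
  hit_value m.+1 s <= g s.
Proof.
move=> bg g0 gx gr.
pose h n t := if n == m.+1 then Num.min (g t) (hit_value n t) else hit_value n t.
have hphi n t : h n t <= hit_value n t by rewrite /h; case: ifP => // _; rewrite ge_min lexx orbT.
have h01 n t : 0 <= h n t <= 1.
  apply/andP; split; last by apply: le_trans (hphi n t) (phi_le1 n t).
  by rewrite /h; case: ifP => // _; rewrite ?le_min ?g0 phi_ge0.
suff : hit_value m.+1 s <= h m.+1 s.
  by rewrite /h eqxx le_min => /andP[].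
apply: phi_min.
- by move=> n; apply: bnd01.
- by move=> n t; case/andP: (h01 n t).
- by move=> t; rewrite /h /= phi0.
move=> n t x tx.
have le1 : top x (h (n.+1 - (x == r))%N) t <= hit_value n.+1 t.
  by apply: le_trans (phi_super n tx); apply: top_mono => //; exact: bnd01.
have hE u : h m.+1 u = Num.min (g u) (hit_value m.+1 u) by rewrite /h eqxx.
have [nm|nm] := eqVneq n m; last by rewrite [X in _ <= X]/h eqSS (negPf nm).
rewrite nm in le1 *; rewrite hE le_min le1 andbT.
have [xr|xr] := eqVneq x r; last first.
  rewrite subn0; apply: le_trans (gx t x tx xr); apply: top_mono => //; first exact: bnd01.
  by move=> u; rewrite /h eqxx ge_min lexx.
rewrite xr subSS subn0 in tx *; apply: le_trans (gr t tx).
by apply: top_mono => //; exact: bnd01.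
Qed.

End value.

(** The supremum c of the admissible constants is admissible, hence so is c + k (1 - c); this cannot
    exceed c, so c is 1. *)
Lemma bootstrap (R : realType) (T : Type) (f g : T -> R) (k : R) : 0 < k <= 1 ->
  (forall t, 0 <= f t) -> (forall t, 0 <= g t) ->
  (forall c, 0 <= c <= 1 -> (forall t, c * g t <= f t) ->
     forall t, (c + k * (1 - c)) * g t <= f t) ->
  forall t, g t <= f t.
Proof.
move=> k01 f0 g0 h.
pose S := [set c : R | 0 <= c <= 1 /\ forall t, c * g t <= f t].
have hS : has_sup S.
  split; first by exists 0; split=> [|t]; [rewrite lexx ler01|rewrite mul0r].
  by exists 1 => c [/andP[]].
have sS c : S c -> c <= sup S by move=> Sc; apply: ub_le_sup => //; case: hS.
have s0 : 0 <= sup S by apply: sS; split=> [|t]; [rewrite lexx ler01|rewrite mul0r].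
have s1 : sup S <= 1 by apply: sup_le_ub => [|c [/andP[]]] //; case: hS.
have Ssup t : sup S * g t <= f t.
  have [g_eq0|gn0] := eqVneq (g t) 0; first by rewrite g_eq0 mulr0.
  have gt0 : 0 < g t by rewrite lt_neqAle eq_sym gn0 g0.
  rewrite -ler_pdivlMr //; apply: sup_le_ub; first by case: hS.
  by move=> c [_ cS]; rewrite ler_pdivlMr.
have /sS : S (sup S + k * (1 - sup S)).
  by split; [nra|apply: h => //; rewrite s0 s1].
move=> le t; apply: le_trans (Ssup t); rewrite -[leLHS]mul1r ler_wpM2r //; nra.
Qed.

(** * Comparison of hitting probabilities *)

Section monotonicity.
Context (R : realType) (nu : probability nat R) (V : eqType) (nb : V -> seq V) (r : V).
Implicit Types (s : state V) (D : V -> bool) (a b : V -> nat) (x y z : V).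
Local Notation E := (Ex nu).
Local Notation top := (topple nu nb).
Local Notation wake := (awaken nu).
Local Notation phi := (hit_value nu nb r).
Local Hint Resolve bnd_phi bnd_top bnd_wake bnd_cst : core.

Definition addf a b : V -> nat := fun u => (a u + b u)%N.

Lemma rm_addf x a b : (0 < a x)%N -> rm x (addf a b) = addf (rm x a) b.
Proof. by move=> ax; apply/funext => u; rewrite /rm /addf; case: (u =P x) => [->|_]; lia. Qed.

Lemma add_addf z k a b : add z k (addf a b) = addf (add z k a) b.
Proof. by apply/funext => u; rewrite /add /addf addnAC. Qed.

Lemma mv_addf x z a b : (0 < a x)%N -> mv x z (addf a b) = addf (mv x z a) b.
Proof. by move=> ax; rewrite /mv rm_addf // add_addf. Qed.

Lemma addfC a b : addf a b = addf b a.
Proof. by apply/funext => u; rewrite /addf addnC. Qed.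

(** Substitute for couplings: [Q] lists candidate bounds for each state, possibly several, and their
    infimum is superharmonic if every move leads from a bound to related bounds. *)
Lemma phi_rel (Q : nat -> state V -> R -> Prop) :
  (forall m s v, Q m s v -> 0 <= v) -> (forall s v, Q 0%N s v -> 1 <= v) ->
  (forall m s v x (g : state V -> R), Q m.+1 s v -> (0 < s.2 x)%N ->
     (forall t, 0 <= g t <= 1) -> (forall t v', Q (m.+1 - (x == r))%N t v' -> g t <= v') ->
     top x g s <= v) ->
  forall m s v, Q m s v -> phi m s <= v.
Proof.
move=> Q0 Q1 H m s v Qv.
(* The value 1 is always a valid bound; adding it keeps the set nonempty. *)
pose S n t := [set v | Q n t v \/ v = 1].
pose g n t := inf (S n t).
have hS n t : has_inf (S n t).
  by split; [exists 1; right|exists 0 => w [/Q0|->]; rewrite ?ler01].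
have gle n t w : S n t w -> g n t <= w by move=> Sw; apply: ge_inf => //; case: (hS n t).
have g01 n t : 0 <= g n t <= 1.
  apply/andP; split; last by apply: gle; right.
  by apply: lb_le_inf; [case: (hS n t)|move=> w [/Q0|->]; rewrite ?ler01].
suff : phi m s <= g m s by move=> h; apply: le_trans h (gle _ _ _ _); left.
apply: phi_min => [n|n t|t|n t x tx].
- exact: bnd01.
- by case/andP: (g01 n t).
- by apply: lb_le_inf; [case: (hS 0%N t)|move=> w [/Q1|->]].
apply: lb_le_inf; first by case: (hS n.+1 t).
move=> w [Qw|->]; last by have /andP[] := top01 nu nb x t (g01 (n.+1 - (x == r))%N).
by apply: H Qw tx _ _ => // t' v' Qv'; apply: gle; left.
Qed.

Lemma phi1_rel (Q : state V -> R -> Prop) :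
  (forall s v, Q s v -> 0 <= v) -> (forall s v, Q s v -> (0 < s.2 r)%N -> 1 <= v) ->
  (forall s v x (g : state V -> R), Q s v -> (0 < s.2 x)%N -> x != r ->
     (forall t, 0 <= g t <= 1) -> (forall t v', Q t v' -> g t <= v') -> top x g s <= v) ->
  forall s v, Q s v -> phi 1 s <= v.
Proof.
move=> Q0 Q1 H s v Qv.
apply: (@phi_rel (fun m s v => (m = 0%N /\ v = 1) \/ (m = 1%N /\ Q s v))); last by right.
- by move=> m t w [[_ ->]|[_ /Q0]].
- by move=> t w [[_ ->]|[]].
move=> m t w x g [[]//|[[->] Qw]] tx g01 gQ.
have [xr|xr] := eqVneq x r.
  rewrite xr in tx; apply: le_trans (Q1 _ _ Qw tx).
  by have /andP[] := top01 nu nb x t g01.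
apply: (H _ _ _ _ Qw tx xr g01) => t' v' Qv'; apply: gQ.
by rewrite (negPf xr); right.
Qed.

(** The frogs of [b] may stay at rest: the larger process, restricted to moves of the other frogs,
    is still superharmonic. *)
Lemma phi_addf m D a b : phi m (D, a) <= phi m (D, addf a b).
Proof.
apply: (@phi_min _ _ _ _ _ (fun n t => phi n (t.1, addf t.2 b)) m (D, a)) => [n|n t|t|n t x tx].
- exact: (bnd_comp (fun t => (t.1, addf t.2 b)) (bnd_phi nu nb r n)).
- exact: phi_ge0.
- by rewrite phi0.
have tx' : (0 < (t.1, addf t.2 b).2 x)%N by rewrite /= /addf; lia.
rewrite -(phi_top nu nb r _ tx'); apply: (@top_transfer _ _ _ _ _ id) => //.
- exact: (bnd_comp (fun t => (t.1, addf t.2 b)) (bnd_phi nu nb r _)).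
- by rewrite map_id.
- by move=> _ /=; rewrite rm_addf.
move=> z _; apply: wake_le => //=.
- exact: (bnd_comp (fun t => (t.1, addf t.2 b)) (bnd_phi nu nb r _)).
- by rewrite mv_addf.
- by move=> _ k; rewrite mv_addf // add_addf.
Qed.

Lemma phi_add m D a z k : phi m (D, a) <= phi m (D, add z k a).
Proof.
have -> : add z k a = addf a (fun u => k * (u == z))%N by [].
exact: phi_addf.
Qed.

(* Waking the frogs of z too early does no harm, on average. *)
Lemma phi_wake m z s : phi m s <= wake z (phi m) s.
Proof.
apply: (@phi_min _ _ _ _ _ (fun n => wake z (phi n)) m s) => [n|n t|t|n t x tx].
- exact: bnd_wake.
- by apply: wake_ge0 => u; exact: phi_ge0.
- by apply: wake_lb => // s' _ _ _; rewrite phi0.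
rewrite -wake_top //; apply: wake_le => //; first exact: bnd_top.
  by move=> _; exact: phi_super.
by move=> _ k; apply: phi_super; exact: add_gt0.
Qed.

(** A visited vertex has no sleepers left, so a smaller visited set means more frogs to wake. When
    only one of the two processes wakes frogs at a vertex, [phi_wake] absorbs the difference. *)
Lemma phi_vis m D D' a : (forall u, D u -> D' u) -> phi m (D', a) <= phi m (D, a).
Proof.
move=> DD'.
pose Q (n : nat) s v := exists2 D1 : V -> bool, (forall u, D1 u -> s.1 u) & v = phi n (D1, s.2).
apply: (@phi_rel Q _ _ _ m (D', a)); last first.
- by exists D.
- move=> n s v x g [D1 D1s ->] sx g01 gQ.
  have sx' : (0 < (D1, s.2).2 x)%N by [].
  rewrite -(phi_top nu nb r _ sx'); apply: (@top_transfer _ _ _ _ _ id) => //.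
  + exact: bnd01.
  + by rewrite map_id.
  + by move=> _; apply: gQ; exists D1.
  move=> z _; have [D1z|D1z] := boolP (D1 z).
    by rewrite /wake /= D1z (D1s _ D1z); apply: gQ; exists D1.
  have [sz|sz] := boolP (s.1 z).
    apply: le_trans (phi_wake _ z _); by rewrite /wake /= sz; apply: gQ; exists D1.
  rewrite /wake /= (negPf D1z) (negPf sz); apply: Ex_le.
  + exact/bnd_slice/bnd01.
  + exact: bnd_slice.
  move=> k; apply: gQ; exists (vis z D1) => // u; rewrite /= /vis.
  by case: (u == z) => //= /D1s.
- by move=> s v [D1 _ ->]; rewrite phi0.
- by move=> n s v [D1 _ ->]; exact: phi_ge0.
Qed.

(** The two groups fail together at least as often as if they were independent: they share the
    sleepers, and those woken by one group are credited to it, while for the other the vertex just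
    becomes visited, which only hurts by [phi_vis]. *)
Lemma phi1_union D a b :
  phi 1 (D, addf a b) <= 1 - (1 - phi 1 (D, a)) * (1 - phi 1 (D, b)).
Proof.
pose Q s v := exists a b, s.2 = addf a b /\
  v = 1 - (1 - phi 1 (s.1, a)) * (1 - phi 1 (s.1, b)).
apply: (@phi1_rel Q); last by exists a, b.
- move=> s v [a' [b' [_ ->]]].
  by have := phi01 nu nb r 1 (s.1, a'); have := phi01 nu nb r 1 (s.1, b'); nra.
- move=> s v [a' [b' [e ->]]]; rewrite e /addf addn_gt0 => /orP[] h.
    by rewrite (@phi1_active _ nu _ nb r (s.1, a') h) subrr mul0r subr0.
  by rewrite (@phi1_active _ nu _ nb r (s.1, b') h) subrr mulr0 subr0.
move=> s v x g [a' [b' [e ev]]] sx xr g01 gQ.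
wlog ax : a' b' e ev / (0 < a' x)%N.
  move=> H; have : (0 < a' x)%N || (0 < b' x)%N by rewrite -addn_gt0; move: sx; rewrite e.
  case/orP => h; first exact: (H a' b').
  by apply: (H b' a') => //; [rewrite addfC|rewrite mulrC].
pose c := phi 1 (s.1, b').
have -> : v = top x (fun t => c + (1 - c) * phi 1 t) (s.1, a').
  by rewrite top_affine // phi_top_neq // ev -/c; ring.
have bF : bnd (fun t => c + (1 - c) * phi 1 t).
  by apply: bndD; [exact: bnd_cst|apply: bndM => //; exact: bnd_cst].
have bg := bnd01 g01.
apply: (@top_transfer _ _ _ _ _ id) => //.
- by rewrite map_id.
- move=> _ /=; rewrite e rm_addf //; apply: gQ; exists (rm x a'), b'; split => //.
  by rewrite /= -/c; ring.
move=> z _; rewrite e mv_addf //; apply: wake_le => //= [_|_ k].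
  by apply: gQ; exists (mv x z a'), b'; split => //; rewrite /= -/c; ring.
rewrite add_addf; apply: le_trans (gQ _ _ _) _.
  by exists (add z k (mv x z a')), b'; split.
rewrite /=; have : phi 1 (vis z s.1, b') <= c.
  by apply: phi_vis => u su; rewrite /vis su orbT.
by have := phi01 nu nb r 1 (vis z s.1, add z k (mv x z a')); nra.
Qed.

(** Makes the value, as a function of the position of one chosen frog, superharmonic for the plain
    walk: frogs woken on the way are only extra help, and a departure from [r] only lowers the
    demand. *)
Lemma phi_nowake m D a x : nb x != [::] ->
  (size (nb x))%:R^-1 * \sum_(z <- nb x) phi m (D, add z 1 a) <= phi m (D, add x 1 a).
Proof.
move=> nx; have ax : (0 < (D, add x 1 a).2 x)%N by exact: add1_gt0.
apply: (@le_trans _ _ (top x (phi m) (D, add x 1 a))); last first.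
  have [xr|xr] := eqVneq x r; last by rewrite phi_top_neq.
  rewrite xr in ax *; rewrite phi_top_eq //; exact: phi_nincrS.
rewrite /top; case e : (nb x) nx => [//|u l] _; rewrite -e.
apply: ler_wpM2l; first exact: size_inv_ge0.
by apply: ler_sum => z _; rewrite /= mv_add1; exact: phi_wake.
Qed.

End monotonicity.

(** * The probability of infinitely many departures *)

Section recurrence.
Context (R : realType) (nu : probability nat R) (V : eqType) (nb : V -> seq V) (r : V).
Implicit Types (s : state V) (D : V -> bool) (a b : V -> nat) (x y z : V).
Local Notation E := (Ex nu).
Local Notation top := (topple nu nb).
Local Notation wake := (awaken nu).
Local Notation phi := (hit_value nu nb r).
Local Hint Resolve bnd_phi bnd_cst : core.

(* Probability that infinitely many moves from r occur. *)
Definition psi s : R := inf (range (fun m => phi m s)).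

Lemma psi_has_inf s : has_inf (range (fun m => phi m s)).
Proof. by split; [exists (phi 0 s), 0%N|exists 0 => _ [m _ <-]; exact: phi_ge0]. Qed.

Lemma psi_le m s : psi s <= phi m s.
Proof. by apply: ge_inf; [case: (psi_has_inf s)|exists m]. Qed.

Lemma psi_ge c s : (forall m, c <= phi m s) -> c <= psi s.
Proof. by move=> h; apply: lb_le_inf; [case: (psi_has_inf s)|move=> _ [m _ <-]]. Qed.

Lemma psi01 s : 0 <= psi s <= 1.
Proof.
rewrite psi_ge => [|m]; last exact: phi_ge0.
by rewrite /= (le_trans (psi_le 0 s)) // phi0.
Qed.

Lemma psi_ge0 s : 0 <= psi s. Proof. by case/andP: (psi01 s). Qed.
Lemma psi_le1 s : psi s <= 1. Proof. by case/andP: (psi01 s). Qed.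

Lemma bnd_psi : bnd psi. Proof. by apply: bnd01 => s; exact: psi01. Qed.
Local Hint Resolve bnd_psi : core.

Lemma phi_cvg s : phi ^~ s @ \oo --> psi s.
Proof.
apply: nonincreasing_cvgn; last by case: (psi_has_inf s).
by move=> m n mn; exact: phi_nincr.
Qed.

Lemma wake_cvg z s : (fun m => wake z (phi m) s) @ \oo --> wake z psi s.
Proof.
rewrite /wake; case: ifP => _; first exact: phi_cvg.
by apply: Ex_cvg => [m k|k]; [exact: phi01|exact: phi_cvg].
Qed.

Lemma top_cvg x s : (fun m => top x (phi m) s) @ \oo --> top x psi s.
Proof.
rewrite /top; case e : (nb x) => [|u l]; first exact: phi_cvg.
rewrite -e; apply: cvgM; first exact: cvg_cst.
elim: (nb x) => [|u' l' IH].
  by under eq_fun do rewrite big_nil; rewrite big_nil; exact: cvg_cst.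
under eq_fun do rewrite big_cons.
by rewrite big_cons; apply: cvgD => //; exact: wake_cvg.
Qed.

(** Limit of [phi_top]: the loss of one level at [r] disappears, so invariance holds at every
    vertex. *)
Lemma psi_top x s : (0 < s.2 x)%N -> top x psi s = psi s.
Proof.
move=> sx; have cv := top_cvg (x := x) (s := s).
apply/eqP; rewrite eq_le; apply/andP; split.
  apply: psi_ge => -[|m]; first by rewrite phi0; case/andP: (top01 nu nb x s psi01).
  rewrite -(phi_top nu nb r m sx); apply: top_mono => // t; exact: psi_le.
have <- : limn (fun m => top x (phi m) s) = top x psi s by apply: cvg_lim.
apply: limr_ge; first by apply/cvg_ex; eexists; exact: cv.
apply: nearW => m; apply: le_trans (psi_le m.+1 s) _.
rewrite -(phi_top nu nb r m sx); apply: top_mono => // t; apply: phi_nincr; lia.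
Qed.

(* A nonnegative function that is superharmonic off r and dominates [psi] when r
   is occupied dominates [psi] everywhere. *)
Lemma psi_min (k : state V -> R) (c : R) : bnd k -> (forall t, 0 <= k t) -> 0 <= c ->
  (forall t x, (0 < t.2 x)%N -> x != r -> top x k t <= k t) ->
  (forall t, (0 < t.2 r)%N -> c * psi t <= k t) ->
  forall t, c * psi t <= k t.
Proof.
move=> bk k0; rewrite le_eqVlt => /predU1P[<- _ _ t|c0 kx kr t]; first by rewrite mul0r.
rewrite mulrC -ler_pdivlMr //.
(* As [phi 1] is 1 when [r] is occupied and both [phi 1] and [psi] are invariant off [r], adding
   their difference reduces the claim to minimality of [phi 1]. *)
pose f t := c^-1 * k t + (phi 1 t - psi t).
have bck : bnd (fun t => c^-1 * k t) by apply: bndM.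
have bf : bnd f by apply: bndD => //; apply: bndB.
suff : phi 1 t <= f t by rewrite /f mulrC; lra.
apply: phi_minS => // [u|u x ux xr|u ur].
- by apply: addr_ge0; [rewrite mulr_ge0 // invr_ge0 ltW|rewrite subr_ge0; exact: psi_le].
- rewrite topD //; last exact: bndB.
  rewrite topZ // topB // psi_top // phi_top_neq // lerD2r ler_pM2l ?invr_gt0 //.
  exact: kx.
rewrite /f phi1_active //.
have := kr u ur; rewrite mulrC -ler_pdivlMr // mulrC => h.
have /andP[_ h2] := top01 nu nb r u (phi01 nu nb r 0).
by move: h h2; lra.
Qed.

Lemma psi_addf D a b : psi (D, a) <= psi (D, addf a b).
Proof.
by apply: psi_ge => m; apply: le_trans (phi_addf nu nb r m D a b); exact: psi_le.
Qed.

End recurrence.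

(** * The rooted tree *)

Section tree.
Context (d : nat).
Implicit Types (u w x y z : vertex d) (i j : 'I_d).
Local Notation nb := (@neighbors d).

Lemma mem_children u x : (x \in children u) = (if x is _ :: v then v == u else false).
Proof.
apply/mapP/idP => [[j _ ->]|]; first by rewrite eqxx.
case: x => [//|j v] /eqP ->; exists j => //; exact: mem_enum.
Qed.

Lemma mem_neighbors x z : (z \in nb x) =
  (if x is _ :: v then z == v else false) || (if z is _ :: v then v == x else false).
Proof.
case: x => [|j x] /=; first by rewrite mem_children.
by rewrite in_cons mem_children.
Qed.

Lemma neighbors_sym x z : (z \in nb x) = (x \in nb z).
Proof.
rewrite !mem_neighbors orbC; congr (_ || _); by [case: z => // j z; rewrite eq_sym|case: x => // j x; rewrite eq_sym].
Qed.

Lemma neighborsP x z : z \in nb x -> (exists j, z = j :: x) \/ (exists j, x = j :: z).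
Proof.
rewrite mem_neighbors => /orP[]; [case: x => // j x /eqP ->; right|
  case: z => // j z /eqP ->; left]; by exists j.
Qed.

Lemma neighbors_uniq x : uniq (nb x).
Proof.
have uc u : uniq (children u).
  by rewrite map_inj_uniq ?enum_uniq // => i j [].
case: x => [|j x] //=; rewrite uc andbT mem_children; case: x => // i x.
apply/eqP => h; have := congr1 size h => /eqP; rewrite ltn_eqF //=.
Qed.

Lemma neighbors_child j x : (j :: x : vertex d) \in nb x.
Proof. by rewrite mem_neighbors eqxx orbT. Qed.

Lemma neighbors_neq0 j x : nb x != [::].
Proof. by apply/eqP => h; have := neighbors_child j x; rewrite h. Qed.

Lemma neighbors_parent j x : x \in nb (j :: x).
Proof. by rewrite mem_neighbors eqxx. Qed.

Lemma size_children u : size (children u) = d.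
Proof. by rewrite size_map size_enum_ord. Qed.

Lemma size_neighbors_root : size (nb [::]) = d.
Proof. exact: size_children. Qed.

Lemma size_neighbors j x : size (nb (j :: x)) = d.+1.
Proof. by rewrite /= size_children. Qed.

Lemma size_neighbors_le x : (size (nb x) <= d.+1)%N.
Proof. by case: x => [|j x]; rewrite ?size_neighbors_root ?size_neighbors. Qed.

Lemma children_cat u w : children (u ++ w) = [seq z ++ w | z <- children u].
Proof. by rewrite /children -[RHS]map_comp. Qed.

Lemma neighbors_cat u w : u != [::] -> nb (u ++ w) = [seq z ++ w | z <- nb u].
Proof. by case: u => [//|j u] _; rewrite /= -children_cat. Qed.

Lemma perm_neighbors (sigma : vertex d -> vertex d) x : involutive sigma ->
  (forall x z, z \in nb x -> sigma z \in nb (sigma x)) ->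
  perm_eq (nb (sigma x)) (map sigma (nb x)).
Proof.
move=> sK h; apply: uniq_perm; first exact: neighbors_uniq.
  by rewrite map_inj_uniq ?neighbors_uniq //; exact: inv_inj.
move=> z; rewrite -[z]sK (mem_map (inv_inj sK)); apply/idP/idP => [/h|/h//].
by rewrite !sK.
Qed.

Section swap.
Variables (i0 : 'I_d) (v : vertex d).

(** A tree automorphism: at each depth it transposes [i0] with the digit of [v] at that depth,
    counted from the root, and so carries the ray 0^|v| to [v]. *)
Fixpoint digit_swap (u : vertex d) : vertex d :=
  if u is j :: u' then tperm i0 (nth i0 (rev v) (size u')) j :: digit_swap u' else [::].

Lemma size_digit_swap u : size (digit_swap u) = size u.
Proof. by elim: u => //= j u ->. Qed.

Lemma digit_swapK : involutive digit_swap.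
Proof. by elim=> //= j u IH; rewrite size_digit_swap tpermK IH. Qed.

Lemma digit_swap_neighbors x z : z \in nb x -> digit_swap z \in nb (digit_swap x).
Proof.
rewrite !mem_neighbors; case: x => [|j x]; case: z => [|j' z] //=.
- by move=> /eqP ->; rewrite eqxx.
- by rewrite orbF => /eqP <-; rewrite eqxx.
by case/orP => /eqP => [<-|->] /=; rewrite eqxx ?orbT.
Qed.

Lemma digit_swap_nseq : digit_swap (nseq (size v) i0) = v.
Proof.
suff h k : (k <= size v)%N -> digit_swap (nseq k i0) = drop (size v - k) v.
  by rewrite h // subnn drop0.
elim: k => [|k IH] hk; first by rewrite subn0 drop_size.
rewrite /= IH 1?ltnW // size_nseq tpermL nth_rev //.
by rewrite [RHS](drop_nth i0) //; [congr (_ :: drop _ _)|]; lia.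
Qed.

End swap.

Section theta.
Variables (i0 : 'I_d) (n : nat).
Local Notation allz := (all (pred1 i0)).

(** Addresses end at the root, so this is the depth at which the path from the root to [u] leaves
    the ray of zeros. *)
Fixpoint tz u : nat := if allz u then size u else if u is _ :: u' then tz u' else 0%N.

(* The involution exchanging w ++ 0^k with w ++ 0^(n-k) reroots the tree at 0^n. *)
Fixpoint theta u : vertex d :=
  if allz u then (if (size u <= n)%N then nseq (n - size u) i0 else u)
  else if u is j :: u' then j :: theta u' else [::].

Lemma allz_nseq k : allz (nseq k i0).
Proof. by rewrite all_nseq /= eqxx orbT. Qed.

Lemma allzP u : allz u -> u = nseq (size u) i0.
Proof. by move/all_pred1P. Qed.

Lemma tz_nseq k : tz (nseq k i0) = k.
Proof. by case: k => [//|k]; rewrite /= eqxx allz_nseq /= size_nseq. Qed.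

Lemma tz_allz u : allz u -> tz u = size u.
Proof. by case: u => [//|j u] /= ->. Qed.

Lemma tz_cons j u : ~~ allz (j :: u) -> tz (j :: u) = tz u.
Proof. by move=> /negPf /= ->. Qed.

Lemma theta_allz u : allz u -> theta u = if (size u <= n)%N then nseq (n - size u) i0 else u.
Proof. by case: u => [|j u] //= ->. Qed.

Lemma theta_cons j u : ~~ allz (j :: u) -> theta (j :: u) = j :: theta u.
Proof. by move=> /negPf /= ->. Qed.

Lemma theta_nseq k : (k <= n)%N -> theta (nseq k i0) = nseq (n - k) i0.
Proof. by move=> kn; rewrite theta_allz ?allz_nseq // size_nseq kn. Qed.

Lemma allz_theta u : allz (theta u) = allz u.
Proof.
elim: u => [|j u IH]; first by rewrite theta_allz //=; apply: allz_nseq.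
have [h|h] := boolP (allz (j :: u)).
  by rewrite theta_allz //; case: ifP; rewrite ?allz_nseq ?h.
by rewrite theta_cons // /= IH; exact: negPf.
Qed.

Lemma thetaK : involutive theta.
Proof.
elim=> [|j u IH]; first by rewrite (theta_nseq (k := 0)) // subn0 theta_nseq // subnn.
have [h|h] := boolP (allz (j :: u)).
  rewrite (theta_allz h); case: ifP => hs; last by rewrite theta_allz // hs.
  by rewrite theta_nseq ?leq_subr // subKn // -(allzP h).
by rewrite theta_cons // theta_cons ?IH //= allz_theta.
Qed.

Lemma tz_theta u : tz (theta u) = if (tz u <= n)%N then (n - tz u)%N else tz u.
Proof.
elim: u => [|j u IH]; first by rewrite (theta_nseq (k := 0)) // tz_nseq subn0.
have [h|h] := boolP (allz (j :: u)).
  by rewrite theta_allz // (tz_allz h); case: ifP => hs; rewrite ?tz_nseq // tz_allz.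
by rewrite theta_cons // !tz_cons //= allz_theta.
Qed.

Lemma tz_neighbors x z : z \in nb x -> (tz z <= (tz x).+1)%N.
Proof.
rewrite mem_neighbors => /orP[]; [case: x => // j x /eqP ->|case: z => // j z /eqP <-].
  have [h|h] := boolP (allz (j :: x)); last by rewrite tz_cons.
  by rewrite (tz_allz h) tz_allz /=; [lia|case/andP: h].
have [h|h] := boolP (allz (j :: z)); last by rewrite tz_cons.
by rewrite (tz_allz h) tz_allz //; case/andP: h.
Qed.

(** The count grows along an edge only when that edge belongs to the ray of zeros. *)
Lemma tz_neighbors_lt x z : z \in nb x -> (tz x < tz z)%N -> z = nseq (tz z) i0.
Proof.
move=> zx; case: (neighborsP zx) => [[j ->]|[j ->]].
  have [h|h] := boolP (allz (j :: x)); last by rewrite tz_cons // ltnn.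
  by move=> _; rewrite (tz_allz h); exact: allzP.
have [h|h] := boolP (allz (j :: z)); last by rewrite tz_cons // ltnn.
by rewrite (tz_allz h) tz_allz /=; [lia|case/andP: h].
Qed.

Lemma theta_neighbors x z : (tz x <= n)%N -> (tz z <= n)%N -> z \in nb x ->
  theta z \in nb (theta x).
Proof.
wlog [j ->] : x z / exists j, z = j :: x.
  move=> H tx tz' zx; case: (neighborsP zx) => h; first exact: (H x z h).
  rewrite neighbors_sym; apply: (H z x h tz' tx); by rewrite neighbors_sym.
move=> tx tz' _.
have [h|h] := boolP (allz (j :: x)); last by rewrite theta_cons // neighbors_child.
have h' : allz x by case/andP: h.
move: tz'; rewrite tz_allz // theta_allz // theta_allz //= => hs.
rewrite hs (ltnW hs); have -> : (n - size x = (n - (size x).+1).+1)%N by lia.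
exact: neighbors_parent.
Qed.

(** The vertex 0^n loses its child 0^(n+1); vertices of the cut subtree have no neighbours, so a
    frog moved there is removed. *)
Definition pruned x := if (n < tz x)%N then [::] else [seq z <- nb x | (tz z <= n)%N].

(** The cut is what makes the degrees agree: [theta] sends the root, of degree d, to 0^n, which
    keeps d of its d + 1 neighbours. The image of 0^n is the root, where degrees differ, hence the
    strict bound. *)
Lemma perm_pruned x : (tz x < n)%N -> perm_eq (nb x) (map theta (pruned (theta x))).
Proof.
move=> tx; have tt : (tz (theta x) <= n)%N by rewrite tz_theta (ltnW tx) leq_subr.
rewrite /pruned ltnNge tt /=; apply: uniq_perm; first exact: neighbors_uniq.
  by rewrite map_inj_uniq ?filter_uniq ?neighbors_uniq //; exact: (inv_inj thetaK).
move=> z; rewrite -[z in RHS]thetaK (mem_map (inv_inj thetaK)) mem_filter.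
apply/idP/andP => [zx|[tz' zx]].
  have tz' : (tz z <= n)%N by apply: leq_trans (tz_neighbors zx) _.
  by split; [rewrite tz_theta tz' leq_subr|apply: theta_neighbors => //; exact: ltnW].
have := theta_neighbors tt tz' zx; rewrite !thetaK; exact.
Qed.

Lemma suffix_nseq k u : suffix (nseq k i0) u = (k <= tz u)%N.
Proof.
apply/idP/idP => [/suffixP[w ->]|].
  elim: w => [|j w IH]; first by rewrite tz_nseq.
  rewrite cat_cons; have [h|h] := boolP (allz (j :: w ++ nseq k i0)); last by rewrite tz_cons.
  by rewrite tz_allz //= size_cat size_nseq; lia.
elim: u => [|j u IH]; first by rewrite leqn0 => /eqP ->.
have [h|h] := boolP (allz (j :: u)).
  rewrite (tz_allz h) => kl; rewrite (allzP h) -(subnK kl) nseqD.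
  exact: suffix_suffix.
by rewrite tz_cons // => /IH h'; apply: suffix_trans h' (suffix_cons _ _).
Qed.

End theta.
End tree.

Definition dirac_frog (V : eqType) (x : V) : V -> nat := fun u => (u == x : nat).
Definition single (V : eqType) (x : V) : state V := ((fun u => u == x), dirac_frog x).

(** * Transport of states along involutions *)

Section pull.
Context (V : eqType).
Implicit Types (sg : V -> V) (s : state V) (D : V -> bool) (a : V -> nat).

Definition pull sg s : state V := (fun u => s.1 (sg u), fun u => s.2 (sg u)).

Lemma pullK sg s : involutive sg -> pull sg (pull sg s) = s.
Proof. by move=> K; case: s => D a; congr (_, _); apply/funext => u; rewrite /= K. Qed.

Lemma pull_vis sg z D : involutive sg -> (fun u => vis (sg z) D (sg u)) = vis z (D \o sg).
Proof. by move=> K; apply/funext => u; rewrite /vis (inj_eq (inv_inj K)). Qed.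

Lemma pull_add sg z k a : involutive sg -> (fun u => add (sg z) k a (sg u)) = add z k (a \o sg).
Proof. by move=> K; apply/funext => u; rewrite /add (inj_eq (inv_inj K)). Qed.

Lemma pull_rm sg z a : involutive sg -> (fun u => rm (sg z) a (sg u)) = rm z (a \o sg).
Proof. by move=> K; apply/funext => u; rewrite /rm (inj_eq (inv_inj K)). Qed.

Lemma pull_mv sg x z a : involutive sg ->
  (fun u => mv (sg x) (sg z) a (sg u)) = mv x z (a \o sg).
Proof. by move=> K; rewrite /mv pull_add // -(pull_rm x a K). Qed.

Lemma pull_single sg x : involutive sg -> pull sg (single (sg x)) = single x.
Proof.
by move=> K; congr (_, _); apply/funext => u; rewrite /= /dirac_frog (inj_eq (inv_inj K)).
Qed.

End pull.

Section iso.
Context (R : realType) (nu : probability nat R) (V : eqType) (nb nb' : V -> seq V) (r : V).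
Local Hint Resolve bnd_phi bnd_cst : core.

Lemma phi_iso (sg : V -> V) m s : involutive sg ->
  (forall x, perm_eq (nb' (sg x)) (map sg (nb x))) ->
  hit_value nu nb' (sg r) m (pull sg s) <= hit_value nu nb r m s.
Proof.
move=> K pm; rewrite -{2}(pullK s K).
have bp n : bnd (fun t => hit_value nu nb r n (pull sg t)) by exact: (bnd_comp (pull sg)).
apply: (@phi_min _ _ _ _ _ (fun n t => hit_value nu nb r n (pull sg t)) m) => //.
- by move=> n t; exact: phi_ge0.
- by move=> t; rewrite phi0.
move=> n t x; rewrite -[x]K; move: (sg x) => {}x tx.
have tx' : (0 < (pull sg t).2 x)%N by [].
rewrite (inj_eq (inv_inj K)) -(phi_top nu nb r n tx').
apply: (top_transfer (i := sg)) => //.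
  by move=> _ /=; rewrite /pull /= pull_rm.
move=> z zx; apply: wake_le => // [_|_ k] /=; rewrite /pull /=.
  by rewrite pull_mv.
by rewrite pull_vis // pull_add // -(pull_mv x z _ K).
Qed.

End iso.

(** * Visits of a given vertex *)

Section tree_value.
Context (R : realType) (nu : probability nat R) (d : nat).
Implicit Types (s t : state (vertex d)) (D : vertex d -> bool) (a : vertex d -> nat).
Implicit Types (x y z w u : vertex d).
Local Notation nb := (@neighbors d).
Local Notation root := (root_vertex d).
Local Notation top := (topple nu nb).
Local Notation psi := (psi nu nb root).
Local Hint Resolve bnd_phi bnd_psi bnd_cst : core.

(* As every vertex has at most d + 1 neighbours, this bounds below the probability
   of any given step. *)
Definition step_prob : R := d.+1%:R^-1.

Lemma kap_gt0 : 0 < step_prob. Proof. by rewrite invr_gt0 ltr0n. Qed.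
Lemma kap_ge0 : 0 <= step_prob. Proof. exact: ltW kap_gt0. Qed.
Lemma kap_le1 : step_prob <= 1. Proof. by rewrite invf_le1 ?ltr0n // ler1n. Qed.
Lemma kapX01 n : 0 < step_prob ^+ n <= 1.
Proof. by rewrite exprn_gt0 ?kap_gt0 //= exprn_ile1 ?kap_le1 ?kap_ge0. Qed.

Lemma kap_le x z : z \in nb x -> step_prob <= (size (nb x))%:R^-1.
Proof.
move=> zx; have sz : (0 < size (nb x))%N by case: (nb x) zx.
by rewrite /step_prob lef_pV2 ?posrE ?ltr0n // ler_nat size_neighbors_le.
Qed.

Lemma top_step (e : state (vertex d) -> R) x z s (c : R) : bnd e -> (forall t, 0 <= e t) ->
  z \in nb x -> 0 <= c ->
  (forall t, (0 < t.2 z)%N -> c <= e t) -> step_prob * c <= top x e s.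
Proof.
move=> be e0 zx c0 h; apply: le_trans (top_ge1 nu s e0 zx).
apply: ler_pM => //; [exact: kap_ge0|exact: kap_le zx|].
by apply: wake_lb => // t _ _ ht; apply: h; apply: leq_trans (ht z); exact: mv_gt0z.
Qed.

(** A frog at the root goes down to [y] without detour; the induction runs over the part [w] of the
    address still ahead. *)
Lemma straight_path (e : state (vertex d) -> R) y (c : R) : bnd e -> (forall t, 0 <= e t) ->
  (forall t x, (0 < t.2 x)%N -> top x e t <= e t) -> 0 <= c ->
  (forall t, (0 < t.2 y)%N -> c <= e t) ->
  forall t, (0 < t.2 root)%N -> step_prob ^+ size y * c <= e t.
Proof.
move=> be e0 et c0 hy.
suff H w u : y = w ++ u -> forall t, (0 < t.2 u)%N -> step_prob ^+ size w * c <= e t.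
  by apply: H; rewrite cats0.
elim/last_ind: w u => [|w j IH] u; first by move=> /= yu t ut; rewrite mul1r; apply: hy; rewrite yu.
rewrite cat_rcons => yE t ut; apply: le_trans (et t u ut).
rewrite size_rcons exprS -mulrA; apply: top_step (neighbors_child j u) _ _ => //.
  by rewrite mulr_ge0 // exprn_ge0 // kap_ge0.
exact: IH.
Qed.

Lemma phi1_top_le y s x : (0 < s.2 x)%N -> top x (hit_value nu nb y 1) s <= hit_value nu nb y 1 s.
Proof.
move=> sx; have [xy|xy] := eqVneq x y; last by rewrite phi_top_neq.
rewrite xy in sx *; rewrite (phi1_active nu nb sx).
by have /andP[] := top01 nu nb y s (phi01 nu nb y 1).
Qed.

(** Each departure from the root gives a chance of at least [step_prob ^+ size y] to go straight to
    [y], so infinitely many departures reach it surely. In [bootstrap] form: the gap to c psi is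
    nonnegative, superharmonic, and at least 1 - c once [y] is occupied. *)
Lemma psi_le_visit y s : psi s <= hit_value nu nb y 1 s.
Proof.
apply: (@bootstrap _ _ (hit_value nu nb y 1) psi (step_prob ^+ size y)); first exact: kapX01.
- exact: phi_ge0.
- exact: psi_ge0.
move=> c c01 hc; have /andP[k0 k1] := kapX01 (size y); have /andP[c0 c1] := c01.
apply: psi_min => // [t|||t tr].
- exact: phi_ge0.
- nra.
- by move=> t x tx _; exact: phi1_top_le.
have bc : bnd (fun t => c * psi t) by exact: bndM.
have := @straight_path (fun t => hit_value nu nb y 1 t - c * psi t) y (1 - c) _ _ _ _ _ t tr.
have -> : (c + step_prob ^+ size y * (1 - c)) * psi t =
  c * psi t + step_prob ^+ size y * (1 - c) * psi t by ring.
move=> h; suff : step_prob ^+ size y * (1 - c) <= hit_value nu nb y 1 t - c * psi t.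
  have p0 := psi_ge0 nu nb root t; have p1 := psi_le1 nu nb root t.
  have q0 : 0 <= step_prob ^+ size y * (1 - c) by apply: mulr_ge0; [exact: ltW|lra].
  have : step_prob ^+ size y * (1 - c) * psi t <= step_prob ^+ size y * (1 - c).
    by rewrite -[leRHS]mulr1 ler_wpM2l.
  lra.
apply: h.
- exact: bndB.
- by move=> t'; rewrite subr_ge0.
- move=> t' x tx; rewrite topB // topZ // psi_top //; apply: lerB => //; exact: phi1_top_le.
- by rewrite subr_ge0.
move=> t' ty; rewrite phi1_active //.
by have := psi01 nu nb root t'; nra.
Qed.

(* By rerooting the tree at y = 0^n: the frog process started at the root reaches y
   as easily as the process started at y, in which the child 0y of y is removed,
   reaches the root. *)
Lemma phi_reroot (i0 : 'I_d) n : (0 < n)%N ->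
  hit_value nu nb (nseq n i0) 1 (single root) <=
  hit_value nu (pruned i0 n) root 1 (single (nseq n i0 : vertex d)).
Proof.
move=> n0; pose y : vertex d := nseq n i0; pose th : vertex d -> vertex d := theta i0 n.
have K : involutive th by exact: thetaK.
have thr : th root = y by rewrite /th (theta_nseq i0 (k := 0)) // subn0.
have thy : th y = root by rewrite -thr K.
pose h := hit_value nu (pruned i0 n) root 1.
(* The correspondence is followed only until [y] is reached: as long as all awake frogs have [tz]
   below n, their neighbourhoods are those of the pruned tree seen through [theta]. *)
pose Q s v := (v = 1) \/ ((forall u, (0 < s.2 u)%N -> (tz i0 u < n)%N) /\ v = h (pull th s)).
have Qh s v : Q s v -> 0 <= v <= 1.
  by move=> [->|[_ ->]]; [rewrite ler01 lexx|exact: phi01].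
apply: (@phi1_rel _ _ _ _ _ Q); last first.
- right; split; last by rewrite -[in RHS]thy pull_single.
  move=> u; rewrite /single /dirac_frog /=; case: (u =P root) => [-> _|//].
  by rewrite (tz_nseq i0 0).
- move=> s v x g [->|[ok ->]] sx xy g01 gQ.
    by have /andP[] := top01 nu nb x s g01.
  have okx := ok x sx.
  have sx' : (0 < (pull th s).2 (th x))%N by rewrite /= K.
  have thx : th x != root by rewrite -thy (inj_eq (inv_inj K)).
  rewrite /h -(phi_top_neq nu _ _ sx' thx); apply: (top_transfer (i := th)) => //.
  + exact: bnd01.
  + exact: perm_pruned.
  + move=> e0; have := perm_pruned okx; rewrite -/th e0 => /perm_nilP nx.
    by have := neighbors_neq0 i0 x; rewrite nx.
  move=> z zx.
  have zx' : th z \in nb x by rewrite (perm_mem (perm_pruned okx)) map_f.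
  have okz : th z = y \/ (tz i0 (th z) < n)%N.
    have [e1|e1] := ltnP (tz i0 (th z)) n; first by right.
    left; have h1 := tz_neighbors i0 zx'.
    rewrite (tz_neighbors_lt (i0 := i0) zx') ?(leq_trans okx e1) //.
    by congr nseq; lia.
  have outc D a D' a' : (forall u, (0 < a u)%N -> u = th z \/ (tz i0 u < n)%N) ->
      D' = D \o th -> a' = a \o th -> (0 < a (th z))%N -> g (D, a) <= h (D', a').
    (* Arrival at [y] on one side is arrival at the root on the other, where the bound is already
       1. *)
    move=> ha -> -> az; case: okz => [e|okz].
      have : (0 < (D \o th, a \o th).2 root)%N by change (0 < a (th root))%N; rewrite thr -e.
      by move=> hr; rewrite /h phi1_active //; case/andP: (g01 (D, a)).
    by apply: gQ; right; split => // u /ha[->|].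
  have hmv u : (0 < mv x (th z) s.2 u)%N -> u = th z \/ (tz i0 u < n)%N.
    rewrite /mv /add /rm; case: (u =P th z) => [->|_]; first by left.
    by rewrite muln0 addn0 => hu; right; apply: ok; lia.
  have emv : mv (th x) z (fun u => s.2 (th u)) = mv x (th z) s.2 \o th.
    by rewrite -[in RHS](K x) -(pull_mv (th x) z s.2 K); apply/funext => u /=; rewrite K.
  apply: wake_le => //=; first exact: bnd01.
    by move=> _; apply: outc => //; exact: mv_gt0z.
  move=> _ k; apply: outc => //.
  + move=> u; rewrite /add; case: (u =P th z) => [->|_]; first by left.
    by rewrite muln0 addn0; exact: hmv.
  + by rewrite -pull_vis.
  + by rewrite emv -pull_add.
  + by apply: add_gt0; exact: mv_gt0z.
- by move=> s v [->|[ok _]] // ry; have := ok _ ry; rewrite tz_nseq ltnn.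
- by move=> s v /Qh/andP[].
Qed.

End tree_value.

(** * Grafting a recurrent configuration *)

Section graft.
Context (d : nat) (i0 : 'I_d) (n : nat).
Local Notation root := (root_vertex d).
Local Notation nb := (@neighbors d).
Implicit Types (u w x y z : vertex d).
Let y0 : vertex d := nseq n i0.
Let c0 : vertex d := nseq n.+1 i0.

(* The configuration that is f outside the subtree of c0 and a copy of g inside. *)
Definition graft (X : Type) (f g : vertex d -> X) u : X :=
  if (n < tz i0 u)%N then g (take (size u - n.+1) u) else f u.

Definition graft_state (s b : state (vertex d)) : state (vertex d) :=
  (graft s.1 b.1, graft s.2 b.2).

Lemma tz_below w : (n < tz i0 (w ++ c0))%N.
Proof. by rewrite -suffix_nseq suffix_suffix. Qed.

Lemma belowP u : (n < tz i0 u)%N -> u = take (size u - n.+1) u ++ c0.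
Proof.
rewrite -suffix_nseq => /suffixP[w ->].
by rewrite size_cat size_nseq addnK take_size_cat.
Qed.

Lemma graft_out X (f g : vertex d -> X) u : (tz i0 u <= n)%N -> graft f g u = f u.
Proof. by rewrite /graft leqNgt => /negPf ->. Qed.

Lemma graft_in X (f g : vertex d -> X) w : graft f g (w ++ c0) = g w.
Proof. by rewrite /graft tz_below size_cat size_nseq addnK take_size_cat. Qed.

Lemma eq_graft X (f f' g g' : vertex d -> X) :
  (forall u, (tz i0 u <= n)%N -> f u = f' u) -> (forall w, g w = g' w) ->
  graft f g = graft f' g'.
Proof.
move=> hf hg; apply/funext => u; rewrite /graft; case: ltnP => h; first exact: hg.
exact: hf.
Qed.

Lemma cat_eq_in w z : (w ++ c0 == z ++ c0) = (w == z).
Proof.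
apply/eqP/eqP => [|->//] /(congr1 (fun u => take (size u - n.+1) u)).
by rewrite !size_cat !size_nseq !addnK !take_size_cat.
Qed.

Lemma in_neq_out w z : (tz i0 z <= n)%N -> (w ++ c0 == z) = false.
Proof. by move=> h; apply/eqP => e; have := tz_below w; rewrite e ltnNge h. Qed.

Lemma graft_vis_out z D D' : (tz i0 z <= n)%N -> graft (vis z D) D' = vis z (graft D D').
Proof.
move=> hz; apply/funext => u; rewrite /vis; have [h|h] := ltnP n (tz i0 u).
  by rewrite (belowP h) !graft_in in_neq_out.
by rewrite !graft_out.
Qed.

Lemma graft_add_out z k a a' : (tz i0 z <= n)%N -> graft (add z k a) a' = add z k (graft a a').
Proof.
move=> hz; apply/funext => u; rewrite /add; have [h|h] := ltnP n (tz i0 u).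
  by rewrite (belowP h) !graft_in in_neq_out // muln0 addn0.
by rewrite !graft_out.
Qed.

Lemma graft_rm_out z a a' : (tz i0 z <= n)%N -> graft (rm z a) a' = rm z (graft a a').
Proof.
move=> hz; apply/funext => u; rewrite /rm; have [h|h] := ltnP n (tz i0 u).
  by rewrite (belowP h) !graft_in in_neq_out // subn0.
by rewrite !graft_out.
Qed.

Lemma graft_mv_out x z a a' : (tz i0 x <= n)%N -> (tz i0 z <= n)%N ->
  graft (mv x z a) a' = mv x z (graft a a').
Proof. by move=> hx hz; rewrite /mv graft_add_out // graft_rm_out. Qed.

Lemma graft_rm_below z a a' : (n < tz i0 z)%N -> graft (rm z a) a' = graft a a'.
Proof.
move=> hz; apply: eq_graft => // u hu; rewrite /rm; case: (u =P z) => [e|_]; last by rewrite subn0.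
by rewrite e leqNgt hz in hu.
Qed.

Lemma graft_vis_in w D D' : graft D (vis w D') = vis (w ++ c0) (graft D D').
Proof.
apply/funext => u; rewrite /vis; have [h|h] := ltnP n (tz i0 u).
  by rewrite (belowP h) !graft_in cat_eq_in.
by rewrite !graft_out // eq_sym in_neq_out.
Qed.

Lemma graft_add_in w k a a' : graft a (add w k a') = add (w ++ c0) k (graft a a').
Proof.
apply/funext => u; rewrite /add; have [h|h] := ltnP n (tz i0 u).
  by rewrite (belowP h) !graft_in cat_eq_in.
by rewrite !graft_out // eq_sym in_neq_out // muln0 addn0.
Qed.

Lemma graft_rm_in w a a' : graft a (rm w a') = rm (w ++ c0) (graft a a').
Proof.
apply/funext => u; rewrite /rm; have [h|h] := ltnP n (tz i0 u).
  by rewrite (belowP h) !graft_in cat_eq_in.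
by rewrite !graft_out // eq_sym in_neq_out // subn0.
Qed.

Lemma graft_mv_in x z a a' : graft a (mv x z a') = mv (x ++ c0) (z ++ c0) (graft a a').
Proof. by rewrite /mv graft_add_in graft_rm_in. Qed.

Lemma tz_y0 : tz i0 y0 = n. Proof. exact: tz_nseq. Qed.
Lemma tz_c0 : tz i0 c0 = n.+1. Proof. exact: tz_nseq. Qed.

Lemma pruned_in x : (n < tz i0 x)%N -> pruned i0 n x = [::].
Proof. by rewrite /pruned => ->. Qed.

Lemma pruned_out x : (tz i0 x <= n)%N -> x != y0 -> pruned i0 n x = nb x.
Proof.
move=> hx xy; rewrite /pruned ltnNge hx /=; apply/all_filterP/allP => z zx.
rewrite leqNgt; apply/negP => hz.
have e : z = c0.
  rewrite (tz_neighbors_lt (i0 := i0) zx) ?(leq_ltn_trans hx hz) //.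
  by rewrite /c0; congr nseq; have := tz_neighbors i0 zx; lia.
case: (neighborsP zx) => [[j]|[j]]; rewrite e.
  by case=> _ xe; move: xy; rewrite -xe eqxx.
move=> xe; have := tz_below [:: j]; rewrite cat1s -xe ltnNge hx //.
Qed.

Lemma perm_pruned_y : perm_eq (nb y0) (c0 :: pruned i0 n y0).
Proof.
have cn : c0 \in nb y0 by exact: neighbors_child.
have e : pruned i0 n y0 = [seq z <- nb y0 | z != c0].
  rewrite /pruned tz_y0 ltnn; apply/eq_in_filter => z zy.
  apply/idP/idP => [h|h]; first by apply: contraTneq h => ->; rewrite tz_c0 ltnn.
  rewrite leqNgt; apply: contraNN h => h; apply/eqP.
  rewrite (tz_neighbors_lt (i0 := i0) zy) ?tz_y0 //.
  by rewrite /c0; congr nseq; have := tz_neighbors i0 zy; rewrite tz_y0; lia.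
rewrite e; apply: uniq_perm; first exact: neighbors_uniq.
  by rewrite /= mem_filter eqxx /= filter_uniq ?neighbors_uniq.
move=> z; rewrite in_cons mem_filter; case: (z =P c0) => [->|_] //=.
Qed.

End graft.

Section reflector.
Context (R : realType) (nu : probability nat R) (d : nat) (i0 : 'I_d) (n : nat).
Implicit Types (s t b o : state (vertex d)) (D : vertex d -> bool) (a : vertex d -> nat).
Implicit Types (x y z w u : vertex d).
Local Notation nb := (@neighbors d).
Local Notation root := (root_vertex d).
Local Notation top := (topple nu).
Local Notation wake := (awaken nu).
Local Notation psi := (psi nu nb root).
Local Notation h := (hit_value nu nb root 1).
Local Notation hp := (hit_value nu (pruned i0 n) root 1).
Local Notation kap := (step_prob R d).
Local Hint Resolve bnd_phi bnd_psi bnd_cst : core.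
Hypothesis n0 : (0 < n)%N.
Let y0 : vertex d := nseq n i0.
Let c0 : vertex d := nseq n.+1 i0.
Local Notation graft := (graft i0 n).
Local Notation graft_state := (graft_state i0 n).

Let y0_root : y0 != root.
Proof. by rewrite /y0; case: n n0. Qed.

Let c0_root w : (w ++ c0 : vertex d) != root.
Proof. by rewrite /c0; case: w. Qed.

Lemma kapE : d%:R = (1 - kap) / kap :> R.
Proof.
by rewrite /step_prob invrK mulrBl mul1r mulVf ?pnatr_eq0 // -natr1 addrK.
Qed.

(* A frog of the subtree of c0 that jumps to y0 is replaced by a spare frog waiting
   at c0; as infinitely many such jumps are attempted when the process in the
   subtree is recurrent, one of them occurs almost surely. *)
Lemma spare_frog s (mu : R) : 0 <= mu <= 1 ->
  (0 < s.2 y0)%N -> (forall b, b.1 root -> mu * psi b <= h (graft_state s b)) ->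
  forall b, b.1 root ->
  mu * psi b <= h (graft_state (s.1, rm y0 s.2) (b.1, add root 1 b.2)).
Proof.
move=> /andP[mu0 mu1] sy hs b0 b0r.
have [S SE] : exists S, forall b, S b = graft_state (s.1, rm y0 s.2) (b.1, add root 1 b.2).
  by eexists.
(* The claim concerns only [b] whose root is visited, a condition that moves preserve; other
   configurations get the largest value 1. *)
pose k b : R := if b.1 root then h (S b) else 1.
have k01 b : 0 <= k b <= 1.
  by rewrite /k; case: ifP => _; [exact: phi01|rewrite ler01 lexx].
have bk : bnd k by exact: bnd01.
have kE b : b.1 root -> k b = h (S b) by rewrite /k => ->.
have S1 b w : (S b).1 (w ++ c0) = b.1 w by rewrite SE /= graft_in.
have S2 b w : (0 < b.2 w)%N -> (0 < (S b).2 (w ++ c0))%N.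
  by rewrite SE /= graft_in; exact: add_gt0.
have Smv b x w : (0 < b.2 x)%N ->
    S (b.1, mv x w b.2) = ((S b).1, mv (x ++ c0) (w ++ c0) (S b).2).
  by move=> bx; rewrite !SE /graft_state /= -(mv_add w root 1 bx) graft_mv_in.
have Swake b x w j : (0 < b.2 x)%N ->
    S (vis w b.1, add w j (mv x w b.2)) =
    (vis (w ++ c0) (S b).1, add (w ++ c0) j (mv (x ++ c0) (w ++ c0) (S b).2)).
  move=> bx; rewrite !SE /graft_state /= addC -(mv_add w root 1 bx) graft_vis_in.
  by rewrite graft_add_in graft_mv_in.
have wk b x w : b.1 root -> (0 < b.2 x)%N ->
    wake w k (b.1, mv x w b.2) <= wake (w ++ c0) h ((S b).1, mv (x ++ c0) (w ++ c0) (S b).2).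
  move=> br bx; apply: wake_le => //=.
    by move=> _; rewrite kE // Smv.
  by move=> _ j; rewrite kE ?Swake // /vis /= br orbT.
rewrite -SE; suff : forall b, mu * psi b <= k b by move=> /(_ b0); rewrite kE.
apply: (@bootstrap _ _ k (fun b => mu * psi b) kap).
- by rewrite kap_gt0 kap_le1.
- by move=> b; case/andP: (k01 b).
- by move=> b; rewrite mulr_ge0 // psi_ge0.
move=> c /andP[c0' c1] hc b; rewrite mulrA; move: b.
have kp := kap_gt0 R d; have kp1 := kap_le1 R d.
apply: psi_min => //.
- by move=> b; case/andP: (k01 b).
- by rewrite mulr_ge0 //; nra.
- move=> b x bx xr; have [br|br] := boolP (b.1 root); last first.
    by rewrite [leRHS]/k (negPf br); case/andP: (top01 nu nb x b k01).
  rewrite kE // -(phi_top_neq nu (r := root) nb 1 (S2 _ _ bx)) ?c0_root //.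
  apply: (@top_transfer_rev _ _ _ _ _ (fun u => u ++ c0)) => //.
    by rewrite neighbors_cat.
    by move=> e; have := neighbors_neq0 i0 x; rewrite e.
  by move=> w _; exact: wk.
move=> b br; have [b1|b1] := boolP (b.1 root); last first.
  rewrite [leRHS]/k (negPf b1); have /andP[p0 p1] := psi01 nu nb root b.
  have c2 : 0 <= c + kap * (1 - c) <= 1 by nra.
  by case/andP: c2 => c2 c3; rewrite mulr_ile1 ?mulr_ge0 ?mulr_ile1.
rewrite kE // -(phi_top_neq nu (r := root) nb 1 (S2 _ _ br)) ?c0_root //.
(* A frog leaving c0 goes to y0 with probability [kap], which restores [graft_state s b]; otherwise
   it goes to a child of c0, as a frog leaving the root does in the original process. *)
have e : nb (root ++ c0) = y0 :: [seq z ++ c0 | z <- nb root].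
  by rewrite /= -children_cat.
rewrite /topple e [size _]/= size_map size_neighbors_root big_cons big_map -/kap.
have A1 : mu * psi b <= wake y0 h ((S b).1, mv (root ++ c0) y0 (S b).2).
  apply: le_trans (phi_wake nu nb root 1 y0 _); apply: le_trans (hs b b1) _.
  rewrite le_eqVlt; apply/orP; left; apply/eqP; congr (hit_value _ _ _ _ (_, _)).
    by rewrite SE.
  by rewrite SE /= /mv graft_add_in rm_add1 -graft_add_out ?tz_nseq // add_rm1.
have A2 : d%:R * (c * (mu * psi b)) <= \sum_(z <- nb root)
    wake (z ++ c0) h ((S b).1, mv (root ++ c0) (z ++ c0) (S b).2).
  have dn : (d%:R : R) != 0 by rewrite pnatr_eq0; case: d i0 => // -[].
  have d0 : 0 < (d%:R : R) by rewrite lt_neqAle eq_sym dn ler0n.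
  rewrite -ler_pdivlMl //; apply: (@le_trans _ _ (top nb root k b)); last first.
    rewrite /topple; case e1 : (nb root) (neighbors_neq0 i0 root) => [|u l] // _.
    rewrite -e1 size_neighbors_root; apply: ler_wpM2l; first by rewrite invr_ge0 ltW.
    by apply: ler_sum => w _; exact: wk.
  rewrite mulrA -[X in _ * X](@psi_top R nu _ nb root root b br) -topZ //.
  by apply: top_mono => // [|t]; [exact: bndM|rewrite -mulrA].
have kd : kap * d%:R = 1 - kap by rewrite kapE mulrCA divff ?mulr1 ?gt_eqF.
rewrite -mulrA [leRHS]mulrDr; move: A1 A2; set M := mu * psi b; set A := wake _ _ _; set B := \sum_(_ <- _) _.
move=> A1 A2; have -> : (c + kap * (1 - c)) * M = kap * M + kap * (d%:R * (c * M)).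
  have -> : kap * (d%:R * (c * M)) = (kap * d%:R) * (c * M) by ring.
  by rewrite kd; ring.
by apply: lerD; rewrite ler_pM2l.
Qed.

(* Reflectors are good: a state consisting of s and of a copy b of a configuration
   grafted at c0 does at least as well as s in the tree pruned at c0, provided that
   the process started from b is recurrent. *)
Lemma graft_ge s b : b.1 root -> hp s * psi b <= h (graft_state s b).
Proof.
(* [g s] is the best constant in the claim, uniformly over the grafted configurations; it suffices
   that [g] be superharmonic for the pruned tree. *)
move=> br; pose Sg s := [set l : R | 0 <= l <= 1 /\
  forall b, b.1 root -> l * psi b <= h (graft_state s b)].
pose g s := sup (Sg s).
have Sg0 t : Sg t 0 by split=> [|b' _]; rewrite ?lexx ?ler01 // mul0r phi_ge0.
have hS t : has_sup (Sg t) by split; [exists 0|exists 1 => l [/andP[]]].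
have gub t l : Sg t l -> l <= g t by move=> Sl; apply: ub_le_sup => //; case: (hS t).
have g01 t : 0 <= g t <= 1.
  by rewrite gub //=; apply: sup_le_ub => [|l [/andP[]]] //; case: (hS t).
have gP t b' : b'.1 root -> g t * psi b' <= h (graft_state t b').
  move=> b'r; have [->|pn] := eqVneq (psi b') 0; first by rewrite mulr0 phi_ge0.
  have p0 : 0 < psi b' by rewrite lt_neqAle eq_sym pn psi_ge0.
  rewrite -ler_pdivlMr //; apply: sup_le_ub; first by case: (hS t).
  by move=> l [_ hl]; rewrite ler_pdivlMr // hl.
have bg : bnd g by exact: bnd01.
have bpg b' : bnd (fun t => psi b' * g t) by exact: bndM.
have wz x z t b' : (tz i0 x <= n)%N -> (tz i0 z <= n)%N -> b'.1 root ->
    wake z (fun t => psi b' * g t) (t.1, mv x z t.2) <=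
    wake z h ((graft_state t b').1, mv x z (graft_state t b').2).
  move=> hx hz b'r; apply: wake_le => // [|_|_ j]; rewrite /graft_state /=.
  - by rewrite graft_out.
  - by rewrite -graft_mv_out // mulrC; exact: (gP (_, _) b').
  - by rewrite -graft_mv_out // -graft_vis_out // -graft_add_out // mulrC; exact: (gP (_, _) b').
have prz x z : (tz i0 x <= n)%N -> z \in pruned i0 n x -> (tz i0 z <= n)%N.
  by move=> hx; rewrite /pruned ltnNge hx mem_filter => /andP[].
suff : hp s <= g s.
  by move=> hg; apply: le_trans (gP s b br); rewrite ler_wpM2r // psi_ge0.
apply: phi_minS => // [t|t x tx xr|t tr].
- by case/andP: (g01 t).
- have [hx|hx] := ltnP n (tz i0 x).
    rewrite /topple pruned_in //; apply: gub; split=> // b' b'r.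
    have -> : graft_state t b' = graft_state (t.1, rm x t.2) b'.
      by rewrite /graft_state /= graft_rm_below.
    exact: gP.
  have act b' : (0 < (graft_state t b').2 x)%N by rewrite /= graft_out.
  have [xy|xy] := eqVneq x y0; last first.
    apply: gub; split=> [|b' b'r]; first exact: top01.
    rewrite -(phi_top_neq nu nb 1 (act b') xr) mulrC -topZ //.
    apply: (@top_transfer_rev _ _ _ _ _ id) => //.
    + by rewrite map_id pruned_out.
    + by rewrite pruned_out // => e; have := neighbors_neq0 i0 x; rewrite e.
    + by move=> z zx; apply: wz => //; exact: prz zx.
  rewrite {x}xy in tx xr hx act *; set l := top _ _ _ _.
  have l01 : 0 <= l <= 1 by exact: top01.
  have kp := kap_gt0 R d; have kp1 := kap_le1 R d.
  have dn : (d%:R : R) != 0 by rewrite pnatr_eq0; case: d i0 => // -[].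
  have d0 : 0 < (d%:R : R) by rewrite lt_neqAle eq_sym dn ler0n.
  have kd : kap * d%:R = 1 - kap by rewrite kapE mulrCA divff ?mulr1 ?gt_eqF.
  have sz : size (pruned i0 n y0) = d.
    have := perm_size (perm_pruned_y i0 n); rewrite /= -/y0.
    have -> : size (nb y0) = d.+1.
      by rewrite /y0; case: n n0 => // n' _; rewrite size_neighbors.
    by case.
  (* In the full tree y0 has the extra neighbour c0. A jump there, of probability [kap], only turns
     the frog into a spare one, worth [g t] by [spare_frog]; the other jumps are those of the pruned
     tree, worth [l]. Solving the inequality removes the loop. *)
  suff le : (1 - kap) * l + kap * g t <= g t.
    have : kap * d%:R * l <= kap * d%:R * g t by rewrite kd; lra.
    by rewrite ler_pM2l // mulr_gt0.
  apply: gub; split=> [|b' b'r]; first by have := g01 t; nra.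
  rewrite -(phi_top_neq nu nb 1 (act b') xr) /topple.
  case e : (nb y0) (neighbors_neq0 i0 y0) => [//|u0 l0] _; rewrite -e.
  have -> : size (nb y0) = d.+1 by rewrite (perm_size (perm_pruned_y i0 n)) /= sz.
  rewrite (perm_big _ (perm_pruned_y i0 n)) /= big_cons -/y0 -/c0 -/kap.
  have A1 : g t * psi b' <= wake c0 h (graft t.1 b'.1, mv y0 c0 (graft t.2 b'.2)).
    have ec : graft t.1 b'.1 c0 = b'.1 root by exact: (graft_in i0 n _ _ [::]).
    rewrite /awaken [(_, _).1]/= ec b'r.
    apply: le_trans (spare_frog (g01 t) tx (gP t) b'r) _.
    rewrite le_eqVlt; apply/orP; left; apply/eqP; congr (hit_value _ _ _ _ (_, _)).
    by rewrite /= (graft_add_in i0 n root) graft_rm_out.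
  have A2 : d%:R * (psi b' * l) <= \sum_(z <- pruned i0 n y0)
      wake z h (graft t.1 b'.1, mv y0 z (graft t.2 b'.2)).
    rewrite /l -topZ // -ler_pdivlMl // /topple.
    case e1 : (pruned i0 n y0) sz => [|u1 l1] sz; first by rewrite -sz in d0; rewrite ltxx in d0.
    rewrite -e1 in sz *; rewrite sz; apply: ler_wpM2l; first by rewrite invr_ge0 ltW.
    rewrite big_seq [leRHS]big_seq; apply: ler_sum => z zy.
    by apply: (wz y0 z t b') => //; exact: prz zy.
  have -> : ((1 - kap) * l + kap * g t) * psi b' =
      kap * (g t * psi b' + d%:R * (psi b' * l)).
    by rewrite -kd; ring.
  by rewrite ler_pM2l // lerD.
- apply: (@le_trans _ _ 1); first by have /andP[] := top01 nu (pruned i0 n) root t (phi01 nu (pruned i0 n) root 0).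
  apply: gub; split=> [|b' b'r]; first by rewrite ler01 lexx.
  have tr' : (0 < (graft_state t b').2 root)%N by rewrite /= graft_out // (tz_nseq i0 0).
  by rewrite mul1r (phi1_active nu nb tr') psi_le1.
Qed.

(** The frog steps from y0 to c0 (a factor [kap]), finds at least one sleeper there (the
    expectation), and a frog steps back to y0 (the second [kap]). What remains below c0 is the
    initial configuration plus extra frogs, to which [graft_ge] applies. *)
Lemma visit_root_ge : kap ^+ 2 * hp (single y0) * psi (single root) *
  Ex nu (fun k => (0 < k)%N%:R) <= h (single y0).
Proof.
have kp := kap_ge0 R d.
have act : (0 < (single y0).2 y0)%N by rewrite /= /dirac_frog eqxx.
rewrite -(phi_top_neq nu nb 1 act y0_root).
have c0y : c0 \in nb y0 by exact: neighbors_child.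
apply: le_trans (top_ge1 nu _ (phi_ge0 nu nb root 1) c0y).
apply: (@le_trans _ _ (kap * wake c0 h ((single y0).1, mv y0 c0 (single y0).2))); last first.
  by rewrite ler_wpM2r ?(kap_le _ c0y) // wake_ge0 // => t; exact: phi_ge0.
rewrite exprS expr1 -!mulrA ler_wpM2l // !mulrA -ExZ; last first.
  by apply: bnd01 => j; case: (0 < j)%N; rewrite ?lexx ?ler01.
rewrite /awaken.
rewrite ifF; last by apply/eqP => /(congr1 size); rewrite !size_nseq; lia.
apply: Ex_le.
- by apply: bndM => //; apply: bnd01 => j; case: (0 < j)%N; rewrite ?lexx ?ler01.
- exact: bnd_slice.
move=> j; case: j => [|j]; first by rewrite mulr0 phi_ge0.
rewrite mulr1 [(_, _).1]/= [(_, _).2]/=.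
set s := (_, _).
have sc : (0 < s.2 c0)%N by rewrite /s /= /add eqxx; lia.
rewrite -(phi_top_neq nu nb 1 sc) ?(c0_root [::]) //.
have y0c : y0 \in nb c0 by exact: neighbors_parent.
apply: le_trans (top_ge1 nu _ (phi_ge0 nu nb root 1) y0c).
rewrite -mulrA; apply: ler_pM => //; [|exact: (kap_le R y0c)|].
  by rewrite mulr_ge0 ?phi_ge0 ?psi_ge0.
rewrite /awaken ifT; last by rewrite /s /= /vis eqxx orbT.
pose b : state (vertex d) := ((single root).1, add root j (single root).2).
have -> : ((s.1, mv c0 y0 s.2).1, (s.1, mv c0 y0 s.2).2) = graft_state (single y0) b.
  have inE w : (w ++ c0 == c0) = (w == root) by exact: (cat_eq_in i0 n w [::]).
  have inN w : (w ++ c0 == y0) = false by apply: in_neq_out; rewrite tz_nseq.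
  have outN u : (tz i0 u <= n)%N -> (u == c0) = false.
    by move=> hu; apply/eqP => e; move: hu; rewrite e tz_nseq ltnn.
  rewrite /b /graft_state /s /=; congr (_, _); apply/funext => u.
    rewrite /vis; have [hu|hu] := ltnP n (tz i0 u); last by rewrite graft_out ?outN.
    by rewrite (belowP hu) graft_in inE inN orbF.
  rewrite /mv /add /rm /dirac_frog; have [hu|hu] := ltnP n (tz i0 u).
    by rewrite (belowP hu) graft_in inE inN; case: (_ == root); lia.
  by rewrite graft_out // outN //; case: (u == y0); lia.
apply: le_trans (graft_ge (single y0) (b := b) _); last by rewrite /= eqxx.
rewrite ler_wpM2l ?phi_ge0 //.
exact: psi_addf.
Qed.

End reflector.

(** * Children of the root *)

Section push.
Context (d : nat) (z : vertex d).
Implicit Types (u w x : vertex d) (a : vertex d -> nat) (D : vertex d -> bool).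

(* Copy of a in the subtree of z. *)
Definition push a : vertex d -> nat :=
  fun u => if suffix z u then a (take (size u - size z) u) else 0%N.

Definition below D : vertex d -> bool := fun u => D (u ++ z).

Lemma push_cat a w : push a (w ++ z) = a w.
Proof. by rewrite /push suffix_suffix size_cat addnK take_size_cat. Qed.

Lemma push_gt0 a u : (0 < push a u)%N -> exists2 w, u = w ++ z & (0 < a w)%N.
Proof.
rewrite /push; case: ifP => // /suffixP[w ->]; rewrite size_cat addnK take_size_cat // => aw.
by exists w.
Qed.

Lemma cat_eqr w w' : (w ++ z == w' ++ z) = (w == w').
Proof.
apply/eqP/eqP => [|->//] /(congr1 (fun u => take (size u - size z) u)).
by rewrite !size_cat !addnK !take_size_cat.
Qed.

Lemma eq_push (f : vertex d -> nat) a : (forall w, f (w ++ z) = a w) ->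
  (forall u, ~~ suffix z u -> f u = 0%N) -> f = push a.
Proof.
move=> h1 h0; apply/funext => u; have [/suffixP[w ->]|h] := boolP (suffix z u).
  by rewrite h1 push_cat.
by rewrite h0 // /push (negPf h).
Qed.

Lemma not_suffix_neq u w : ~~ suffix z u -> (u == w ++ z) = false.
Proof. by move=> h; apply: contraNF h => /eqP ->; exact: suffix_suffix. Qed.

Lemma push_add w k a : push (add w k a) = add (w ++ z) k (push a).
Proof.
apply/esym/eq_push => [w'|u h]; rewrite /add; first by rewrite push_cat cat_eqr.
by rewrite not_suffix_neq // /push (negPf h) muln0.
Qed.

Lemma push_rm w a : push (rm w a) = rm (w ++ z) (push a).
Proof.
apply/esym/eq_push => [w'|u h]; rewrite /rm; first by rewrite push_cat cat_eqr.
by rewrite /push (negPf h).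
Qed.

Lemma push_mv x w a : push (mv x w a) = mv (x ++ z) (w ++ z) (push a).
Proof. by rewrite /mv push_add push_rm. Qed.

Lemma push_dirac w : push (dirac_frog w) = dirac_frog (w ++ z).
Proof.
by apply/esym/eq_push => [w'|u h]; rewrite /dirac_frog ?cat_eqr ?not_suffix_neq.
Qed.

Lemma under_vis w D : below (vis (w ++ z) D) = vis w (below D).
Proof. by apply/funext => u; rewrite /below /vis cat_eqr. Qed.

Lemma push_root a : z != [::] -> push a (root_vertex d) = 0%N.
Proof. by move=> z0; rewrite /push suffixs0 (negPf z0). Qed.

Lemma cat_neq_root w : z != [::] -> w ++ z != root_vertex d.
Proof. by case: w => // j w. Qed.

End push.

Lemma addf0 (V : eqType) (a : V -> nat) : addf a (fun=> 0%N) = a.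
Proof. by apply/funext => u; rewrite /addf addn0. Qed.

Lemma addf_dirac (V : eqType) (a : V -> nat) x : addf a (dirac_frog x) = add x 1 a.
Proof. by apply/funext => u; rewrite /addf /add mul1n. Qed.

Section special_cases.
Context (R : realType) (nu : probability nat R) (d : nat) (i0 : 'I_d).
Implicit Types (s t : state (vertex d)) (D : vertex d -> bool) (a : vertex d -> nat).
Implicit Types (x y z w u : vertex d).
Local Notation nb := (@neighbors d).
Local Notation root := (root_vertex d).
Local Notation top := (topple nu).
Local Notation wake := (awaken nu).
Local Notation phi := (hit_value nu nb root).
Local Notation h := (phi 1).
Local Notation psi := (psi nu nb root).
Local Notation kap := (step_prob R d).
Local Hint Resolve bnd_phi bnd_psi bnd_cst : core.
Let z0 : vertex d := [:: i0].

Lemma dR_gt0 : 0 < (d%:R : R).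
Proof. by rewrite ltr0n; case: d i0 => // -[]. Qed.

Lemma kap_d : kap * d%:R = 1 - kap.
Proof. by rewrite kapE mulrCA divff ?mulr1 // gt_eqF // kap_gt0. Qed.

(* Compare the process started in the subtree of z0 with the process where frogs
   leaving this subtree are reflected: at each of the first m moves from the root of
   the subtree the exit is avoided with probability 1 - kap. *)
Lemma exit_le m s D : below z0 D = s.1 ->
  h (D, push z0 s.2) <= 1 - (1 - kap) ^+ m * (1 - phi m s).
Proof.
have kp := kap_gt0 R d; have kp1 := kap_le1 R d.
have r01 k : 0 <= (1 - kap) ^+ k <= 1.
  by rewrite exprn_ge0 ?exprn_ile1 ?subr_ge0 //; lra.
pose G k t : R := 1 - (1 - kap) ^+ k * (1 - phi k t).
have G01 k t : 0 <= G k t <= 1.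
  by rewrite /G; have := r01 k; have := phi01 nu nb root k t; nra.
have GE k : G k = fun t => (1 - (1 - kap) ^+ k) + (1 - kap) ^+ k * phi k t.
  by apply/funext => t; rewrite /G; ring.
have bG k : bnd (G k) by exact: bnd01.
have topG x k t : top nb x (G k) t = 1 - (1 - kap) ^+ k * (1 - top nb x (phi k) t).
  rewrite GE (@top_affine R nu _ nb x (1 - (1 - kap) ^+ k) ((1 - kap) ^+ k) (phi k) t) //.
  by ring.
move=> De; pose Q t v := exists s m, [/\ below z0 t.1 = s.1, t.2 = push z0 s.2 & v = G m s].
apply: (@phi1_rel _ _ _ _ _ Q); last by exists s, m.
- by move=> t v [s' [k [_ _ ->]]]; case/andP: (G01 k s').
- by move=> t v [s' [k [_ -> _]]]; rewrite push_root.
move=> t v x g [s' [k [e1 e2 ->]]] tx xr g01 gQ.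
have bg := bnd01 g01.
have [w xw s'w] : exists2 w, x = w ++ z0 & (0 < s'.2 w)%N.
  by apply: push_gt0; rewrite -e2.
have gG w' k' : (0 < s'.2 w)%N -> wake (w' ++ z0) g (t.1, mv x (w' ++ z0) t.2) <=
    wake w' (G k') (s'.1, mv w w' s'.2).
  move=> _; apply: wake_le => //= [|_|_ l]; first by rewrite -e1.
    apply: gQ; exists (s'.1, mv w w' s'.2), k'; split=> //.
    by rewrite push_mv e2 xw.
  apply: gQ; exists (vis w' s'.1, add w' l (mv w w' s'.2)), k'; split=> //=.
    by rewrite under_vis e1.
  by rewrite push_add push_mv e2 xw.
have [wr|wr] := eqVneq w root; last first.
  apply: (@le_trans _ _ (top nb w (G k) s')); last by rewrite topG phi_top_neq.
  apply: (@top_transfer _ _ _ _ _ (fun u => u ++ z0)) => //.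
  - by rewrite xw neighbors_cat.
  - by move=> e; have := neighbors_neq0 i0 w; rewrite e.
  - by move=> w' _; apply: gG.
case: k => [|k]; first by rewrite /G phi0; have /andP[_] := top01 nu nb x t g01; rewrite subrr mulr0 subr0.
have -> : G k.+1 s' = kap + (1 - kap) * top nb root (G k) s'.
  have s'r : (0 < s'.2 root)%N by rewrite -wr.
  by rewrite topG phi_top_eq // /G exprS; ring.
rewrite xw wr /topple [root ++ z0]/= [neighbors [:: i0]]/=.
rewrite [size _]/= size_children -/kap big_cons.
case e : (nb root) (neighbors_neq0 i0 root) => [//|u0 l0] _; rewrite -e size_neighbors_root.
rewrite (children_cat (root : vertex d) z0) big_map mulrDr -kap_d.
apply: lerD.
  rewrite -[leRHS]mulr1; apply: ler_wpM2l; first exact: ltW.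
  rewrite -(wake_cst nu root 1 (t.1, mv z0 root t.2)).
  by apply: wake_le => // [_|_ l]; case/andP: (g01 (t.1, mv z0 root t.2)) => //; case/andP: (g01 (vis root t.1, add root l (mv z0 root t.2))).
rewrite -mulrA; apply: ler_wpM2l; first exact: ltW.
rewrite mulrA divff ?mul1r ?gt_eqF ?dR_gt0 //.
by apply: ler_sum => w' _; have := gG w' k s'w; rewrite xw wr.
Qed.

(** A deficit 1 - phi m would leave the exit untaken with probability at least (1 - kap)^m times
    that deficit. *)
Lemma phi_eq1_of_exit : h (single z0) = 1 -> forall m, phi m (single root) = 1.
Proof.
move=> h1 m; have := @exit_le m (single root) (fun u => u == z0).
rewrite push_dirac -/(single z0) h1 => le.
have {le}le := le _.
have e : below z0 (fun u => u == z0) = (single root).1.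
  by apply/funext => u; rewrite /below -{2}(cat0s z0) cat_eqr.
have r0 : 0 < 1 - kap by rewrite -kap_d mulr_gt0 ?kap_gt0 ?dR_gt0.
have := le e; have := phi_le1 nu nb root m (single root) => p1 p2.
have : (1 - kap) ^+ m * (1 - phi m (single root)) <= 0 by lra.
by rewrite pmulr_rle0 ?exprn_gt0 // => p3; lra.
Qed.

(* Without sleeping frogs, only the initial frog moves. *)
Lemma phi_single_nosleep m : Ex nu (fun k => (0 < k)%N%:R) = 0 ->
  (forall j : 'I_d, h (single ([:: j] : vertex d)) <= h (single z0)) ->
  phi m.+1 (single root) <= h (single z0) ^+ m.
Proof.
move=> E0 hj; set q := h (single z0).
have q01 : 0 <= q <= 1 by exact: phi01.
have qX k : 0 <= q ^+ k <= 1 by case/andP: q01 => q0 q1; rewrite exprn_ge0 ?exprn_ile1.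
pose one s := `[< exists x, s.2 = dirac_frog x >].
(* The first departure needs one arrival, of probability [h s]; each of the k - 1 later ones needs a
   return from a child of the root. States without exactly one awake frog get the trivial bound
   1. *)
pose g k s : R := if one s then (if k is k'.+1 then q ^+ k' * h s else 1) else 1.
have g01 k s : 0 <= g k s <= 1.
  rewrite /g; case: ifP => _; last by rewrite lexx ler01.
  case: k => [|k]; first by rewrite lexx ler01.
  by have := qX k; have := phi01 nu nb root 1 s; nra.
have bg k : bnd (g k) by exact: bnd01.
have one1 D x : one (D, dirac_frog x) by apply/asboolP; exists x.
have gE k D x : g k.+1 (D, dirac_frog x) = q ^+ k * h (D, dirac_frog x).
  by rewrite /g one1.
have wk0 z f s : bnd f -> wake z f s = if s.1 z then f s else f (vis z s.1, s.2).
  by move=> bf; rewrite /awaken; case: ifP => // _; rewrite Ex_at0 ?add0 //; exact: bnd_slice.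
have mvd x w : mv x w (dirac_frog x) = dirac_frog w.
  by apply/funext => u; rewrite /mv /add /rm /dirac_frog subnn mul1n.
suff : phi m.+1 (single root) <= g m.+1 (single root).
  by rewrite gE -/(single root) phi1_active ?mulr1 // /= /dirac_frog eqxx.
apply: phi_min => // [n t|t|n t x tx].
- by case/andP: (g01 n t).
- by rewrite /g if_same.
have [/asboolP[x' e]|no] := boolP (one t); last first.
  by rewrite [leRHS]/g (negPf no); have /andP[] := top01 nu nb x t (g01 (n.+1 - (x == root))%N).
have xx : x = x' by move: tx; rewrite e /dirac_frog; case: (x =P x').
subst x'; have -> : t = (t.1, dirac_frog x) by case: t e {tx} => D a /= ->.
move: t.1 => D {t tx e}.
have dx : (0 < (D, dirac_frog x).2 x)%N by rewrite /= /dirac_frog eqxx.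
rewrite gE; have [xr|xr] := eqVneq x root; last first.
  rewrite subn0 -(phi_top_neq nu nb 1 dx xr) -topZ //.
  apply: (@top_transfer _ _ _ _ _ id) => //.
  - exact: bndM.
  - by rewrite map_id.
  - by move=> e; have := neighbors_neq0 i0 x; rewrite e.
  move=> z _; rewrite !wk0 //; last exact: bndM.
  by rewrite /= mvd; case: ifP => _; rewrite gE.
rewrite (phi1_active nu nb (s := (D, dirac_frog x))) ?mulr1; last by rewrite -xr.
rewrite xr subSS subn0; case: n => [|n].
  by have /andP[] := top01 nu nb root (D, dirac_frog root) (g01 0%N).
rewrite -(top_cst nu nb root (q ^+ n.+1) (D, dirac_frog root)).
apply: (@top_transfer _ _ _ _ _ id) => //.
- by rewrite map_id.
- by move=> e; have := neighbors_neq0 i0 root; rewrite e.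
move=> z zr; rewrite wake_cst wk0 //=.
have [j zE] : exists j, z = [:: j] by case: (neighborsP zr) => -[j] // ->; exists j.
have hz D' : D' z -> g n.+1 (D', mv root z (dirac_frog root)) <= q ^+ n.+1.
  move=> Dz; rewrite mvd gE exprSr ler_wpM2l //; first by case/andP: (qX n).
  apply: (le_trans _ (hj j)); rewrite -zE; apply: phi_vis => u /eqP -> //.
by case: ifP => [Dz|_]; apply: hz => //; rewrite /vis eqxx.
Qed.

End special_cases.

(** * The frozen model *)

Section frozen_root.
Context (R : realType) (nu : probability nat R) (d : nat) (i0 : 'I_d).
Implicit Types (s t : state (vertex d)) (D : vertex d -> bool) (a : vertex d -> nat).
Implicit Types (x y z w u : vertex d).
Local Notation nb := (@neighbors d).
Local Notation root := (root_vertex d).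
Local Notation top := (topple nu).
Local Notation wake := (awaken nu).
Local Notation phi := (hit_value nu nb root).
Local Notation h := (phi 1).
Local Notation psi := (psi nu nb root).
Local Notation kap := (step_prob R d).

(* The root is given no neighbours: frogs reaching it are counted, then removed. *)
Definition frozen_neighbors x := if x == root then [::] else nb x.
Local Notation phiF := (hit_value nu frozen_neighbors root).
Local Hint Resolve bnd_phi bnd_psi bnd_cst : core.

Lemma frozen_neq x : x != root -> frozen_neighbors x = nb x.
Proof. by rewrite /frozen_neighbors => /negPf ->. Qed.

Lemma phiF_root m s : (0 < s.2 root)%N -> phiF m.+1 s = phiF m (s.1, rm root s.2).
Proof. by move=> sr; rewrite -phi_top_eq. Qed.

(** Freezing the root changes nothing before the first arrival there. *)
Lemma phiF1 s : phiF 1 s = h s.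
Proof.
have topE x f t : x != root -> topple nu frozen_neighbors x f t = top nb x f t.
  by move=> xr; rewrite /topple frozen_neq.
apply/eqP; rewrite eq_le; apply/andP; split; apply: phi_minS => // [t|t x tx xr|t tr].
- exact: phi_ge0.
- by rewrite topE // phi_top_neq.
- rewrite (phi1_active nu nb tr).
  by have /andP[] := top01 nu frozen_neighbors root t (phi01 nu frozen_neighbors root 0).
- exact: phi_ge0.
- by rewrite -topE // phi_top_neq.
- rewrite (phi1_active nu frozen_neighbors tr).
  by have /andP[] := top01 nu nb root t (phi01 nu nb root 0).
Qed.

(** By symmetry only the depth of the starting vertex counts: [digit_swap] fixes the root and so
    respects both graphs. *)
Lemma phi_single_sym (nb' : vertex d -> seq (vertex d)) m y :
  (forall x, nb' x = nb x) \/ (forall x, nb' x = frozen_neighbors x) ->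
  hit_value nu nb' root m (single y) = hit_value nu nb' root m (single (nseq (size y) i0 : vertex d)).
Proof.
move=> hnb; pose sg : vertex d -> vertex d := digit_swap i0 y.
have K : involutive sg by exact: digit_swapK.
have pm x : perm_eq (nb' (sg x)) (map sg (nb' x)).
  have pn : perm_eq (nb (sg x)) (map sg (nb x)).
    by apply: perm_neighbors => // u v; exact: digit_swap_neighbors.
  case: hnb => h; rewrite !h // /frozen_neighbors.
  have -> : (sg x == root) = (x == root) by case: x {pn}.
  by case: ifP.
have e : sg (nseq (size y) i0) = y by exact: digit_swap_nseq.
have e' : sg y = nseq (size y) i0 by rewrite -{1}e K.
apply/eqP; rewrite eq_le; apply/andP; split.
  have := @phi_iso R nu _ nb' nb' root sg m (single (nseq (size y) i0 : vertex d)) K pm.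
  by rewrite -{1}e' pull_single.
have := @phi_iso R nu _ nb' nb' root sg m (single y) K pm.
by rewrite -{1}e pull_single.
Qed.

(* Each frog reaching the root in the frozen model succeeds with probability q, the
   (C+1)-st one surely; mix q C k is the probability of a success among the frogs
   from the k-th on. *)
Fixpoint mix (q : R) (C k : nat) s : R :=
  if C is C'.+1 then q * phiF k s + (1 - q) * mix q C' k.+1 s else phiF k s.

Section mix.
Variable q : R.
Hypothesis q01 : 0 <= q <= 1.

Lemma mix01 C k s : 0 <= mix q C k s <= 1.
Proof.
elim: C k => [|C IH] k /=; first exact: phi01.
have := IH k.+1; have := phi01 nu frozen_neighbors root k s; move: q01 (phiF k s) (mix q C k.+1 s).
by move=> /andP[q0 q1] A B /andP[A0 A1] /andP[B0 B1]; apply/andP; split; nra.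
Qed.

Lemma bnd_mix C k : bnd (mix q C k).
Proof. by apply: bnd01 => s; exact: mix01. Qed.

Lemma mix_vis C k D D' a : (forall u, D u -> D' u) -> mix q C k (D', a) <= mix q C k (D, a).
Proof.
move=> DD'; elim: C k => [|C IH] k /=; first exact: phi_vis.
have p1 := phi_vis nu frozen_neighbors root k a DD'; have p2 := IH k.+1.
by case/andP: q01 => q0 q1; apply: lerD; apply: ler_wpM2l; rewrite // subr_ge0.
Qed.

Lemma top_mix C k s x : (0 < s.2 x)%N -> x != root -> topple nu frozen_neighbors x (mix q C k) s = mix q C k s.
Proof.
move=> sx xr; elim: C k => [|C IH] k /=; first by rewrite phi_top_neq.
rewrite topD ?topZ ?phi_top_neq ?IH //; [exact: bnd_mix|exact: bndM|].
by apply: bndM => //; exact: bnd_mix.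
Qed.

Lemma mix_root C k s : (0 < s.2 root)%N -> mix q C k.+1 s = mix q C k (s.1, rm root s.2).
Proof. by move=> sr; elim: C k => [|C IH] k /=; rewrite phiF_root ?IH. Qed.

Lemma mix_decr C k s : mix q C.+1 k s <= mix q C k s.
Proof.
elim: C k => [|C IH] k; first rewrite /=.
  have := phi_nincrS nu frozen_neighbors root k s; case/andP: q01 => q0 q1.
  by move: (phiF k.+1 s) (phiF k s) => A B AB; nra.
rewrite [leLHS]/= [leRHS]/= lerD2l; apply: ler_wpM2l (IH _); by case/andP: q01; rewrite subr_ge0.
Qed.

(** Bookkeeping for one release, with the same allowance C on both sides: by definition a failure
    lowers the allowance to C - 1, and [mix_decr] shows that this is only larger. *)
Lemma mix_step C s : q + (1 - q) * mix q C 1 s <= mix q C 0 s.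
Proof.
case: C => [|C]; first rewrite /= phi0.
  have /andP[p0 p1] := phi01 nu frozen_neighbors root 1 s; case/andP: q01 => q0 q1.
  by move: (phiF 1 s) p0 p1 => A p0 p1; nra.
rewrite [leRHS]/= phi0 mulr1 lerD2l; apply: ler_wpM2l (mix_decr _ _ _); by case/andP: q01; rewrite subr_ge0.
Qed.

(** The first C trials carry total weight 1 - (1 - q)^C, and each needs at least k arrivals; if all
    of them fail, at least k + C arrivals are needed. *)
Lemma mix_le C k s :
  mix q C k s <= (1 - (1 - q) ^+ C) * phiF k s + (1 - q) ^+ C * phiF (k + C) s.
Proof.
case/andP: q01 => q0 q1.
elim: C k => [|C IH] k /=; first by rewrite expr0 subrr mul0r add0r mul1r addn0.
have := IH k.+1; rewrite addSnnS.
have w01 : 0 <= (1 - q) ^+ C <= 1 by rewrite exprn_ge0 ?exprn_ile1 //; lra.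
have := phi_nincrS nu frozen_neighbors root k s; rewrite exprS.
move: (phiF k s) (phiF k.+1 s) (phiF (k + C.+1) s) (mix q C k.+1 s) w01 => A A' B M.
move: ((1 - q) ^+ C) => W /andP[W0 W1] A'A MA.
have q2 : 0 <= 1 - q by lra.
have h1 : (1 - W) * A' <= (1 - W) * A by apply: ler_wpM2l; rewrite ?subr_ge0.
have h2 : (1 - q) * M <= (1 - q) * ((1 - W) * A + W * B).
  by apply: ler_wpM2l => //; lra.
by nra.
Qed.

End mix.

Let z0 : vertex d := [:: i0].
Local Notation under := (below z0).
Local Notation push := (push z0).

(* The frogs reaching z0 are released, each reaching the root with probability at
   most q. *)
Lemma h_le_mix C D a1 a2 : D z0 || (a1 root == 0%N) ->
  h (D, addf (push a1) a2) <=
  1 - (1 - mix (h (single z0)) C 1 (under D, a1)) * (1 - h (D, a2)).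
Proof.
move=> Dz; set q := h (single z0); have q01 : 0 <= q <= 1 by exact: phi01.
pose L := mix q C 1; have L01 s : 0 <= L s <= 1 by exact: mix01.
have bL : bnd L by exact: bnd01.
(* [a1] are frogs followed in the subtree of z0 with z0 frozen, [a2] those already released; the two
   bounds are combined as in [phi1_union]. *)
pose v0 D a1 a2 := 1 - (1 - L (under D, a1)) * (1 - h (D, a2)).
(* The side condition guarantees that z0 is visited whenever a frog is released there, as the
   comparison with [single z0] requires. *)
pose Q s v := exists a1 a2, [/\ s.1 z0 || (a1 root == 0%N), s.2 = addf (push a1) a2 &
  v = v0 s.1 a1 a2].
have z0n : z0 != [::] by [].
apply: (@phi1_rel _ _ _ _ _ Q); last by exists a1, a2.
- move=> s v [b1 [b2 [_ _ ->]]]; rewrite /v0.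
  by have := L01 (under s.1, b1); have := phi01 nu nb root 1 (s.1, b2); nra.
- move=> s v [b1 [b2 [_ e ->]]]; rewrite e /addf push_root // add0n => b2r.
  by rewrite /v0 (phi1_active nu nb (s := (s.1, b2)) b2r) subrr mulr0 subr0.
have rel s b1 b2 x (g : state (vertex d) -> R) : s.1 z0 || (b1 root == 0%N) ->
    s.2 = addf (push b1) b2 -> (0 < b2 x)%N -> x != root ->
    (forall t, 0 <= g t <= 1) -> (forall t v', Q t v' -> g t <= v') ->
    top nb x g s <= v0 s.1 b1 b2.
  move=> hz e b2x xr g01 gQ; pose c := L (under s.1, b1).
  have -> : v0 s.1 b1 b2 = top nb x (fun t => c + (1 - c) * h t) (s.1, b2).
    by rewrite top_affine // phi_top_neq // /v0 -/c; ring.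
  have bF : bnd (fun t => c + (1 - c) * h t) by apply: bndD => //; exact: bndM.
  apply: (@top_transfer _ _ _ _ _ id) => //; first exact: bnd01.
  - by rewrite map_id.
  - by move=> e0; have := neighbors_neq0 i0 x; rewrite e0.
  move=> w _; apply: wake_le => //=; first exact: bnd01.
    move=> _; rewrite e addfC mv_addf // addfC; apply: le_trans (gQ _ _ _) _.
      by exists b1, (mv x w b2); split.
    by rewrite /v0 /= -/c; lra.
  move=> _ j; rewrite e addfC mv_addf // add_addf addfC; apply: le_trans (gQ _ _ _) _.
    exists b1, (add w j (mv x w b2)); split => //=.
    by case/orP: hz => [hz|->]; rewrite ?orbT // /vis hz orbT.
  rewrite /v0 /=; have : L (under (vis w s.1), b1) <= c.
    by apply: mix_vis => // u; rewrite /below /vis => ->; rewrite orbT.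
  by have := phi01 nu nb root 1 (vis w s.1, add w j (mv x w b2)); nra.
move=> s v x g [b1 [b2 [hz e ->]]] sx xr g01 gQ.
have [b2x|] := boolP (0 < b2 x)%N; first exact: (rel s b1 b2).
rewrite -eqn0Ngt => /eqP b2x.
have [w xw b1w] : exists2 w, x = w ++ z0 & (0 < b1 w)%N.
  by apply: push_gt0; move: sx; rewrite e /addf b2x addn0.
have [wr|wr] := eqVneq w root.
  (* the frog at z0 is released *)
  have Dz0 : s.1 z0 by move: b1w; rewrite wr lt0n; case/orP: hz => // ->.
  rewrite wr in xw b1w; have xz : x = z0 by [].
  apply: (@le_trans _ _ (v0 s.1 (rm root b1) (add z0 1 b2))).
    apply: (rel s _ _ x) => //; rewrite ?Dz0 //; last by rewrite xz add1_gt0.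
    rewrite e push_rm; apply/funext => u; rewrite /addf /rm /add -[root ++ z0]/z0.
    have : (0 < push b1 z0)%N by rewrite -[z0]cat0s push_cat.
    by case: (u =P z0) => [->|_]; lia.
  rewrite /v0; have Lr : q + (1 - q) * L (under s.1, rm root b1) <= L (under s.1, b1).
    by rewrite /L [leRHS]mix_root //; exact: mix_step.
  have hr : h (s.1, add z0 1 b2) <= 1 - (1 - h (s.1, b2)) * (1 - q).
    rewrite -addf_dirac; apply: le_trans (phi1_union nu nb root s.1 b2 (dirac_frog z0)) _.
    have : h (s.1, dirac_frog z0) <= q by apply: phi_vis => u /eqP ->.
    by have := phi01 nu nb root 1 (s.1, b2); nra.
  have := L01 (under s.1, rm root b1); have := L01 (under s.1, b1).
  have := phi01 nu nb root 1 (s.1, b2); have := phi01 nu nb root 1 (s.1, add z0 1 b2).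
  move: Lr hr; move: (L (under s.1, rm root b1)) (L (under s.1, b1)) => A B.
  move: (h (s.1, b2)) (h (s.1, add z0 1 b2)) => Hh H' Lr hr.
  move=> /andP[H0 H1] /andP[G0 G1] /andP[B0 B1] /andP[A0 A1].
  have e1 : (1 - B) * (1 - Hh) <= ((1 - q) * (1 - A)) * (1 - Hh) by apply: ler_wpM2r; nra.
  have e2 : (1 - A) * ((1 - Hh) * (1 - q)) <= (1 - A) * (1 - H') by apply: ler_wpM2l; lra.
  have e3 : ((1 - q) * (1 - A)) * (1 - Hh) = (1 - A) * ((1 - Hh) * (1 - q)) by ring.
  lra.
pose c := h (s.1, b2).
have -> : v0 s.1 b1 b2 = topple nu frozen_neighbors w (fun t => c + (1 - c) * L t) (under s.1, b1).
  by rewrite top_affine // /L top_mix // /v0 -/c; rewrite /L; ring.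
have bF : bnd (fun t => c + (1 - c) * L t) by apply: bndD => //; exact: bndM.
apply: (@top_transfer _ _ _ _ _ (fun u => u ++ z0)) => //; first exact: bnd01.
- by rewrite xw frozen_neq // neighbors_cat.
- by rewrite frozen_neq // => e0; have := neighbors_neq0 i0 w; rewrite e0.
have pw : (0 < push b1 x)%N by rewrite xw push_cat.
move=> w' _; rewrite e; apply: wake_le => //=; first exact: bnd01.
  move=> Dw'; rewrite mv_addf // xw -push_mv; apply: le_trans (gQ _ _ _) _.
    exists (mv w w' b1), b2; split => //=.
    case/orP: hz => [->//|/eqP b1r]; rewrite /mv /add /rm b1r.
    case: (root =P w') => [e0|_]; last by rewrite muln0 addn0 orbT.
    by move: Dw'; rewrite -e0 => ->.
  by rewrite /v0 /= -/c; lra.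
move=> _ j; rewrite mv_addf // add_addf xw -push_mv -push_add; apply: le_trans (gQ _ _ _) _.
  exists (add w' j (mv w w' b1)), b2; split => //=.
  case/orP: hz => [hz|/eqP b1r]; first by rewrite /vis hz orbT.
  rewrite /mv /add /rm b1r /vis.
  case: (root =P w') => [e0|_]; first by rewrite -e0 eqxx.
  by rewrite !muln0 !addn0 orbT.
rewrite /v0 /= under_vis; have : h (vis (w' ++ z0) s.1, b2) <= c.
  by apply: phi_vis => u; rewrite /vis => ->; rewrite orbT.
by have := L01 (vis w' (under s.1), add w' j (mv w w' b1)); nra.
Qed.

End frozen_root.

Lemma expr_lt_small (R : realType) (r e : R) : 0 <= r < 1 -> 0 < e -> exists n, r ^+ n < e.
Proof.
move=> /andP[r0 r1] e0; have cv : (fun n => r ^+ n) @ \oo --> (0 : R).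
  by apply: cvg_expr; rewrite ger0_norm.
have /cvgrPdist_lt/(_ e e0)[N _ hN] := cv; exists N.
by have := hN N (leqnn N); rewrite /= sub0r normrN ger0_norm ?exprn_ge0.
Qed.

Section frozen_composition.
Context (R : realType) (nu : probability nat R) (d : nat) (i0 : 'I_d).
Implicit Types (s t : state (vertex d)) (D : vertex d -> bool) (a : vertex d -> nat).
Implicit Types (x y z w u : vertex d).
Local Notation nb := (@neighbors d).
Local Notation root := (root_vertex d).
Local Notation top := (topple nu).
Local Notation wake := (awaken nu).
Local Notation phi := (hit_value nu nb root).
Local Notation h := (phi 1).
Local Notation psi := (psi nu nb root).
Local Notation kap := (step_prob R d).
Local Notation frozen := (@frozen_neighbors d).
Local Notation phiF := (hit_value nu frozen root).
Local Hint Resolve bnd_phi bnd_psi bnd_cst : core.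
Let z0 : vertex d := [:: i0].

Lemma phi1_empty D : h (D, fun=> 0%N) = 0.
Proof.
apply/eqP; rewrite eq_le phi_ge0 andbT.
pose g s : R := (`[< exists x, (0 < s.2 x)%N >])%:R.
have g01 s : 0 <= g s <= 1 by rewrite /g; case: asbool; rewrite ?ler01 ?lexx.
have g1 s x : (0 < s.2 x)%N -> g s = 1 by move=> sx; rewrite /g asboolT //; exists x.
have -> : 0 = g (D, fun=> 0%N).
  by rewrite /g asboolF // => -[x]; rewrite ltnn.
apply: phi_minS; first exact: bnd01; [move=> t|move=> t x tx _|move=> t tr].
- by case/andP: (g01 t).
- by rewrite (g1 t x) //; case/andP: (top01 nu nb x t g01).
- by rewrite (g1 t root) //; case/andP: (top01 nu nb root t (phi01 nu nb root 0)).
Qed.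

(** If C + 1 arrivals always had probability below delta / 2, then passing from depth n+1 to n+2
    would contract the excess of [h] over delta / 2 by the factor 1 - (1 - q)^C, and [h] would fall
    below delta. *)
Lemma many_exits (delta : R) C : 0 < delta -> h (single z0) < 1 ->
  (forall n, delta <= h (single (nseq n.+1 i0 : vertex d))) ->
  exists n, delta / 2 <= phiF C (single (nseq n.+1 i0 : vertex d)).
Proof.
move=> d0 q1 hd; apply: contrapT => H.
have {}H n : phiF C.+1 (single (nseq n.+1 i0 : vertex d)) < delta / 2.
  rewrite ltNge; apply/negP => le; apply: H; exists n.
  by apply: le_trans le (phi_nincrS _ _ _ _ _).
set q := h (single z0) in q1; have q0 : 0 <= q by exact: phi_ge0.
pose W := (1 - q) ^+ C.
have W01 : 0 < W <= 1.
  have q2 : 0 < 1 - q by rewrite subr_gt0.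
  by rewrite exprn_gt0 //= exprn_ile1 ?gerBl // ltW.
pose u n := h (single (nseq n.+1 i0 : vertex d)).
have uS n : u n.+1 <= (1 - W) * u n + W * (delta / 2).
  have := @h_le_mix R nu d i0 C (single (nseq n.+2 i0 : vertex d)).1
    (dirac_frog (nseq n.+1 i0 : vertex d)) (fun=> 0%N).
  rewrite addf0 push_dirac phi1_empty subr0 mulr1 opprB addrCA subrr addr0.
  have e2 : nseq n.+1 i0 ++ [:: i0] = nseq n.+2 i0.
    by rewrite -[[:: i0]]/(nseq 1 i0) -nseqD addn1.
  rewrite e2.
  move=> h1; have {h1} := h1 (orbT _); rewrite -/(single _) -[h (single _)]/(u n.+1) => h1.
  apply: (le_trans h1).
  apply: (le_trans (mix_le nu (phi01 nu nb root 1 _) C 1 _)).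
  have -> : (below [:: i0] (single (nseq n.+2 i0)).1, dirac_frog (nseq n.+1 i0)) =
     single (nseq n.+1 i0 : vertex d).
    congr (_, _); apply/funext => v; change ((v ++ z0 == (nseq n.+2 i0 : vertex d)) = (v == (nseq n.+1 i0 : vertex d))).
    by rewrite -e2 cat_eqr.
  rewrite phiF1 -/q -/W add1n lerD2l ler_wpM2l ?(ltW (H n)) //; by case/andP: W01 => /ltW.
have uW n : u n - delta / 2 <= (1 - W) ^+ n.
  elim: n => [|n IH]; first by rewrite expr0; have := phi_le1 nu nb root 1 (single (nseq 1 i0 : vertex d)); rewrite /u; lra.
  rewrite exprS; have : (1 - W) * (u n - delta / 2) <= (1 - W) * (1 - W) ^+ n.
    by apply: ler_wpM2l => //; lra.
  by have := uS n; lra.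
have [n hn] : exists n, (1 - W) ^+ n < delta / 2.
  by apply: expr_lt_small; lra.
by have := uW n; have := hd n; rewrite -/(u n); lra.
Qed.

Lemma straight_walk (e : vertex d -> R) (c : R) : (forall x, 0 <= e x) ->
  (forall x, (size (nb x))%:R^-1 * \sum_(z <- nb x) e z <= e x) -> 0 <= c -> c <= e root ->
  forall w, kap ^+ size w * c <= e w.
Proof.
move=> e0 he c0 cr; elim=> [|j w IH]; first by rewrite mul1r.
apply: le_trans (he (j :: w)); rewrite size_neighbors -/kap [size _]/= exprS -mulrA.
apply: ler_wpM2l; first exact: kap_ge0.
by rewrite /= big_cons; apply: (le_trans IH); rewrite lerDl sumr_ge0.
Qed.

(** C1 frogs are kept in reserve for the m remaining departures, and j more try in turn to walk
    straight to the root, each with probability at least K. Both errors are e / 2, and (1 - e/2)^2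
    >= 1 - e. *)
Lemma many_frogs l m : forall e : R, 0 < e ->
  exists C, forall w D a, size w = l.+1 -> (C <= a w)%N -> 1 - e <= phi m (D, a).
Proof.
elim: m => [|m IH] e e0.
  by exists 0%N => w D a _ _; rewrite phi0; lra.
have [C1 hC1] := IH (e / 2) ltac:(lra).
have [e1|e1] := leP e 1; last first.
  by exists 0%N => w D a _ _; have := phi_ge0 nu nb root m.+1 (D, a); lra.
pose K := kap ^+ l.+1; have K01 : 0 < K <= 1 by exact: kapX01.
pose c := 1 - e / 2.
have step j w D a : size w = l.+1 -> (C1 + j <= a w)%N ->
    c * (1 - (1 - K) ^+ j) <= phi m.+1 (D, a).
  move=> sw; have wr : w != root by apply: contra_eq_neq sw => ->.
  elim: j D a => [|j IHj] D a; first by move=> _; rewrite expr0 subrr mulr0 phi_ge0.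
  move=> hj; have aw : (0 < a w)%N by lia.
  pose a' := rm w a; have ha' : (C1 + j <= a' w)%N by rewrite /a' /rm eqxx; lia.
  pose b := c * (1 - (1 - K) ^+ j).
  have KX : 0 <= (1 - K) ^+ j <= 1 by rewrite exprn_ge0 ?exprn_ile1 //; lra.
  have cb : b <= c by rewrite /b /c; nra.
  pose F x := phi m.+1 (D, add x 1 a').
  have Fb x : b <= F x by apply: le_trans (IHj D a' ha') (phi_add _ _ _ _ _ _ _ _).
  have Fr : c <= F root.
    have ar : (0 < (D, add root 1 a').2 root)%N by exact: add1_gt0.
    rewrite /F -(phi_top_eq nu nb m ar).
    rewrite -(top_cst nu nb root c (D, add root 1 a')); apply: top_le => // t _ /(_ w wr) hw.
    case: t hw => D' a'' /= hw; apply: (hC1 w) => //; apply: leq_trans hw.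
    by rewrite /add; lia.
  have Fw : F w = phi m.+1 (D, a) by rewrite /F add_rm1.
  have sF x : (size (nb x))%:R^-1 * \sum_(z <- nb x) (F z - b) <= F x - b.
    have nx := neighbors_neq0 i0 x; have := phi_nowake nu root m.+1 D a' nx.
    rewrite big_split /= mulrDr -/(F x) => le; apply: lerD => //.
    rewrite big_const_seq iter_addr_0 count_predT -[(- b) *+ _]mulr_natl mulrA mulVf ?mul1r //.
    by rewrite pnatr_eq0; case: (nb x) nx.
  (* The gain K (c - b) over b turns (1 - K)^j into (1 - K)^(j+1). *)
  have := @straight_walk (fun x => F x - b) (c - b) _ sF _ _ w.
  rewrite Fw exprS sw -/K => hw.
  suff : K * (c - b) <= phi m.+1 (D, a) - b by rewrite /b; lra.
  by apply: hw => [x||]; rewrite ?subr_ge0 // lerD2r.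
have [j hj] : exists j, (1 - K) ^+ j < e / 2 by apply: expr_lt_small; lra.
exists (C1 + j)%N => w D a sw ha; apply: le_trans (step j w D a sw ha).
have : 0 <= (1 - K) ^+ j by rewrite exprn_ge0 //; lra.
by rewrite /c; nra.
Qed.

(* A frog process started in the subtree of w brings C frogs to w with the
   probability computed in the frozen model. *)
Lemma frozen_compose w m C (B : R) : w != root -> 0 < B ->
  (forall D a, (C <= a w)%N -> B <= phi m (D, a)) ->
  forall k s D a2, below w D = s.1 -> (C <= a2 w + k)%N ->
  B * phiF k s <= phi m (D, addf (push w s.2) a2).
Proof.
move=> wr B0 hB k s D a2 hD hC; rewrite mulrC -ler_pdivlMr // mulrC.
pose Q k s v := exists D a2, [/\ below w D = s.1, (C <= a2 w + k)%N &
  v = B^-1 * phi m (D, addf (push w s.2) a2)].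
have Bi : 0 <= B^-1 by rewrite invr_ge0 ltW.
apply: (@phi_rel _ _ _ _ _ Q); last by exists D, a2.
- by move=> j t v [D' [b [_ _ ->]]]; rewrite mulr_ge0 ?phi_ge0.
- move=> t v [D' [b [_ hb ->]]]; rewrite mulrC ler_pdivlMr // mul1r; apply: hB.
  by move: hb; rewrite /addf; lia.
move=> j t v x g [D' [b [e hb ->]]] tx g01 gQ.
have bg := bnd01 g01.
have [xr|xr] := eqVneq x root.
  rewrite /topple xr /frozen_neighbors eqxx; apply: gQ.
  exists D', (add w 1 b); split=> //=; first by rewrite xr eqxx /add eqxx; lia.
  congr (_ * phi _ (_, _)); apply/funext => u; rewrite push_rm /addf /rm /add [_ ++ w]/=.
  have tr : (0 < t.2 root)%N by rewrite -xr.
  have : (0 < push w t.2 w)%N by rewrite -[X in push _ _ X](cat0s w) push_cat.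
  move=> pw; have [->|uw] := eqVneq u w; first by rewrite mul1n [(_ + true)%N]addnC addnA subnK.
  by rewrite subn0 muln0 addn0.
have act : (0 < (D', addf (push w t.2) b).2 (x ++ w))%N by rewrite /= /addf push_cat addn_gt0 tx.
have px : (0 < push w t.2 (x ++ w))%N by rewrite push_cat.
rewrite -(phi_top_neq nu nb m act) ?cat_neq_root // -topZ //.
apply: (@top_transfer_rev _ _ _ _ _ (fun u => u ++ w)) => //; first exact: bndM.
- by rewrite frozen_neq // neighbors_cat.
- by rewrite frozen_neq // => e0; have := neighbors_neq0 i0 x; rewrite e0.
rewrite (negPf xr) subn0 in gQ.
move=> y _; apply: wake_le => //=; first exact: bndM.
- by rewrite -e.
- move=> _; apply: gQ; exists D', b; split=> //=.
  by rewrite mv_addf // push_mv.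
move=> _ l; apply: gQ; exists (vis (y ++ w) D'), b; split=> //=.
  by rewrite under_vis e.
by rewrite mv_addf // add_addf push_add push_mv.
Qed.

(** From any vertex of depth at most N, walking straight away from the root reaches depth N with
    probability at least kap^N; [bootstrap] turns this into almost sure arrival. *)
Lemma min_principle (F : vertex d -> R) (c : R) N : (forall x, 0 <= F x) -> 0 <= c ->
  (forall x, (size (nb x))%:R^-1 * \sum_(z <- nb x) F z <= F x) ->
  (forall x, size x = N -> c <= F x) -> forall x, (size x <= N)%N -> c <= F x.
Proof.
move=> F0 c0 sF hN x hx.
pose f y := if (size y <= N)%N then F y else c.
suff : forall y, c <= f y by move=> /(_ x); rewrite /f hx.
apply: (@bootstrap _ _ f (fun=> c) (kap ^+ N)) => //; first exact: kapX01.
  by move=> y; rewrite /f; case: ifP.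
move=> c' /andP[c'0 c'1] hc' y; have /andP[k0 k1] := kapX01 R d N.
have kN j : (j <= N)%N -> kap ^+ N <= kap ^+ j.
  by move=> jN; apply: ler_wiXn2l; rewrite ?kap_ge0 ?kap_le1.
have ccF v : (size v <= N)%N -> c' * c <= F v by move=> hv; have := hc' v; rewrite /f hv.
(* j is the distance to depth N: a step to one chosen child gains a level, every other neighbour
   keeps at least c' c. *)
have H j : (j <= N)%N -> forall v, size v = (N - j)%N ->
    (c' + kap ^+ j * (1 - c')) * c <= F v.
  elim: j => [|j IH] jN v hv.
    by rewrite expr0 mul1r addrC subrK mul1r; apply: hN; rewrite hv subn0.
  have hs : (size v < N)%N by rewrite hv; lia.
  apply: le_trans (sF v); set A := c' * c; set e := kap ^+ j * (1 - c') * c.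
  have hch : A + e <= F (i0 :: v).
    by rewrite /A /e -mulrDl; apply: IH; [exact: ltnW|rewrite /= hv; lia].
  have e0 : 0 <= e by rewrite /e !mulr_ge0 ?exprn_ge0 ?kap_ge0 ?subr_ge0.
  have nv := neighbors_child i0 v.
  have sz : (0 < size (nb v))%N by case: (nb v) nv.
  have : A * (size (nb v))%:R + e <= \sum_(z <- nb v) F z.
    rewrite (big_rem (i0 :: v)) //= -[X in _ * X%:R](prednK sz) -natr1 mulrDr mulr1.
    have -> : A * (size (nb v)).-1%:R + A + e = (A + e) + A * (size (nb v)).-1%:R by ring.
    apply: lerD => //; rewrite -(size_rem nv).
    have cs (l : seq (vertex d)) : (forall z, z \in l -> A <= F z) ->
        A * (size l)%:R <= \sum_(z <- l) F z.
      elim: l => [|y0 l IHl] hl; first by rewrite big_nil mulr0.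
      rewrite big_cons [size _]/= -natr1 mulrDr mulr1 addrC; apply: lerD.
        by apply: hl; rewrite mem_head.
      by apply: IHl => z zl; apply: hl; rewrite in_cons zl orbT.
    apply: cs => z /mem_rem zv; apply: ccF.
    case: (neighborsP zv) => -[l ve]; first by rewrite ve.
    by apply: ltnW; apply: leq_ltn_trans hs; rewrite ve /=.
  move=> le; rewrite ler_pdivlMl ?ltr0n //; apply: le_trans le.
  have ks : kap * (size (nb v))%:R <= 1.
    by rewrite /step_prob mulrC ler_pdivrMr ?ltr0n // mul1r ler_nat size_neighbors_le.
  have -> : (size (nb v))%:R * ((c' + kap ^+ j.+1 * (1 - c')) * c) =
      A * (size (nb v))%:R + kap * (size (nb v))%:R * e by rewrite /A /e exprS; ring.
  by rewrite lerD2l -[leRHS]mul1r; apply: ler_wpM2r.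
have c2 : (c' + kap ^+ N * (1 - c')) <= 1 by nra.
have [hy|hy] := leqP (size y) N; last by rewrite /f leqNgt hy /= ler_piMl.
have -> : f y = F y by rewrite /f hy.
apply: le_trans (H (N - size y)%N (leq_subr _ _) y _); last by rewrite subKn.
apply: ler_wpM2r => //; rewrite lerD2l; apply: ler_wpM2r; first by rewrite subr_ge0.
by apply: kN; exact: leq_subr.
Qed.

End frozen_composition.

(** * The zero-one law for hitting probabilities *)

Section zero_one_value.
Context (R : realType) (nu : probability nat R) (d : nat) (i0 : 'I_d).
Implicit Types (s t : state (vertex d)) (D : vertex d -> bool) (a : vertex d -> nat).
Implicit Types (x y z w u : vertex d).
Local Notation nb := (@neighbors d).
Local Notation root := (root_vertex d).
Local Notation top := (topple nu).
Local Notation wake := (awaken nu).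
Local Notation phi := (hit_value nu nb root).
Local Notation h := (phi 1).
Local Notation psi := (psi nu nb root).
Local Notation kap := (step_prob R d).
Local Notation phiF := (hit_value nu (@frozen_neighbors d) root).
Local Hint Resolve bnd_phi bnd_psi bnd_cst : core.
Let z0 : vertex d := [:: i0].

(* A frog of a configuration with finitely many visited vertices reaches a region
   that was never visited, far from the visited one; from there many frogs return. *)
Lemma uniform_lower_bound (delta : R) : 0 < delta -> h (single z0) < 1 ->
  (forall n, delta <= h (single (nseq n.+1 i0 : vertex d))) ->
  forall m L D a x0, (forall u, D u -> (size u <= L)%N) -> (size x0 <= L)%N ->
  (0 < a x0)%N -> delta / 4 <= phi m (D, a).
Proof.
move=> d0 q1 hd m L D a x0 hD hx0 ax0.
have [C hC] := @many_frogs R nu d i0 L m (1 / 2) ltac:(lra).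
have [n hn] := many_exits C d0 q1 hd.
pose F x := phi m (D, add x 1 (rm x0 a)).
suff : delta / 4 <= F x0 by rewrite /F add_rm1.
apply: (@min_principle R d i0 F (delta / 4) (n.+1 + L.+1)); last by lia.
- by move=> x; exact: phi_ge0.
- lra.
- by move=> x; apply: phi_nowake; exact: neighbors_neq0 i0 x.
(* [w] is the ancestor of [x] at depth L + 1, so nothing below it was visited and [x] sits in a
   fresh copy of the tree, at relative depth n + 1. C frogs reach [w] with probability at least
   delta / 2, and then succeed with probability at least 1/2. *)
move=> x hx; pose w := drop n.+1 x; pose y := take n.+1 x.
have sw : size w = L.+1 by rewrite size_drop hx; lia.
have sy : size y = n.+1 by rewrite size_takel // hx; lia.
have xE : x = y ++ w by rewrite cat_take_drop.
have wr : w != root by apply: contra_eq_neq sw => ->.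
have hB D' b : (C <= b w)%N -> 1 / 2 <= phi m (D', b).
  by move=> hb; have := hC w D' b sw hb; lra.
have uw : below w D = (fun=> false).
  apply/funext => u; apply/negP => /hD; rewrite size_cat sw; lia.
have h12 : 0 < 1 / 2 :> R by lra.
have := frozen_compose i0 wr h12 hB (s := (fun=> false, dirac_frog y)) uw (leq_addl _ _).
move=> /(_ (rm x0 a)); rewrite [(_, _).2]/= push_dirac -xE addfC addf_dirac -/(F x) => le.
apply: le_trans le.
have : phiF C (single y) <= phiF C (fun=> false, dirac_frog y) by apply: phi_vis.
rewrite (phi_single_sym nu i0 C y) ?sy; last by right.
by move: hn; lra.
Qed.

Theorem phi_zero_one : psi (single root) = 0 \/ forall m, phi m (single root) = 1.
Proof.
have [|q1] := eqVneq (h (single z0)) 1.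
  by move=> q1; right; exact: (phi_eq1_of_exit q1).
have {}q1 : h (single z0) < 1 by rewrite lt_neqAle q1 phi_le1.
have [|p0] := eqVneq (psi (single root)) 0; first by left.
have {}p0 : 0 < psi (single root) by rewrite lt_neqAle eq_sym p0 psi_ge0.
right; pose e := Ex nu (fun k => (0 < k)%N%:R : R).
have e0 : 0 <= e by apply: Ex_ge0 => k; exact: ler0n.
have [e_eq0|en0] := eqVneq e 0.
  have [n hn] := @expr_lt_small R (h (single z0)) _ (introT andP (conj (phi_ge0 _ _ _ _ _) q1)) p0.
  have hh : phi n.+1 (single root) <= h (single z0) ^+ n.
    apply: phi_single_nosleep => // j.
    by rewrite (phi_single_sym nu i0 1 [:: j]) //; left.
  by have := psi_le nu nb root n.+1 (single root); lra.
have {e0 en0} e0 : 0 < e by rewrite lt_neqAle eq_sym en0.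
(* The bound of [visit_root_ge]: one factor [psi] is the grafted recurrent configuration, the other
   bounds the pruned hitting probability through [phi_reroot] and [psi_le_visit]. *)
pose delta := kap ^+ 2 * psi (single root) * psi (single root) * e.
have kp := kap_gt0 R d.
have d0 : 0 < delta by rewrite /delta !mulr_gt0 // exprn_gt0.
have hd n : delta <= h (single (nseq n.+1 i0 : vertex d)).
  apply: le_trans (visit_root_ge nu i0 (ltn0Sn n)).
  rewrite /delta ler_wpM2r ?(ltW e0) // ler_wpM2r ?(ltW p0) //.
  rewrite ler_wpM2l ?exprn_ge0 ?(ltW kp) //.
  apply: le_trans (phi_reroot nu i0 (ltn0Sn n)); exact: psi_le_visit.
pose i := delta / 4; have lb := uniform_lower_bound d0 q1 hd.
have i0' : 0 < i by rewrite /i; lra.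
have i1 : i < 1.
  by have := hd 0%N; have := phi_le1 nu nb root 1 (single (nseq 1 i0 : vertex d)); rewrite /i; lra.
(* Bounded depth means finitely many visited vertices, since degrees are finite. The class is closed
   under moves, so the lower bound i holds along the whole evolution. *)
pose cls s := `[< (exists L, forall u, s.1 u -> (size u <= L)%N) /\ exists x, (0 < s.2 x)%N >].
have clsP n s : cls s -> i <= phi n s.
  case: s => D a /asboolP[[L hL] [x hx]].
  apply: (lb n (maxn L (size x)) D a x) => // [u /hL|]; lia.
(* The affine map sending i to 0 and fixing 1 keeps nonnegativity, the value at level 0 and
   invariance under moves, and lies below the identity on [0, 1]. *)
pose A n s := (1 - i)^-1 * (phi n s - i).
have bA n : bnd (A n) by apply: bndM => //; exact: bndB.
have Ale n s : A n s <= phi n s.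
  by rewrite /A mulrC ler_pdivrMr ?subr_gt0 //; have := phi_le1 nu nb root n s; nra.
pose g n s := if cls s then A n s else phi n s.
have gle n s : g n s <= phi n s by rewrite /g; case: ifP.
have g0 n s : 0 <= g n s.
  rewrite /g; case: ifP => [/(clsP n) h|_]; last exact: phi_ge0.
  by rewrite /A mulr_ge0 ?subr_ge0 // invr_ge0 subr_ge0 ltW.
have bg n : bnd (g n).
  by apply: bnd01 => s; rewrite g0 /= (le_trans (gle n s)) // phi_le1.
move=> m; have : phi m (single root) <= g m (single root).
  apply: phi_min => // [t|n t x tx].
    by rewrite /g /A !phi0; case: ifP; rewrite // mulVf // subr_eq0 gt_eqF.
  have [ct|ct] := boolP (cls t); last first.
    rewrite [leRHS]/g (negPf ct) -(phi_top nu nb root n tx); exact: top_mono.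
  rewrite [leRHS]/g ct /A -(phi_top nu nb root n tx).
  set k := (n.+1 - (x == root))%N.
  have -> : (1 - i)^-1 * (top nb x (phi k) t - i) = top nb x (A k) t.
    rewrite /A topZ //; last exact: bndB.
    by rewrite topB // top_cst.
  have /asboolP[[L hL] _] := ct.
  apply: (@top_transfer _ _ _ _ _ id) => //.
  - by rewrite map_id.
  - by move=> e1; have := neighbors_neq0 i0 x; rewrite e1.
  move=> z zx; apply: wake_le => // [_|_ l].
    rewrite /g ifT //; apply/asboolP; split; last by exists z; exact: mv_gt0z.
    by exists L => u /= /hL.
  rewrite /g ifT //; apply/asboolP; split; last by exists z; apply: add_gt0; exact: mv_gt0z.
  exists (maxn L (size z)) => u /=; rewrite /vis => /orP[/eqP ->|/hL h1].
    by rewrite leq_max leqnn orbT.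
  by rewrite leq_max h1.
rewrite /g ifT; last first.
  apply/asboolP; split; first by exists 0%N => u /= /eqP ->.
  by exists root; rewrite /= /dirac_frog eqxx.
(* phi <= (phi - i) / (1 - i) amounts to i <= i phi, so phi is 1. *)
have := phi_le1 nu nb root m (single root).
rewrite /A mulrC ler_pdivlMr ?subr_gt0 // => p1 p2.
apply/eqP; rewrite eq_le p1 /=; nra.
Qed.

End zero_one_value.

Definition frog (d : nat) : Type := (vertex d * nat)%type.
HB.instance Definition _ (d : nat) := Countable.on (frog d).

(** * Realizations *)

Section realization.
Context (d : nat) (eta : vertex d -> nat) (S : vertex d -> nat -> nat -> vertex d).
Implicit Types (u v : vertex d) (f : frog d).
Local Notation root := (root_vertex d).
Local Notation wake_time := (wake_time eta S).

(** A description of the visited vertices free of wake-up times. Only steps k + 1 count, as in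
    [wake_time]: walks start at their vertex only almost surely, while the equivalence with
    [wake_time] is wanted for every realization. *)
Fixpoint reach (n : nat) v : Prop :=
  if n is n'.+1 then
    v = root \/ exists f k, [/\ reach n' f.1, (f.2 < eta f.1)%N & S f.1 f.2 k.+1 = v]
  else v = root.

Definition woken v := exists n, reach n v.

Lemma woken_root : woken root.
Proof. by exists 0%N. Qed.

Lemma woken_step v i k : woken v -> (i < eta v)%N -> woken (S v i k.+1).
Proof. by case=> n nv ie; exists n.+1; right; exists (v, i), k. Qed.

Lemma woken_ind (Q : vertex d -> Prop) : Q root ->
  (forall v i k, Q v -> (i < eta v)%N -> Q (S v i k.+1)) -> forall v, woken v -> Q v.
Proof.
move=> Q0 QS v [n]; elim: n v => [|n IH] v /=; first by move->.
by case=> [->//|[[u i] [k [/IH Qu ie <-]]]]; exact: QS.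
Qed.

Lemma wake_time_add t k v s : wake_time t v = Some s -> wake_time (t + k)%N v = Some s.
Proof. by move=> h; elim: k => [|k IH]; rewrite ?addn0 // addnS /= IH. Qed.

Lemma wake_time_fun t t' v s s' :
  wake_time t v = Some s -> wake_time t' v = Some s' -> s = s'.
Proof.
by move=> /(wake_time_add t') h /(wake_time_add t); rewrite addnC h => -[].
Qed.

Lemma wake_timeP t v s : wake_time t v = Some s -> (s <= t)%N /\ wake_time s v = Some s.
Proof.
elim: t s => [|t IH'] s /=; first by case: eqP => // -> [<-]; rewrite /= ?eqxx.
case E: (wake_time t v) => [s'|].
  by move=> [<-]; have [? ?] := IH' _ E; split=> //; lia.
by case: asboolP => // h [<-]; split; rewrite //= E; case: asboolP.
Qed.

Lemma wokenP v : woken v <-> exists t s, wake_time t v = Some s.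
Proof.
split.
  move: v; apply: (woken_ind (Q := fun v => exists t s, wake_time t v = Some s)).
    by exists 0%N, 0%N; rewrite /= ?eqxx.
  move=> v i k [t [s ts]] ie; have [_ ss] := wake_timeP ts.
  exists (s + k).+1 => /=; case: (wake_time (s + k) _) => [s'|]; first by exists s'.
  exists (s + k).+1; rewrite ifT //; apply/asboolP; exists (v, i).
  by rewrite /frog_pos /= (wake_time_add _ ss) ie -addnS addKn.
case=> t [s]; elim: t v s => [|t IH] v s /=; first by case: eqP => // -> _; exact: woken_root.
case E: (wake_time t v) => [s'|]; first by move=> _; exact: IH E.
case: asboolP => // -[[u i]]; rewrite /frog_pos /=.
case E': (wake_time t u) => [s'|//]; case: ltnP => // ie [<-] _.
have [st _] := wake_timeP E'; rewrite (subSn st); exact: woken_step (IH _ _ E') _.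
Qed.

Definition root_hits : set (frog d * nat) :=
  [set p | [/\ woken p.1.1, (p.1.2 < eta p.1.1)%N & S p.1.1 p.1.2 p.2 = root]].

(** A visit at global time t is renamed by the frog's own clock, t minus its wake-up time; the two
    renamings carry each set into the other, so they are finite together. *)
Lemma recurrentP : recurrent eta S <-> infinite_set root_hits.
Proof.
pose wt v := xget 0%N [set s | exists t, wake_time t v = Some s].
have wtP t v s : wake_time t v = Some s -> wt v = s.
  move=> h; rewrite /wt; case: xgetP => [s' _ [t' h']|/(_ s) []]; last by exists t.
  exact: wake_time_fun h' h.
have key : finite_set (visits eta S root) <-> finite_set root_hits.
  split => /finite_image.
    move=> /(_ _ (fun tf => (tf.2, (tf.1 - wt tf.2.1)%N))); apply: sub_finite_set.
    case=> [[v i] n] /= [/wokenP[t [s ts]] ie e]; have [_ ss] := wake_timeP ts.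
    exists ((s + n)%N, (v, i)); last by rewrite /= (wtP _ _ _ ts) addKn.
    by rewrite /visits /frog_pos /= (wake_time_add _ ss) ie addKn e.
  move=> /(_ _ (fun p => ((wt p.1.1 + p.2)%N, p.1))); apply: sub_finite_set.
  case=> t [v i]; rewrite /visits /frog_pos /=.
  case E: (wake_time t v) => [s|//]; case: ltnP => // ie [e].
  have [st _] := wake_timeP E; exists ((v, i), (t - s)%N).
    by split=> //=; apply/wokenP; exists t, s.
  by rewrite /= (wtP _ _ _ E) subnKC.
by rewrite /recurrent; split => h /key.
Qed.

Definition root_hits_ge (m : nat) : Prop :=
  exists l : seq (frog d * nat), [/\ uniq l, size l = m & forall p, p \in l -> root_hits p].

Lemma infinite_root_hits : infinite_set root_hits <-> forall m, root_hits_ge m.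
Proof.
split=> [inf m|h fin].
  have [B BA mB] := infinite_set_fset m inf.
  exists (take m (enum_fset B)); split.
  - by apply: take_uniq; exact: fset_uniq.
  - by rewrite size_takel.
  - by move=> p /mem_take pB; apply: BA.
have [s es] := (finite_seqP _).1 fin.
have [l [ul sl hl]] := h (size s).+1.
have : {subset l <= s} by move=> p /hl; rewrite es.
by move=> /(uniq_leq_size ul); rewrite sl ltnn.
Qed.

End realization.

(** * Measurability through countable quantifiers *)

Section countable_quantifiers.
Context (dO : measure_display) (Omega : measurableType dO).

Lemma measurable_exists (T : countType) (Q : T -> Omega -> Prop) :
  (forall x, measurable [set w | Q x w]) -> measurable [set w | exists x, Q x w].
Proof.
move=> h; rewrite (_ : [set w | _] = \bigcup_x [set w | Q x w]); last first.
  by apply/seteqP; split => w /= [x]; exists x.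
by apply: countable_bigcupT_measurable => //; exact: countableP.
Qed.

Lemma measurable_forall (T : countType) (Q : T -> Omega -> Prop) :
  (forall x, measurable [set w | Q x w]) -> measurable [set w | forall x, Q x w].
Proof.
move=> h; rewrite (_ : [set w | _] = ~` [set w | exists x, ~ Q x w]).
  by apply: measurableC; apply: measurable_exists => x; apply: measurableC; exact: h.
apply/seteqP; split => w /= hw; first by case=> x; apply.
by move=> x; apply: contrapT => nx; apply: hw; exists x.
Qed.

Lemma measurable_imply (Q : Prop) (A : Omega -> Prop) :
  (Q -> measurable [set w | A w]) -> measurable [set w | Q -> A w].
Proof.
move=> h; case: (pselect Q) => q.
  by rewrite (_ : [set w | _] = [set w | A w]); [exact: h|apply/seteqP; split => w //= hw; exact: hw].
by rewrite (_ : [set w | _] = setT); [|apply/seteqP; split => w /=].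
Qed.

Lemma measurable_cst_prop (Q : Prop) : measurable [set w : Omega | Q].
Proof.
case: (pselect Q) => q; first by rewrite (_ : [set w | _] = setT) //; apply/seteqP; split.
by rewrite (_ : [set w | _] = set0) //; apply/seteqP; split.
Qed.

Lemma measurable_and (A B : Omega -> Prop) : measurable [set w | A w] ->
  measurable [set w | B w] -> measurable [set w | A w /\ B w].
Proof. exact: measurableI. Qed.

Lemma measurable_or (A B : Omega -> Prop) : measurable [set w | A w] ->
  measurable [set w | B w] -> measurable [set w | A w \/ B w].
Proof. exact: measurableU. Qed.

End countable_quantifiers.

Section series.
Context (R : realType) (nu : probability nat R).

Lemma Ex_series (f : nat -> R) : bnd f -> (forall k, 0 <= f k) ->
  (Ex nu f)%:E = (\sum_(0 <= k <oo) (nu [set k] * (f k)%:E))%E.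
Proof.
move=> bf f0; rewrite Ex_E //.
rewrite (_ : setT = \bigcup_(k : nat) [set k]); last first.
  by apply/seteqP; split => k // _; exists k.
rewrite ge0_integral_bigcup //.
- apply: eq_eseriesr => k _; rewrite muleC -(integral_cst nu _ (f k)%:E) //.
  by apply: eq_integral => j; rewrite inE /= => ->.
- by move=> k _; rewrite lee_fin.
- by move=> i j _ _ [k [-> ->]].
Qed.

End series.

Lemma gen_setI (T : Type) (G : set_system T) A B : <<s G >> A -> <<s G >> B -> <<s G >> (A `&` B).
Proof.
move=> gA gB; have [_ gC gU] := smallest_sigma_algebra setT G.
have {}gC X : <<s G >> X -> <<s G >> (~` X) by rewrite -setTD; exact: gC.
rewrite -[A]setCK -[B]setCK -setCU; apply: (gC (~` A `|` ~` B)).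
by rewrite -bigcup2E; apply: gU => -[|[|n]] /=; [exact: gC|exact: gC|exact: sigma_algebra0].
Qed.

Lemma prob_bigcap1 (R : realType) (dO : measure_display) (Omega : measurableType dO)
    (P : probability Omega R) (A : nat -> set Omega) :
  (forall n, measurable (A n)) -> (forall n, P (A n) = 1%E) -> P (\bigcap_n A n) = 1%E.
Proof.
move=> mA A1; have mI : measurable (\bigcap_n A n) by exact: bigcapT_measurable.
have : P (~` \bigcap_n A n) = 0%E.
  rewrite setC_bigcap; apply: measure_negligible.
    by apply: bigcupT_measurable => n; exact: measurableC.
  apply: negligible_bigcup => n; apply/negligibleP; first exact: measurableC.
  by apply: (eq_trans (probability_setC P (mA n))); rewrite A1 subee.
by rewrite probability_setC // => /eqP; rewrite sube_eq ?fin_num_measure // add0e => /eqP.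
Qed.

(** * Probabilities of partial explorations *)

Section cylinders.
Context (R : realType) (nu : probability nat R) (d : nat).
Context (dO : measure_display) (Omega : measurableType dO) (P : probability Omega R).
Context (eta : vertex d -> {RV P >-> nat}) (S : vertex d -> nat -> nat -> {RV P >-> vertex d}).
Hypothesis hmodel : frog_model nu eta S.
Implicit Types (u v x z : vertex d) (f g : frog d) (w : Omega).
Local Notation root := (root_vertex d).

Lemma measurable_eta v (A : nat -> Prop) : measurable [set w | A (eta v w)].
Proof. by rewrite -[X in measurable X]setTI; apply: (measurable_funPT (eta v) measurableT). Qed.

Lemma measurable_walk v i n (A : vertex d -> Prop) : measurable [set w | A (S v i n w)].
Proof. by rewrite -[X in measurable X]setTI; apply: (measurable_funPT (S v i n) measurableT). Qed.

Definition path_event f n (p : nat -> vertex d) : set Omega :=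
  [set w | forall k, (k <= n)%N -> S f.1 f.2 k w = p k].

Lemma measurable_path f n p : measurable (path_event f n p).
Proof.
apply: measurable_forall => k; apply: measurable_imply => _.
exact: (measurable_walk f.1 f.2 k (fun z => z = p k)).
Qed.

Lemma path_eventS f n p :
  path_event f n.+1 p = path_event f n p `&` [set w | S f.1 f.2 n.+1 w = p n.+1].
Proof.
apply/seteqP; split => w /= h.
  by split=> [k kn|]; apply: h => //; lia.
by case: h => h1 h2 k; rewrite leq_eqVlt ltnS => /predU1P[->|/h1].
Qed.

Lemma path_event0 f p : path_event f 0 p = [set w | S f.1 f.2 0 w = p 0%N].
Proof.
apply/seteqP; split => w /= h; first exact: h.
by move=> k; rewrite leqn0 => /eqP ->.
Qed.

Lemma path_sigma f n p : sigma_process (S f.1 f.2) (path_event f n p).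
Proof.
have gs k : sigma_process (S f.1 f.2) [set w | S f.1 f.2 k w = p k].
  apply: sub_gen_smallest; exists k => //.
  by exists [set p k] => //; rewrite setTI.
elim: n => [|n IH]; first by rewrite path_event0.
by rewrite path_eventS; apply: gen_setI; [exact: IH|exact: gs].
Qed.

Lemma path_event_step f n p : p n.+1 \in neighbors (p n) ->
  P (path_event f n.+1 p) = (P (path_event f n p) * ((size (neighbors (p n)))%:R^-1)%:E)%E.
Proof. by move=> pn; rewrite (frog_srw hmodel f.1 f.2).2 /srw_step pn. Qed.

Lemma path_event_start f p : p 0%N = f.1 -> P (path_event f 0 p) = 1%E.
Proof. by move=> p0; rewrite path_event0 p0 (frog_srw hmodel f.1 f.2).1. Qed.

Lemma prob_eta v k : v != root -> P [set w | eta v w = k] = nu [set k].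
Proof. by move=> /(frog_law hmodel) <-. Qed.

Definition cyl (found : vertex d -> nat) (clock : frog d -> nat) (track : frog d -> nat -> vertex d)
    (a : vertex d + frog d) : set Omega :=
  match a with
  | inl v => [set w | eta v w = found v]
  | inr f => path_event f (clock f) (track f)
  end.

Lemma measurable_cyl found clock track a : measurable (cyl found clock track a).
Proof.
by case: a => [v|f] /=; [exact: (measurable_eta v (fun k => k = found v))|exact: measurable_path].
Qed.

Lemma prob_cyls found clock track (J : seq (vertex d + frog d)) : uniq J ->
  P [set w | forall a, a \in J -> cyl found clock track a w] = (\prod_(a <- J) P (cyl found clock track a))%E.
Proof.
move=> uJ; have := frog_indep hmodel (J := [fset a in J]%fset) (E := cyl found clock track).
rewrite (perm_big J) /=; last first.
  by apply: uniq_perm => // [|a]; rewrite ?fset_uniq // in_fset.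
move=> <-; last first.
  move=> [v|[v i]] _ /=; last exact: (@path_sigma (v, i)).
  by exists [set found v] => //; rewrite setTI.
congr (P _); apply/seteqP; split => w /= h a aJ; apply: h; last by rewrite /= in_fset.
by move: aJ; rewrite /= in_fset.
Qed.

(** An almost sure event; inside it, discovering new frogs imposes no condition on their walks. *)
Definition all_start : set Omega := [set w | forall f : frog d, S f.1 f.2 0 w = f.1].

Lemma measurable_all_start : measurable all_start.
Proof.
by apply: measurable_forall => f; exact: (measurable_walk f.1 f.2 0 (fun z => z = f.1)).
Qed.

Lemma prob_all_start : P all_start = 1%E.
Proof.
rewrite (_ : all_start = \bigcap_n
  (if (choice.unpickle n : option (frog d)) is Some f then [set w | S f.1 f.2 0 w = f.1] else setT)).
  apply: prob_bigcap1 => n; case: (choice.unpickle n : option (frog d)) => [f|] //.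
    exact: (measurable_walk f.1 f.2 0 (fun z => z = f.1)).
    by rewrite (frog_srw hmodel f.1 f.2).1.
  exact: probability_setT.
apply/seteqP; split => w /= h; last first.
  by move=> f; have := h (choice.pickle f) I; rewrite choice.pickleK.
by move=> n _; case: (choice.unpickle n : option (frog d)) => [f|] //=; exact: h.
Qed.

Lemma prob_all_startI A : measurable A -> P (all_start `&` A) = P A.
Proof.
move=> mA; have mO := measurable_all_start.
have e : P (A `\` all_start) = 0%E.
  apply: (subset_measure0 (B := ~` all_start)) => //; [exact: measurableD|exact: measurableC|].
  by apply: (eq_trans (probability_setC P mO)); rewrite prob_all_start subee.
have : P A = (P (A `\` all_start) + P (A `&` all_start))%E by exact: measureDI.
by rewrite e add0e setIC.
Qed.

End cylinders.

(** * Partial explorations and their states *)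

Section history.
Context (d : nat).
Implicit Types (u v x z : vertex d) (f g : frog d).
Local Notation root := (root_vertex d).

(* A partial exploration of a realization: frog f has been followed for clock f steps
   along track f, and found v is the number of frogs discovered at the known vertex v.
   The list hit_list records the departures from the root so far. *)
Record hist := Hist {
  known : seq (vertex d);
  found : vertex d -> nat;
  frogs : seq (frog d);
  clock : frog d -> nat;
  track : frog d -> nat -> vertex d;
  hit_list : seq (frog d * nat) }.
Implicit Types H : hist.

Definition pos H f := track H f (clock H f).
#[local] Arguments pos : simpl never.

(** A visit of the root is recorded when the frog leaves it, labelled by the frog and its own clock;
    this agrees with the level drop in [superharmonic]. *)
Definition move_frog f z H := Hist (known H) (found H) (frogs H)
  (fun g => if g == f then (clock H f).+1 else clock H g)
  (fun g k => if (g == f) && (k == (clock H f).+1) then z else track H g k)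
  (if pos H f == root then (f, clock H f) :: hit_list H else hit_list H).

Definition newfrogs z k : seq (frog d) := [seq (z, i) | i <- iota 0 k].

Definition discover z k H := Hist (z :: known H) (fun v => if v == z then k else found H v)
  (newfrogs z k ++ frogs H) (clock H) (track H) (hit_list H).

Definition step f z k H := if z \in known H then move_frog f z H else discover z k (move_frog f z H).

(** [fresh] prepares undiscovered frogs at their home vertex with clock 0, so [discover] need not
    touch [clock] and [track]. *)
Record wf H : Prop := WF {
  known_uniq : uniq (known H);
  known_root : root \in known H;
  frogs_uniq : uniq (frogs H);
  frogsE : forall f, (f \in frogs H) = (f.1 \in known H) && (f.2 < found H f.1)%N;
  fresh : forall f, f \notin frogs H -> clock H f = 0%N /\ track H f 0 = f.1 }.

Lemma mem_newfrogs z k f : (f \in newfrogs z k) = (f.1 == z) && (f.2 < k)%N.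
Proof.
apply/mapP/andP => [[i ik ->]|[/eqP <- fk]]; first by rewrite eqxx; split=> //; rewrite mem_iota in ik.
by exists f.2; rewrite ?mem_iota //; case: f fk.
Qed.

Lemma pos_move f z H : pos (move_frog f z H) f = z.
Proof. by rewrite /pos /= !eqxx. Qed.

Lemma pos_move_neq f z H g : g != f -> pos (move_frog f z H) g = pos H g.
Proof. by move=> gf; rewrite /pos /= (negPf gf). Qed.

Lemma wf_move f z H : wf H -> f \in frogs H -> wf (move_frog f z H).
Proof.
move=> [? ? ? ? fr] ff; split=> //= g gl.
by have -> : (g == f) = false; [apply: contraNF gl => /eqP ->|exact: fr].
Qed.

Lemma wf_discover z k H : wf H -> z \notin known H -> wf (discover z k H).
Proof.
move=> [uv rv uf fE fr] zl; split=> /=.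
- by rewrite zl.
- by rewrite inE rv orbT.
- rewrite cat_uniq uf andbT (map_inj_uniq (f := pair z)) ?iota_uniq //; last by move=> ? ? [].
  apply/hasPn => f; rewrite fE mem_newfrogs => /andP[fv _]; rewrite negb_and.
  by apply/orP; left; apply: contraNneq zl => <-.
- move=> f; rewrite mem_cat mem_newfrogs fE inE; case: (eqVneq f.1 z) => [e|_] //=.
  by rewrite e (negPf zl) orbF.
- by move=> f; rewrite mem_cat negb_or => /andP[_ /fr].
Qed.

Lemma wf_step f z k H : wf H -> f \in frogs H -> wf (step f z k H).
Proof.
by move=> wH fH; rewrite /step; case: ifPn => zl; [|apply: wf_discover => //]; exact: wf_move.
Qed.

Definition st H : state (vertex d) :=
  (fun u => u \in known H, fun x => count (fun f => pos H f == x) (frogs H)).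

Lemma st_gt0 H x : (0 < (st H).2 x)%N -> exists2 f, f \in frogs H & pos H f = x.
Proof. by rewrite -has_count => /hasP[f frogs /eqP]; exists f. Qed.

Lemma st_pos H f : f \in frogs H -> (0 < (st H).2 (pos H f))%N.
Proof. by move=> ff; rewrite -has_count; apply/hasP; exists f. Qed.

Lemma st_move f z H : wf H -> f \in frogs H ->
  st (move_frog f z H) = ((st H).1, mv (pos H f) z (st H).2).
Proof.
move=> wH ff; congr (_, _); apply/funext => x; rewrite /mv /add /rm /=.
have pm := perm_to_rem ff; rewrite !(seq.permP pm) /= pos_move.
have -> : count (fun g => pos (move_frog f z H) g == x) (rem f (frogs H)) =
          count (fun g => pos H g == x) (rem f (frogs H)).
  apply: eq_in_count => g; rewrite mem_rem_uniq ?(frogs_uniq wH) // !inE => /andP[gf _].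
  by rewrite pos_move_neq.
by rewrite (eq_sym z) (eq_sym (pos H f)); do 2 case: eqP => _; rewrite /=; lia.
Qed.

Lemma st_discover z k H : wf H -> z \notin known H ->
  st (discover z k H) = (vis z (st H).1, add z k (st H).2).
Proof.
move=> wH zl; congr (_, _); apply/funext => x; rewrite /vis /add /= ?inE // count_cat addnC.
congr (_ + _)%N; have -> : count (fun f => pos (discover z k H) f == x) (newfrogs z k) =
  count (fun=> x == z) (newfrogs z k).
  apply: eq_in_count => f; rewrite mem_newfrogs => /andP[/eqP fz _].
  have fn : f \notin frogs H by rewrite (frogsE wH) fz (negPf zl).
  by have [l0 p0] := fresh wH fn; rewrite /pos /= l0 p0 fz eq_sym.
by case: eqP => _; rewrite ?count_predT ?count_pred0 ?size_map ?size_iota ?muln1 ?muln0.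
Qed.

Lemma size_hit_list_step f z k H :
  size (hit_list (step f z k H)) = (size (hit_list H) + (pos H f == root))%N.
Proof. by rewrite /step; case: ifP => _ /=; case: ifP => _ /=; rewrite ?addn1 ?addn0. Qed.

End history.

Section history_event.
Context (R : realType) (nu : probability nat R) (d : nat) (i0 : 'I_d).
Context (dO : measure_display) (Omega : measurableType dO) (P : probability Omega R).
Context (eta : vertex d -> {RV P >-> nat}) (S : vertex d -> nat -> nat -> {RV P >-> vertex d}).
Hypothesis hmodel : frog_model nu eta S.
Implicit Types (u v x z : vertex d) (f g : frog d) (w : Omega) (H : hist d).
Local Notation root := (root_vertex d).
Local Notation nb := (@neighbors d).
Local Notation cyl := (cyl eta S).
Local Notation all_start := (all_start S).

Definition idx H : seq (vertex d + frog d) := map inl (known H) ++ map inr (frogs H).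

Definition evt H : set Omega :=
  all_start `&` [set w | forall a, a \in idx H -> cyl (found H) (clock H) (track H) a w].

Lemma mem_idx H a :
  (a \in idx H) = match a with inl v => v \in known H | inr f => f \in frogs H end.
Proof.
rewrite mem_cat; case: a => [v|f].
  rewrite (mem_map (f := inl)); last by move=> ? ? [].
  by rewrite (_ : _ \in map inr _ = false) ?orbF //; apply/negP => /mapP[].
rewrite (mem_map (f := inr)); last by move=> ? ? [].
by rewrite (_ : _ \in map inl _ = false) //; apply/negP => /mapP[].
Qed.

Lemma evtP H w : evt H w <-> [/\ all_start w, forall v, v \in known H -> eta v w = found H v &
  forall f, f \in frogs H -> forall k, (k <= clock H f)%N -> S f.1 f.2 k w = track H f k].
Proof.
split=> [[sw hw]|[sw hv hf]].
  split=> // [v vH|f fH]; first by apply: (hw (inl v)); rewrite mem_idx.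
  by apply: (hw (inr f)); rewrite mem_idx.
by split=> // -[v|f]; rewrite mem_idx => /= ?; [exact: hv|exact: hf].
Qed.

Lemma measurable_evt H : measurable (evt H).
Proof.
apply: measurableI; first exact: measurable_all_start.
by apply: measurable_forall => a; apply: measurable_imply => _; exact: measurable_cyl.
Qed.

Lemma idx_uniq H : wf H -> uniq (idx H).
Proof.
move=> wH; rewrite cat_uniq !map_inj_uniq ?(known_uniq wH) ?(frogs_uniq wH) /=; try by move=> ? ? [].
by rewrite andbT; apply/hasPn => a /mapP[f _ ->]; apply/negP => /mapP[].
Qed.

Lemma prob_evt H : wf H -> P (evt H) = (\prod_(a <- idx H) P (cyl (found H) (clock H) (track H) a))%E.
Proof.
move=> wH; rewrite (prob_all_startI hmodel); first by rewrite (prob_cyls hmodel) // idx_uniq.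
by apply: measurable_forall => a; apply: measurable_imply => _; exact: measurable_cyl.
Qed.

Lemma evt_move f z H : f \in frogs H ->
  evt (move_frog f z H) = evt H `&` [set w | S f.1 f.2 (clock H f).+1 w = z].
Proof.
move=> fH; apply/seteqP; split => w.
  move=> /evtP[sw hv hf]; split.
    apply/evtP; split=> // g gH k kl; have := hf g gH k; rewrite /=.
    case: eqP => [e|_]; last exact.
    by rewrite e in kl *; rewrite ltn_eqF ?ltnS //=; apply; exact: leqW.
  by have := hf f fH (clock H f).+1; rewrite /= !eqxx => ->.
case=> /evtP[sw hv hf] /= hz; apply/evtP; split=> // g gH k /=.
case: eqP => [-> /=|_]; last exact: hf.
by rewrite leq_eqVlt ltnS; case: eqP => [-> _|_ /= /(hf f fH)].
Qed.

(** New frogs have clock 0, so their only constraint is their starting point, which [all_start]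
    already contains. *)
Lemma evt_discover z k H : wf H -> z \notin known H ->
  evt (discover z k H) = evt H `&` [set w | eta z w = k].
Proof.
move=> wH zH; apply/seteqP; split => w.
  move=> /evtP[sw hv hf]; split.
    apply/evtP; split=> // [v vH|g gH].
      have := hv v; rewrite /= inE vH orbT => /(_ isT) ->.
      by case: eqP => // e; rewrite -e vH in zH.
    by apply: hf; rewrite /= mem_cat gH orbT.
  by have := hv z; rewrite /= inE eqxx => /(_ isT).
case=> /evtP[sw hv hf] /= hz; apply/evtP; split=> // [v|g] /=.
  by rewrite inE; case: eqP => [->|_ /hv].
rewrite mem_cat => /orP[gn j jl|/hf //].
have gH : g \notin frogs H.
  move: gn; rewrite mem_newfrogs (frogsE wH) => /andP[/eqP -> _]; by rewrite (negPf zH).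
by have [l0 p0] := fresh wH gH; move: jl; rewrite l0 leqn0 => /eqP ->; rewrite p0; exact: sw.
Qed.

Lemma prob_move f z H : wf H -> f \in frogs H -> z \in nb (pos H f) ->
  P (evt (move_frog f z H)) = (P (evt H) * ((size (nb (pos H f)))%:R^-1)%:E)%E.
Proof.
move=> wH fH zx; rewrite (prob_evt (wf_move z wH fH)) (prob_evt wH) /idx /=.
have ff : inr f \in idx H by rewrite mem_idx.
rewrite !(big_rem (inr f) ff) /= [RHS]muleAC; congr (_ * _)%E.
  rewrite eqxx.
  have -> : path_event S f (clock H f).+1 (fun k => if true && (k == (clock H f).+1) then z else track H f k)
     = path_event S f (clock H f).+1 (fun k => if k == (clock H f).+1 then z else track H f k) by [].
  rewrite (path_event_step hmodel) ?eqxx /=; last by rewrite ltn_eqF.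
  rewrite ltn_eqF //; congr (_ * _)%E; congr (P _); apply/seteqP; split=> w h k kl; rewrite h //.
    by rewrite ltn_eqF.
  by rewrite ltn_eqF.
apply: eq_big_seq => a; rewrite mem_rem_uniq ?idx_uniq // inE => /andP[af _].
case: a af => [//|g] /= gf; have -> : (g == f) = false by apply: contraNF gf => /eqP ->.
by [].
Qed.

Lemma prob_discover z k H : wf H -> z \notin known H ->
  P (evt (discover z k H)) = (P (evt H) * nu [set k])%E.
Proof.
move=> wH zH; rewrite (prob_evt (wf_discover k wH zH)) (prob_evt wH) /idx /=.
rewrite big_cons /= eqxx (prob_eta hmodel); last by apply: contraNneq zH => ->; exact: known_root.
rewrite muleC; congr (_ * _)%E; rewrite map_cat !big_cat /=; congr (_ * _)%E.
  rewrite !big_map; apply: eq_big_seq => v vH /=; case: eqP => // e; by rewrite -e vH in zH.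
rewrite -[RHS]mul1e; congr (_ * _)%E; last by rewrite !big_map.
rewrite big_map big1_seq // => g /andP[_].
rewrite mem_newfrogs => /andP[/eqP gz _].
have gH : g \notin frogs H by rewrite (frogsE wH) gz (negPf zH).
have [l0 p0] := fresh wH gH; rewrite /= l0; exact: (path_event_start hmodel).
Qed.

End history_event.

(** * Splitting an exploration event by its next step *)

Section branching.
Context (R : realType) (nu : probability nat R) (d : nat) (i0 : 'I_d).
Context (dO : measure_display) (Omega : measurableType dO) (P : probability Omega R).
Context (eta : vertex d -> {RV P >-> nat}) (S : vertex d -> nat -> nat -> {RV P >-> vertex d}).
Hypothesis hmodel : frog_model nu eta S.
Implicit Types (u v x z : vertex d) (f g : frog d) (w : Omega) (H : hist d).
Local Notation root := (root_vertex d).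
Local Notation nb := (@neighbors d).
Local Notation evt := (evt eta S).

Lemma prob_fiber_seq (X : {RV P >-> vertex d}) (A : set Omega) (l : seq (vertex d)) :
  measurable A -> uniq l ->
  P (A `&` [set w | X w \in l]) = (\sum_(z <- l) P (A `&` [set w | X w = z]))%E.
Proof.
have mX (Q : vertex d -> Prop) : measurable [set w | Q (X w)].
  by rewrite -[Y in measurable Y]setTI; apply: (measurable_funPT X measurableT).
move=> mA; elim: l => [_|z l IH /= /andP[zl ul]].
  by rewrite big_nil (_ : _ `&` _ = set0) ?measure0 //; apply/seteqP; split => w [].
rewrite big_cons -IH // -measureU //.
- congr (P _); apply/seteqP; split => w /=; rewrite inE.
    by case=> Aw /predU1P[?|?]; [left|right].
  by case=> -[Aw ->]; rewrite ?eqxx ?orbT.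
- by apply: measurableI => //; exact: (mX (fun y => y = z)).
- by apply: measurableI => //; exact: (mX (fun y => y \in l)).
- by apply/seteqP; split => w // [[_ /= ->]] [_ /=]; rewrite (negPf zl).
Qed.

(** The probabilities of steps to neighbours already add up to that of [evt H], so all other
    destinations form a null event. *)
Lemma prob_split_move H f (B : set Omega) : wf H -> f \in frogs H -> measurable B ->
  P (evt H `&` B) = (\sum_(z <- nb (pos H f)) P (evt (move_frog f z H) `&` B))%E.
Proof.
move=> wH fH mB; set X := S f.1 f.2 (clock H f).+1; set l := nb (pos H f).
have mX (Q : vertex d -> Prop) : measurable [set w | Q (X w)] by exact: (measurable_walk S f.1 f.2 (clock H f).+1 Q).
have mE := measurable_evt eta S H; have ul : uniq l by exact: neighbors_uniq.
have ez A z : evt (move_frog f z H) `&` A = (evt H `&` A) `&` [set w | X w = z].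
  by rewrite evt_move // setIAC.
under eq_bigr do rewrite ez.
rewrite -(prob_fiber_seq X (measurableI _ _ mE mB) ul).
have dec A : measurable A -> P A = (P (A `&` [set w | X w \in l]) + P (A `\` [set w | X w \in l]))%E.
  by move=> mA; have h := measureDI P mA (mX (fun y => y \in l)); rewrite addeC; exact: h.
have null : P (evt H `\` [set w | X w \in l]) = 0%E.
  have := dec _ mE; rewrite (prob_fiber_seq X mE ul).
  have -> : (\sum_(z <- l) P (evt H `&` [set w | X w = z]) = P (evt H))%E.
    transitivity (\sum_(z <- l) (P (evt H) * ((size l)%:R^-1)%:E))%E.
      apply: eq_big_seq => z zl; rewrite -(prob_move hmodel wH fH zl).
      by rewrite -(setIT (evt (move_frog f z H))) ez setIT.
    rewrite -(fineK (fin_num_measure P _ mE)) sumEFin big_const_seq count_predT iter_addr_0.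
    rewrite -mulrnAr -mulr_natr mulVf ?mulr1 // pnatr_eq0 size_eq0; exact: neighbors_neq0.
  have mD : measurable (evt H `\` [set w | X w \in l]).
    by apply: measurableD => //; exact: (mX (fun y => y \in l)).
  rewrite -(fineK (fin_num_measure P _ mE)) -(fineK (fin_num_measure P _ mD)) => -[e].
  congr (_%:E); lra.
rewrite (dec _ (measurableI _ _ mE mB)) [X in (_ + X)%E](_ : _ = 0%E) ?adde0 //.
have mX' := mX (fun y => y \in l).
apply: subset_measure0 null; [|exact: measurableD|by move=> w [[]]].
by apply: measurableD => //; exact: measurableI.
Qed.

Lemma prob_split_discover H z (B : set Omega) : wf H -> z \notin known H -> measurable B ->
  P (evt H `&` B) = (\sum_(0 <= k <oo) P (evt (discover z k H) `&` B))%E.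
Proof.
move=> wH zH mB; have mE := measurable_evt eta S H.
have mk k : measurable (evt (discover z k H) `&` B).
  by apply: measurableI => //; exact: measurable_evt.
have eU : evt H `&` B = \bigcup_k (evt (discover z k H) `&` B).
  apply/seteqP; split => w.
    by case=> Ew Bw; exists (eta z w) => //; rewrite evt_discover.
  by case=> k _; rewrite evt_discover // => -[[]].
rewrite {1}eU; apply: measure_semi_bigcup => //; last by rewrite -eU; exact: measurableI.
by move=> j k _ _ [w]; rewrite !evt_discover // => -[[[_ /= <-] _] [[_ /= ->]]].
Qed.

End branching.

(** * Hitting probabilities and the frog model *)

Section branches.
Context (R : realType) (nu : probability nat R) (d : nat) (i0 : 'I_d).
Context (dO : measure_display) (Omega : measurableType dO) (P : probability Omega R).
Context (eta : vertex d -> {RV P >-> nat}) (S : vertex d -> nat -> nat -> {RV P >-> vertex d}).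
Hypothesis hmodel : frog_model nu eta S.
Implicit Types (u v x z : vertex d) (f : frog d) (w : Omega) (H : hist d).
Local Notation root := (root_vertex d).
Local Notation nb := (@neighbors d).
Local Notation evt := (evt eta S).

(** Counterpart of [topple] on histories. The 0 for a known [z] is a dummy: [step] ignores the
    number of frogs there. *)
Definition branch H f (Phi : hist d -> \bar R) : \bar R :=
  (\sum_(z <- nb (pos H f)) if z \in known H then Phi (step f z 0 H)
                            else \sum_(0 <= k <oo) Phi (step f z k H))%E.

Lemma branch_le H f (Phi Psi : hist d -> \bar R) :
  (forall z k, z \in nb (pos H f) ->
    0 <= Phi (step f z k H) /\ Phi (step f z k H) <= Psi (step f z k H))%E ->
  (branch H f Phi <= branch H f Psi)%E.
Proof.
move=> h; rewrite /branch big_seq [leRHS]big_seq; apply: lee_sum => z zx.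
case: ifP => _; first by case: (h z 0%N zx).
by apply: lee_nneseries => [k _ _|k _]; case: (h z k zx).
Qed.

Lemma branch_prob H f (B : set Omega) : wf H -> f \in frogs H -> measurable B ->
  P (evt H `&` B) = branch H f (fun H' => P (evt H' `&` B)).
Proof.
move=> wH fH mB; rewrite (prob_split_move i0 hmodel wH fH mB); apply: eq_bigr => z _.
rewrite /step; case zl: (z \in known H) => //; move/negbT: zl => zl.
exact: (prob_split_discover _ _ (wf_move z wH fH) zl mB).
Qed.

Lemma branch_top H f (g : state (vertex d) -> R) : wf H -> f \in frogs H ->
  (forall t, 0 <= g t <= 1) ->
  (P (evt H) * (topple nu nb (pos H f) g (st H))%:E)%E =
  branch H f (fun H' => P (evt H') * (g (st H'))%:E)%E.
Proof.
move=> wH fH g01; have bg := bnd01 g01.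
have g0 t : 0 <= g t by case/andP: (g01 t).
have top_sum : topple nu nb (pos H f) g (st H) = (size (nb (pos H f)))%:R^-1 *
    \sum_(z <- nb (pos H f)) awaken nu z g ((st H).1, mv (pos H f) z (st H).2).
  by rewrite /topple; have := neighbors_neq0 i0 (pos H f); case: (nb _).
rewrite top_sum mulr_sumr -sumEFin ge0_sume_distrr; last first.
  by move=> z _; rewrite lee_fin mulr_ge0 // wake_ge0 // => t; case/andP: (g01 t).
rewrite /branch; apply: eq_big_seq => z zx; rewrite EFinM muleA -(prob_move hmodel wH fH zx).
rewrite /step /awaken /=; case zl: (z \in known H); first by rewrite st_move.
move/negbT: zl => zl; rewrite Ex_series //; last exact: bnd_slice.
have fP := fin_num_measure P _ (measurable_evt eta S (move_frog f z H)).
rewrite -(fineK fP) -nneseriesZl; last by move=> k _; rewrite mule_ge0 // lee_fin.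
apply: eq_eseriesr => k _; have wM := wf_move z wH fH.
by rewrite (prob_discover hmodel k wM) // (fineK fP) -muleA st_discover // st_move.
Qed.

End branches.

Section lower_bound.
Context (R : realType) (nu : probability nat R) (d : nat) (i0 : 'I_d).
Context (dO : measure_display) (Omega : measurableType dO) (P : probability Omega R).
Context (eta : vertex d -> {RV P >-> nat}) (S : vertex d -> nat -> nat -> {RV P >-> vertex d}).
Hypothesis hmodel : frog_model nu eta S.
Implicit Types (u v x z : vertex d) (f : frog d) (w : Omega) (H : hist d).
Local Notation root := (root_vertex d).
Local Notation nb := (@neighbors d).
Local Notation evt := (evt eta S).
Local Notation etaw w := (fun v => eta v w).
Local Notation Sw w := (fun v i n => S v i n w).

Record consistent H : Prop := Consistent {
  consistent_wf : wf H;
  track_known : forall f k, f \in frogs H -> (k <= clock H f)%N -> track H f k \in known H;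
  hit_list_uniq : uniq (hit_list H);
  hit_listE : forall p, (p \in hit_list H) = [&& p.1 \in frogs H, (p.2 < clock H p.1)%N & track H p.1 p.2 == root];
  known_woken : forall w v, evt H w -> v \in known H -> woken (etaw w) (Sw w) v }.

Lemma evt_step f z k H : wf H -> f \in frogs H -> evt (step f z k H) =
  evt H `&` [set w | S f.1 f.2 (clock H f).+1 w = z /\ (z \notin known H -> eta z w = k)].
Proof.
move=> wH fH; rewrite /step; case: ifPn => zl.
  by rewrite evt_move //; apply/seteqP; split=> w [Hw] /=; [|case].
rewrite (evt_discover _ _ _ (wf_move z wH fH) zl) evt_move // -setIA.
by apply/seteqP; split=> w [Hw [/= h1 h2]]; split=> //; split=> //; exact: h2.
Qed.

Lemma consistent_step f z k H : consistent H -> f \in frogs H -> consistent (step f z k H).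
Proof.
move=> [wH pv uh hE vw] fH; have wS := wf_step z k wH fH.
have hEm p : (p \in hit_list (move_frog f z H)) = [&& p.1 \in frogs H, (p.2 < clock (move_frog f z H) p.1)%N &
    track (move_frog f z H) p.1 p.2 == root].
  case: p => g j /=; have e : ((g, j) \in (if pos H f == root then (f, clock H f) :: hit_list H else hit_list H)) =
      ((g, j) \in hit_list H) || [&& g == f, j == clock H f & pos H f == root].
    by case: ifP => _; rewrite ?andbF ?orbF // inE andbT orbC xpair_eqE.
  rewrite e hE /=; case: (eqVneq g f) => [->|_] /=; last by rewrite orbF.
  rewrite fH /=; case: (ltngtP j (clock H f)) => jl /=.
  - by rewrite orbF ltnS ltnW // ltn_eqF // (ltn_trans jl).
  - by rewrite ltnNge jl.
  - by rewrite jl ltnSn ltn_eqF.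
have uhm : uniq (hit_list (move_frog f z H)).
  by rewrite /=; case: ifP => _ //=; rewrite uh andbT hE /= ltnn andbF.
have pvm g j : g \in frogs H -> (j <= clock (move_frog f z H) g)%N ->
    (track (move_frog f z H) g j == z) || (track (move_frog f z H) g j \in known H).
  rewrite /= => gH; case: (eqVneq g f) => [->|_] /=; last by move=> /(pv _ _ gH) ->; rewrite orbT.
  case: (eqVneq j _) => [_|jl]; first by rewrite eqxx.
  by rewrite leq_eqVlt (negPf jl) ltnS /= => /(pv _ _ fH) ->; rewrite orbT.
have wz w : evt (step f z k H) w -> woken (etaw w) (Sw w) z.
  rewrite evt_step // => -[Hw [<- _]]; apply: (woken_step (v := f.1)).
    by apply: (vw w) => //; have := fH; rewrite (frogsE wH) => /andP[].
  have [_ hv _] := (evtP _ _ _ _).1 Hw.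
  by have := fH; rewrite (frogsE wH) => /andP[fv]; rewrite hv.
have vlS v : v \in known (step f z k H) -> (v == z) || (v \in known H).
  by rewrite /step; case: ifP => _ /=; rewrite ?inE // => ->; rewrite orbT.
split=> //.
- move=> g j gS; have zS : z \in known (step f z k H).
    by rewrite /step; case: ifP => //= _; rewrite inE eqxx.
  have sub v : v \in known H -> v \in known (step f z k H).
    by rewrite /step; case: ifP => //= _ vH; rewrite inE vH orbT.
  case gH: (g \in frogs H).
    have := pvm g j gH; rewrite /step; case: ifPn => zl h /h /orP[/eqP ->|] //=.
      by rewrite inE eqxx.
    by rewrite inE => ->; rewrite orbT.
  have [] := fresh wH (negbT gH); move: gS; rewrite /step; case: ifPn => zl; rewrite /= ?gH //.
  rewrite mem_cat mem_newfrogs gH orbF => /andP[/eqP gz _] l0 p0.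
  have -> : (g == f) = false by apply: contraFF gH => /eqP ->.
  by rewrite l0 leqn0 => /eqP -> /=; rewrite p0 gz inE eqxx.
- by rewrite /step; case: ifP.
- move=> p; rewrite /step; case: ifPn => zl; first exact: hEm.
  rewrite [LHS]hEm [clock _ _]/= [track _ _ _]/= /= mem_cat mem_newfrogs.
  case pH: (p.1 \in frogs H); first by rewrite orbT.
  have pf : (p.1 == f) = false by apply: contraFF pH => /eqP ->.
  by have [l0 _] := fresh wH (negbT pH); rewrite pf l0 /= andbF.
- move=> w v Hw /vlS /predU1P[->|vH]; first exact: wz.
  by apply: vw vH; move: Hw; rewrite evt_step // => -[].
Qed.

Definition hits_event m : set Omega := [set w | root_hits_ge (etaw w) (Sw w) m].

Lemma measurable_reach n v : measurable [set w | reach (etaw w) (Sw w) n v].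
Proof.
elim: n v => [|n IH] v /=; first exact: measurable_cst_prop.
apply: measurable_or; first exact: measurable_cst_prop.
apply: measurable_exists => f; apply: measurable_exists => k.
rewrite (_ : [set w | _] = [set w | reach (etaw w) (Sw w) n f.1] `&`
  ([set w | (f.2 < eta f.1 w)%N] `&` [set w | S f.1 f.2 k.+1 w = v])); last first.
  by apply/seteqP; split=> w; [case|case=> ? []].
apply: measurableI; first exact: IH.
apply: measurableI; first exact: (measurable_eta eta f.1 (fun j => (f.2 < j)%N)).
exact: (measurable_walk S f.1 f.2 k.+1 (fun z => z = v)).
Qed.

Lemma measurable_hits m : measurable (hits_event m).
Proof.
rewrite (_ : hits_event m = [set w | exists l : seq (frog d * nat), (uniq l /\ size l = m) /\
   forall p, p \in l -> root_hits (etaw w) (Sw w) p]); last first.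
  by apply/seteqP; split=> w [l]; [case=> ul sl hl; exists l|case=> -[ul sl] hl; exists l].
apply: measurable_exists => l; apply: measurable_and; first exact: measurable_cst_prop.
apply: measurable_forall => p; apply: measurable_imply => _.
rewrite (_ : [set w | _] = [set w | exists n, reach (etaw w) (Sw w) n p.1.1] `&`
  ([set w | (p.1.2 < eta p.1.1 w)%N] `&` [set w | S p.1.1 p.1.2 p.2 w = root])); last first.
  by apply/seteqP; split=> w; [case|case=> ? []].
apply: measurableI; first by apply: measurable_exists => n; exact: measurable_reach.
apply: measurableI; first exact: (measurable_eta eta p.1.1 (fun j => (p.1.2 < j)%N)).
exact: (measurable_walk S p.1.1 p.1.2 p.2 (fun z => z = root)).
Qed.

Lemma evt_hits H : consistent H -> evt H `<=` hits_event (size (hit_list H)).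
Proof.
move=> [wH pv uh hE vw] w Hw; exists (hit_list H); split=> // p.
rewrite hE => /and3P[pH pl /eqP e]; have [_ hv hf] := (evtP _ _ _ _).1 Hw.
have := pH; rewrite (frogsE wH) => /andP[vH lt]; split; first exact: vw vH.
  by rewrite hv.
by rewrite hf // ltnW.
Qed.

(** The conditional probability of enough hits, given a history, is an admissible bound for the
    state of that history. Histories with equal states may give different values, hence the
    relational form; null histories are set aside because conditioning on them is meaningless. *)
Lemma phi_le_prob m H : consistent H ->
  (P (evt H) * (hit_value nu nb root m (st H))%:E <= P (evt H `&` hits_event (size (hit_list H) + m)))%E.
Proof.
move=> cH; have mE H' := measurable_evt eta S H'; have mB n := measurable_hits n.
have fE H' : P (evt H') \is a fin_num by exact: fin_num_measure.
have mI H' n : measurable (evt H' `&` hits_event n) by exact: measurableI.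
have fI H' n : P (evt H' `&` hits_event n) \is a fin_num by exact: fin_num_measure.
have [P0|P0] := eqVneq (P (evt H)) 0%E; first by rewrite P0 mul0e.
pose Q n s (v : R) := exists H', [/\ consistent H', st H' = s, P (evt H') != 0%E &
  (P (evt H' `&` hits_event (size (hit_list H') + n)) = P (evt H') * v%:E)%E].
have posE H' : P (evt H') != 0%E -> 0 < fine (P (evt H')).
  by move=> h; rewrite fine_gt0 // lt0e h measure_ge0 ltey_eq fE.
have val H' n : consistent H' -> P (evt H') != 0%E ->
    Q n (st H') (fine (P (evt H' `&` hits_event (size (hit_list H') + n))) / fine (P (evt H'))).
  move=> cH' h; exists H'; split=> //.
  by rewrite -{1}(fineK (fE H')) -EFinM mulrCA mulfV ?mulr1 ?fineK // gt_eqF ?posE.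
suff main : hit_value nu nb root m (st H) <=
    fine (P (evt H `&` hits_event (size (hit_list H) + m))) / fine (P (evt H)).
  rewrite -(fineK (fE H)) -(fineK (fI H _)) -EFinM lee_fin mulrC -ler_pdivlMr //; exact: posE.
apply: (phi_rel (Q := Q)) (val _ _ cH P0) => {m H cH P0}.
- move=> n s v [H [_ _ P0 e]]; have : (0 <= P (evt H `&` hits_event (size (hit_list H) + n)))%E by exact: measure_ge0.
  by rewrite e -(fineK (fE H)) -EFinM lee_fin pmulr_rge0 // posE.
- move=> s v [H [cH _ P0]]; rewrite addn0 (setIidl (evt_hits cH)) -(fineK (fE H)) -EFinM => -[e].
  have := posE _ P0; nra.
move=> n s v x g [H [cH <- P0 e]] sx g01 hg; have [f fH fx] := st_gt0 sx.
have wH := consistent_wf cH; rewrite -fx in hg *.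
suff : (P (evt H) * (topple nu nb (pos H f) g (st H))%:E <= P (evt H) * v%:E)%E.
  by rewrite -(fineK (fE H)) -!EFinM lee_fin ler_pM2l // posE.
rewrite -e (branch_prob i0 hmodel wH fH (mB _)) (branch_top i0 hmodel wH fH g01).
apply: branch_le => z k zx; set H' := step f z k H.
have cH' : consistent H' by exact: consistent_step.
split; first by rewrite mule_ge0 // lee_fin; case/andP: (g01 (st H')).
have [P0'|P0'] := eqVneq (P (evt H')) 0%E; first by rewrite P0' mul0e.
have := hg _ _ (val H' (n.+1 - (pos H f == root))%N cH' P0').
have -> : (size (hit_list H') + (n.+1 - (pos H f == root)))%N = (size (hit_list H) + n.+1)%N.
  by rewrite size_hit_list_step; case: (_ == _); rewrite /=; lia.
rewrite ler_pdivlMr ?posE // mulrC => h.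
by rewrite -(fineK (fE H')) -(fineK (fI H' _)) -EFinM lee_fin.
Qed.

End lower_bound.

Section upper_bound.
Context (R : realType) (nu : probability nat R) (d : nat) (i0 : 'I_d).
Context (dO : measure_display) (Omega : measurableType dO) (P : probability Omega R).
Context (eta : vertex d -> {RV P >-> nat}) (S : vertex d -> nat -> nat -> {RV P >-> vertex d}).
Hypothesis hmodel : frog_model nu eta S.
Implicit Types (u v x z : vertex d) (f g : frog d) (w : Omega) (H : hist d) (l : seq (frog d)).
Local Notation root := (root_vertex d).
Local Notation nb := (@neighbors d).
Local Notation evt := (evt eta S).
Local Notation consistent := (consistent eta S).
Local Notation hits_event := (hits_event eta S).

(** A frog not yet discovered is skipped, so one deterministic schedule serves all realizations. *)
Definition reveal w H f : hist d :=
  let z := S f.1 f.2 (clock H f).+1 w in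
  if f \in frogs H then step f z (eta z w) H else H.

Definition run w l H : hist d := foldl (reveal w) H l.

Lemma reveal_step w H f z k : wf H -> f \in frogs H -> evt (step f z k H) w ->
  reveal w H f = step f z k H.
Proof.
move=> wH fH; rewrite evt_step // /reveal fH => -[_ [-> he]].
by rewrite /step; case: ifPn => // /he ->.
Qed.

Lemma measurable_run l H (X : hist d -> Prop) : measurable [set w | X (run w l H)].
Proof.
elim: l H => [|f l IH] H /=; first exact: measurable_cst_prop.
rewrite (_ : [set w | _] = [set w | exists z k,
  (S f.1 f.2 (clock H f).+1 w = z /\ eta z w = k) /\
    X (run w l (if f \in frogs H then step f z k H else H))]).
  apply: measurable_exists => z; apply: measurable_exists => k.
  apply: measurable_and => //; apply: measurable_and.
    exact: (measurable_walk S f.1 f.2 (clock H f).+1 (fun y => y = z)).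
  exact: (measurable_eta eta z (fun y => y = k)).
apply/seteqP; split=> w /=.
  move=> h; exists (S f.1 f.2 (clock H f).+1 w), (eta (S f.1 f.2 (clock H f).+1 w) w).
  by split.
by move=> [_ [_ [[<- <-]]]].
Qed.

(** Each revealed step is one toppling, under which the value is invariant by [phi_top]; the
    inequality comes from stopping when the list ends. *)
Lemma prob_run_le l m H : wf H ->
  (P (evt H `&` [set w | size (hit_list H) + m <= size (hit_list (run w l H))]%N) <=
    P (evt H) * (hit_value nu nb root m (st H))%:E)%E.
Proof.
have mE H' := measurable_evt eta S H'.
have mR l' H' c : measurable [set w | (c <= size (hit_list (run w l' H')))%N].
  exact: (measurable_run l' H' (fun H'' => (c <= size (hit_list H''))%N)).
elim: l m H => [|f l IH] [|m] H wH.
- by rewrite phi0 mule1; apply: le_measure; rewrite ?inE //; exact: measurableI.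
- rewrite (_ : _ `&` _ = set0); first by rewrite measure0 mule_ge0 // lee_fin phi_ge0.
  by apply/seteqP; split=> w // -[_] /=; lia.
- by rewrite phi0 mule1; apply: le_measure; rewrite ?inE //; exact: measurableI.
have [fH|fH] := boolP (f \in frogs H); last first.
  rewrite (_ : [set w | _] = [set w | size (hit_list H) + m.+1 <= size (hit_list (run w l H))]%N).
    exact: IH.
  by apply/seteqP; split=> w; rewrite /= /reveal (negPf fH).
rewrite (branch_prob i0 hmodel wH fH) // -(phi_top nu nb root m (st_pos fH)).
rewrite (branch_top i0 hmodel wH fH); last by move=> t; exact: phi01.
apply: branch_le => z k zx; split; first exact: measure_ge0.
have wS := wf_step z k wH fH.
apply: le_trans (IH _ _ wS); apply: le_measure; rewrite ?inE //; try exact: measurableI.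
move=> w [Ew hb]; split=> //; move: hb => /=; rewrite (reveal_step wH fH Ew) size_hit_list_step.
by case: (_ == _) => /=; lia.
Qed.

Definition extends H H' : Prop :=
  [/\ {subset known H <= known H'}, {subset frogs H <= frogs H'},
      forall g, (clock H g <= clock H' g)%N & {subset hit_list H <= hit_list H'}].

Lemma extends_trans H H' H'' : extends H H' -> extends H' H'' -> extends H H''.
Proof.
move=> [a b c e] [a' b' c' e']; split=> [v /a/a'|g /b/b'|g|p /e/e'] //.
exact: leq_trans (c g) (c' g).
Qed.

Lemma reveal_extends w H f : extends H (reveal w H f).
Proof.
rewrite /reveal; case: ifP => [fH|_]; last by split.
move: (S f.1 f.2 (clock H f).+1 w) => z; move: (eta z w) => k.
have sm : {subset hit_list H <= hit_list (move_frog f z H)}.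
  by move=> p /=; case: ifP => // _; rewrite inE orbC => ->.
have lm g : (clock H g <= clock (move_frog f z H) g)%N by rewrite /=; case: eqP => [->|].
rewrite /step; case: ifP => _; first by split; [move=> v|move=> g|exact: lm|exact: sm].
split; [| |exact: lm|exact: sm] => [v vH|g gH]; first by rewrite /= inE vH orbT.
by rewrite /= mem_cat gH orbT.
Qed.

Lemma reveal_ln w H f : f \in frogs H -> (clock H f < clock (reveal w H f) f)%N.
Proof. by move=> fH; rewrite /reveal fH /step; case: ifP => _ /=; rewrite eqxx. Qed.

Lemma run_extends w l H : extends H (run w l H).
Proof.
elim: l H => [|f l IH] H /=; first by split.
exact: extends_trans (reveal_extends w H f) (IH _).
Qed.

Lemma run_ln w l H f : f \in l -> f \in frogs H -> (clock H f < clock (run w l H) f)%N.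
Proof.
elim: l H => // g l IH H; rewrite inE => /predU1P[<-|fl'] fH /=.
  by have [_ _ /(_ f) h _] := run_extends w l (reveal w H f); exact: leq_trans (reveal_ln w fH) h.
have [_ /(_ f fH) fr /(_ f) h _] := reveal_extends w H g.
exact: leq_ltn_trans h (IH _ fl' fr).
Qed.

Lemma run_consistent w l H : consistent H -> evt H w ->
  consistent (run w l H) /\ evt (run w l H) w.
Proof.
elim: l H => [|f l IH] H cH Hw //=; apply: IH; rewrite /reveal; case: ifP => // fH.
  exact: consistent_step.
by rewrite evt_step //; exact: consistent_wf cH.
Qed.

(* Every frog is scheduled infinitely often. *)
Fixpoint schedule (N : nat) : seq (frog d) :=
  if N is N'.+1 then schedule N' ++ pmap choice.unpickle (iota 0 N) else [::].

Definition hist0 : hist d :=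
  Hist [:: root] (fun=> 1%N) [:: (root, 0%N)] (fun=> 0%N) (fun f _ => f.1) [::].

Lemma evt_hist0 : evt hist0 = all_start S.
Proof.
apply/seteqP; split=> w; first by case.
move=> sw; apply/evtP; split=> // [v|f]; rewrite inE => /eqP ->.
  exact: (frog_root hmodel).
by move=> k; rewrite leqn0 => /eqP ->; exact: (sw (root, 0%N)).
Qed.

Lemma consistent_hist0 : consistent hist0.
Proof.
split=> //=.
- split=> //=.
  by case=> v [|i]; rewrite /= !inE ?xpair_eqE /= ?andbT ?andbF.
- by move=> f k; rewrite !inE => /eqP ->.
- by case=> f k; rewrite /= ?in_nil ?ltn0 ?andbF.
- by move=> w v _; rewrite inE => /eqP ->; exact: woken_root.
Qed.

Lemma st_hist0 : st hist0 = single root.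
Proof.
congr (_, _); apply/funext => v; first by rewrite inE.
by rewrite /= addn0 eq_sym.
Qed.

(** Fairness: every discovered frog is eventually followed as far as desired ([grow]), so every
    woken vertex becomes known, by induction along the wakings, and every hit of the finite list is
    recorded. *)
Lemma schedule_complete w m : all_start S w -> hits_event m w ->
  exists N, (m <= size (hit_list (run w (schedule N) hist0)))%N.
Proof.
move=> sw [l [ul <- hl]]; pose K N := run w (schedule N) hist0.
have [cK EK] : (forall N, consistent (K N)) /\ (forall N, evt (K N) w).
  have h N : consistent (K N) /\ evt (K N) w.
    by apply: run_consistent; [exact: consistent_hist0|rewrite evt_hist0].
  by split=> N; case: (h N).
have KS N : K N.+1 = run w (pmap choice.unpickle (iota 0 N.+1)) (K N).
  by rewrite /K /run -foldl_cat.
have KE N N' : (N <= N')%N -> extends (K N) (K N').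
  move=> /subnKC <-; elim: (N' - N)%N => [|j IH]; first by rewrite addn0; split.
  by rewrite addnS KS; exact: extends_trans IH (run_extends _ _ _).
have grow N f j : f \in frogs (K N) -> exists2 N', (N <= N')%N & (j <= clock (K N') f)%N.
  move=> fK; elim: j => [|j [N' NN' jN']]; first by exists N.
  (* Round M + 1 schedules all frogs of code at most M, hence [f] once more, after round N'. *)
  set M := maxn N' (choice.pickle f); have N'M : (N' <= M)%N by exact: leq_maxl.
  have fM : f \in frogs (K M) by have [_ h _ _] := KE N M (leq_trans NN' N'M); exact: h.
  exists M.+1; first by rewrite leqW // (leq_trans NN').
  have [_ _ /(_ f) h _] := KE N' M N'M; apply: leq_ltn_trans (leq_trans jN' h) _.
  rewrite KS; apply: run_ln => //; rewrite mem_pmap; apply/mapP.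
  exists (choice.pickle f); last by rewrite choice.pickleK.
  by rewrite mem_iota add0n ltnS leq0n leq_maxr.
have flK N v i : v \in known (K N) -> (i < eta v w)%N -> (v, i) \in frogs (K N).
  move=> vK ie; rewrite (frogsE (consistent_wf (cK N))) vK /=.
  by have [_ <- //] := (evtP _ _ _ _).1 (EK N).
have psK N f k : f \in frogs (K N) -> (k <= clock (K N) f)%N -> S f.1 f.2 k w = track (K N) f k.
  by move=> fK kl; have [_ _ h] := (evtP _ _ _ _).1 (EK N); exact: h.
have wok v : woken (fun v => eta v w) (fun v i n => S v i n w) v -> exists N, v \in known (K N).
  move: v; apply: (woken_ind (Q := fun v => exists N, v \in known (K N))).
    by exists 0%N; rewrite /= inE.
  move=> v i k [N vK] ie; have fK := flK N v i vK ie.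
  have [N' NN' kN'] := grow N _ k.+1 fK; exists N'.
  have [_ h _ _] := KE _ _ NN'; have fK' := h _ fK.
  by have := psK N' _ _ fK' kN'; rewrite /= => ->; exact: (track_known (cK N')).
have hit p : p \in l -> exists N, p \in hit_list (K N).
  move=> /hl [/wok[N vK] ie e]; have fK := flK N p.1.1 p.1.2 vK ie.
  rewrite -surjective_pairing in fK; have [N' NN' kN'] := grow N _ p.2.+1 fK; exists N'.
  have [_ h _ _] := KE _ _ NN'; have fK' := h _ fK.
  by rewrite (hit_listE (cK N')) fK' kN' /= -(psK N' _ _ fK' (ltnW kN')) e.
suff [N hN] : exists N, {subset l <= hit_list (K N)} by exists N; exact: uniq_leq_size ul hN.
elim: (l) hit => [|p l' IH] hit; first by exists 0%N.
have [N1 h1] := hit p (mem_head _ _).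
have [N2 h2] : exists N, {subset l' <= hit_list (K N)}.
  by apply: IH => q ql; apply: hit; rewrite inE ql orbT.
exists (maxn N1 N2) => q; rewrite inE => /predU1P[->|/h2].
  by have [_ _ _ h] := KE N1 _ (leq_maxl N1 N2); exact: h.
by have [_ _ _ h] := KE N2 _ (leq_maxr N1 N2); exact: h.
Qed.

(** The lower bound is [phi_le_prob] at the initial history. For the upper bound the hit event is
    exhausted by the increasing events that m departures are recorded after N rounds, each
    controlled by [prob_run_le]. *)
Lemma prob_hits m : P (hits_event m) = (hit_value nu nb root m (single root))%:E.
Proof.
have mV := measurable_hits eta S m.
have P1 : P (evt hist0) = 1%E by rewrite evt_hist0 (prob_all_start hmodel).
have cH := consistent_hist0; have wH := consistent_wf cH.
have PV : P (evt hist0 `&` hits_event m) = P (hits_event m).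
  by rewrite evt_hist0 (prob_all_startI hmodel).
apply/eqP; rewrite eq_le; apply/andP; split; last first.
  by have := phi_le_prob i0 hmodel m cH; rewrite P1 mul1e add0n PV st_hist0.
pose A N := evt hist0 `&` [set w | size (hit_list hist0) + m <= size (hit_list (run w (schedule N) hist0))]%N.
have mA N : measurable (A N).
  apply: measurableI; first exact: measurable_evt.
  exact: (measurable_run _ _ (fun H => (size (hit_list hist0) + m <= size (hit_list H))%N)).
have mU : measurable (\bigcup_N A N) by exact: bigcupT_measurable.
rewrite -PV; apply: (@le_trans _ _ (P (\bigcup_N A N))).
  apply: le_measure; rewrite ?inE //; first exact: measurableI (measurable_evt _ _ _) mV.
  move=> w [Ew Vw]; have sw : all_start S w by rewrite -evt_hist0.
  by have [N hN] := schedule_complete sw Vw; exists N.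
have ndA : nondecreasing_seq A.
  apply/nondecreasing_seqP => N; apply/subsetPset => w [Ew hw]; split=> //.
  apply: leq_trans hw _; rewrite /= /run foldl_cat; apply: uniq_leq_size.
    by have [] := run_consistent (schedule N) cH Ew => /hit_list_uniq.
  by have [_ _ _] := run_extends w (pmap choice.unpickle (iota 0 N.+1)) (run w (schedule N) hist0).
have cvA := nondecreasing_cvg_mu (mu := P) mA mU ndA.
apply: (cvge_le _ cvA); apply: nearW => N.
by apply: le_trans (prob_run_le (schedule N) m wH) _; rewrite P1 mul1e st_hist0.
Qed.

End upper_bound.

Theorem theorem4 (R : realType) (d : nat) (hd : (1 <= d)%N)
    (nu : probability nat R)
    (dO : measure_display) (Omega : measurableType dO)
    (P : probability Omega R)
    (eta : vertex d -> {RV P >-> nat})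
    (S : vertex d -> nat -> nat -> {RV P >-> vertex d})
    (hmodel : frog_model nu eta S) :
  let rec_event : set Omega :=
    [set w | recurrent (fun v => eta v w) (fun v i n => S v i n w)] in
  measurable rec_event /\ (P rec_event = 0%E \/ P rec_event = 1%E).
Proof.
move=> rec_event; have mV m := measurable_hits eta S m.
have recE : rec_event = \bigcap_m hits_event eta S m.
  apply/seteqP; split=> w; rewrite /rec_event /= recurrentP infinite_root_hits => h.
    by move=> m _; exact: h.
  by move=> m; exact: (h m I).
have mrec : measurable rec_event by rewrite recE; exact: bigcapT_measurable.
split=> //; pose i0 : 'I_d := Ordinal hd.
have [p0|phi1] := phi_zero_one nu i0; [left|right]; last first.
  by rewrite recE; apply: prob_bigcap1 => // m; rewrite (prob_hits i0 hmodel) phi1.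
apply/eqP; rewrite eq_le measure_ge0 andbT.
have fP : P rec_event \is a fin_num by exact: fin_num_measure.
(* Recurrence implies m hits for each m, so its probability is at most every [phi m], hence at most
   [psi], which is 0 here. *)
rewrite -(fineK fP) lee_fin -[leRHS]p0; apply: psi_ge => m.
rewrite -lee_fin (fineK fP) -(prob_hits i0 hmodel).
by apply: le_measure; rewrite ?inE // recE => w; apply.
Qed.
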